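(* Let $\alpha>0$ be a constant with $\alpha\neq 1$. For each $n$ (in an infinite set of positive integers, with $n\to\infty$) let $G=G^{(n)}$ be a $d$-regular graph on vertex set $\{1,\dots,n\}$, $d=d(n)$, and let $\lambda=\lambda(G)$ be the maximum absolute value of the eigenvalues $\lambda_2,\dots,\lambda_n$ of its adjacency matrix. Assume that $d\to\infty$ and $\lambda=o(d)$ as $n\to\infty$. Let $G_p$ be the random subgraph of $G$ obtained by keeping each edge of $G$ independently with probability $p=\frac{\alpha}{d}$. Let $\omega=\omega(n)\to\infty$ as $n\to\infty$, and let $\zeta$ be defined by $\zeta^{-1}=\alpha-1-\log\alpha>0$. (a) If $d\gg(\log n)^2$, then with high probability $G_p$ contains no isolated tree of size at least $\zeta\left(\log n-\frac52\log\log n\right)+\omega$. (b) If $d\gg(\log n)^2$, then with high probability $G_p$ contains an isolated tree of size at least $\zeta\left(\log n-\frac52\log\log n\right)-\omega$. (c) If $d=\Omega(n)$, then with high probability $G_p$ contains at most $\omega$ vertices on unicyclic components. (d) Let $d\gg\sqrt n$. If $\alpha<1$, then with high probability $G_p$ contains no component with $k$ vertices and more than $k$ edges, for any $k$. (e) Let $d\gg\sqrt n$. If $\alpha>1$, then with high probability $G_p$ contains no component with $k=o(n)$ vertices and more than $k$ edges; that is, for every function $s(n)=o(n)$, with high probability there is no component of $G_p$ having $k\le s(n)$ vertices and more than $k$ edges.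
   Context: All graphs are simple. The eigenvalues $d=\lambda_1\ge\lambda_2\ge\cdots\ge\lambda_n$ of a $d$-regular graph $G$ on $n$ vertices are those of its adjacency matrix, and $\lambda(G)=\max_{2\le i\le n}|\lambda_i|$. The size of a component or tree is its number of vertices. An isolated tree of $G_p$ is a connected component of $G_p$ that is a tree; a unicyclic component is a connected component containing exactly one cycle (equivalently, with as many edges as vertices). An event holds with high probability if its probability tends to $1$ as $n\to\infty$. The notation $f(n)\gg g(n)$ means $f(n)/g(n)\to\infty$ as $n\to\infty$, and $\log$ is the natural logarithm. Here $n$ is assumed as large as needed (in particular so that $p\le1$). *)

(* Defs.v *)
From mathcomp Require Import all_boot all_order all_algebra.
From mathcomp Require Import polyrcf spectral complex.
From mathcomp Require Import all_classical all_reals all_analysis.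

Set Implicit Arguments.
Unset Strict Implicit.
Unset Printing Implicit Defensive.

Import Order.TTheory GRing.Theory Num.Theory.
Import numFieldNormedType.Exports.

Local Open Scope ring_scope.

(* A simple graph on the vertex type T is given by its set of edges, each edge
   being a two-element set of vertices. *)
Section Graphs.
Variable T : finType.
Implicit Types (E F : {set {set T}}) (C : {set T}).

Definition simple_graph E : bool := [forall f in E, #|f| == 2].

Definition adj E : rel T := fun u v => [set u; v]%SET \in E.

Definition regular (d : nat) E : bool :=
  [forall v, #|[set u | adj E v u]%SET| == d].

Definition component E (v : T) : {set T} := [set u | connect (adj E) v u]%SET.

Definition components E : {set {set T}} := [set component E v | v : T]%SET.

Definition edges_in E C : {set {set T}} := [set f in E | f \subset C]%SET.

(* A cycle is identified with its edge set, so that the rotations and the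
   reversal of a cyclic sequence of vertices count as a single cycle. *)
Definition is_cycle_in E C F : bool :=
  [exists k : 'I_#|T|.+1, exists p : k.-tuple T,
    [&& (2 < k)%N, cycle (adj E) p, uniq p, all [in C] p
      & F == [set [set x; next p x]%SET | x in val p]%SET]].

Definition cycles_in E C : {set {set {set T}}} :=
  [set F | is_cycle_in E C F]%SET.

Definition isolated_tree E C : bool :=
  (C \in components E) && (#|cycles_in E C| == 0%N).

Definition unicyclic_component E C : bool :=
  (C \in components E) && (#|cycles_in E C| == 1%N).

Definition unicyclic_vertices E : {set T} :=
  (\bigcup_(C : {set T} | unicyclic_component E C) C)%SET.

Definition excess_component E C : bool :=
  (C \in components E) && (#|C| < #|edges_in E C|)%N.

(* The probability that the random subgraph of E, in which every edge is kept
   independently with probability p, belongs to the event A. *)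
Definition subgraph_prob (R : realType) E (p : R) (A : pred {set {set T}}) : R :=
  \sum_(H : {set {set T}} | (H \subset E) && A H)
    p ^+ #|H| * (1 - p) ^+ #|(E :\: H)%SET|.

End Graphs.

Section Spectrum.
Variable R : realType.

Definition adjmx (n : nat) (E : {set {set 'I_n}}) : 'M[R]_n :=
  \matrix_(u, v) (adj E u v)%:R.

(* The real roots of the characteristic polynomial with multiplicity, in
   nonincreasing order; for a symmetric matrix these are all its roots, see
   char_poly_eigenvalues below. *)
Definition eigenvalues (n : nat) (A : 'M[R]_n) : seq R :=
  let p := char_poly A in
  sort >=%R (flatten [seq nseq (mup x p) x | x <- rootsR p]).

Lemma char_poly_eigenvalues (n : nat) (A : 'M[R]_n) :
  A^T = A -> char_poly A = \prod_(x <- eigenvalues A) ('X - x%:P).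
Proof.
move=> symA.
pose B : 'M[R[i]]_n := map_mx (real_complex R) A.
have hB : B \is hermsymmx.
  apply: realsym_hermsym.
    by apply/is_hermitianmxP; rewrite expr0 scale1r map_mx_id // map_trmx symA.
  by apply/mxOverP => i j; rewrite mxE complex_real.
pose D := spectral_diag B.
have realD j : real_complex R (complex.Re (D 0 j)) = D 0 j.
  have /mxOverP/(_ 0 j) := hermitian_spectral_diag_real hB.
  by move=> /RRe_real.
have eqB : spectralmx B *m B = diag_mx D *m spectralmx B.
  have /hermitian_normalmx/orthomx_spectralP {2}-> := hB.
  by rewrite !mulmxA mulmxV ?spectral_unit // mul1mx.
have cpB : char_poly B = \prod_(j < n) ('X - (D 0 j)%:P).
  have uP : map_mx polyC (spectralmx B) \in unitmx.
    by rewrite unitmxE det_map_mx rmorph_unit // -unitmxE spectral_unit.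
  have -> : \prod_(j < n) ('X - (D 0 j)%:P) = char_poly (diag_mx D).
    rewrite char_poly_trig ?diag_mx_is_trig //.
    by apply: eq_bigr => j _; rewrite mxE eqxx mulr1n.
  rewrite /char_poly; apply: (mulrI (x := \det (map_mx polyC (spectralmx B)))).
    by rewrite -unitmxE.
  rewrite -det_mulmx [RHS]mulrC -det_mulmx; congr (\det _).
  rewrite /char_poly_mx mulmxBr mulmxBl scalar_mxC -!map_mxM eqB //.
pose s := [seq complex.Re (D 0 j) | j <- enum 'I_n].
have cpA : char_poly A = \prod_(x <- s) ('X - x%:P).
  apply: (map_poly_inj (real_complex R)); rewrite map_char_poly -/B cpB.
  rewrite rmorph_prod /= big_map big_enum /=.
  by apply: eq_bigr => j _; rewrite map_polyXsubC /= realD.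
have pN0 : char_poly A != 0 by rewrite monic_neq0 ?char_poly_monic.
rewrite {1}cpA; apply: perm_big.
rewrite perm_sym perm_sort; apply/allP => x _ /=; apply/eqP.
rewrite -(mu_prod_XsubC x s) -cpA count_flatten -map_comp.
have -> : sumn [seq (count_mem x \o (fun y => nseq (mup y (char_poly A)) y)) i
               | i <- rootsR (char_poly A)]
    = (\sum_(i <- rootsR (char_poly A) | i == x) mup i (char_poly A))%N.
  rewrite sumnE big_map [RHS]big_mkcond /=; apply: eq_bigr => i _.
  by rewrite count_nseq /=; case: eqP => _; rewrite ?mul1n ?mul0n.
have [xr|xr] := boolP (x \in rootsR (char_poly A)).
  by rewrite -big_filter (filter_pred1_uniq (uniq_roots _ _ _) xr) big_seq1.
rewrite big1_seq => [|y /andP[/eqP-> yr]]; last by rewrite yr in xr.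
rewrite mupNroot //; apply: contra xr.
by have /(_ x) := roots_on_rootsR pN0; rewrite !inE /= => <-.
Qed.

Definition second_eigenvalue (n : nat) (E : {set {set 'I_n}}) : R :=
  \big[Num.max/0]_(x <- behead (eigenvalues (adjmx E))) `|x|.

End Spectrum.

Section Asymptotics.
Variable R : realType.
Local Open Scope classical_set_scope.

(* n tends to infinity inside the index set S *)
Definition along (S : set nat) : set_system nat := within S \oo.

#[global] Instance along_filter (S : set nat) : Filter (along S).
Proof. exact: within_filter. Qed.

Definition much_larger (S : set nat) (f g : nat -> R) : Prop :=
  f n / g n @[n --> along S] --> +oo.

Definition whp (S : set nat) (G : forall n, {set {set 'I_n}}) (p : nat -> R)
    (A : forall n, pred {set {set 'I_n}}) : Prop :=
  subgraph_prob (G n) (p n) (A n) @[n --> along S] --> (1 : R).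

Definition zeta (alpha : R) : R := (alpha - 1 - ln alpha)^-1.

End Asymptotics.

Arguments much_larger : clear implicits.

(* Main.v *)
(* A tree K on a vertex set C of size k is a component of the random subgraph
   when its k-1 edges are kept and the other edges of G touching C are
   deleted.  Cutting a tree at an edge gives a recursion for the number of
   k-vertex trees of G through a vertex that avoid a given set X; by Abel's
   identity its solution for a tree-like graph is d^(k-1) k^(k-1)/k!, which is
   always an upper bound, and (d-|X|-k)^(k-1) k^(k-1)/k! is a lower bound.  By
   the expander mixing lemma C spans at most dk(k/n + lambda/d)/2 edges, so
   that all but few of the dk edge ends at C leave C.

   With eta = alpha - 1 - log alpha, the expected number of isolated trees of
   size k is then about n k^(-5/2) e^(-eta k) for small k, whence (a) by the
   first and (b) by the second moment method.  For sizes up to eps n, a spanning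
   tree together with j further edges costs at most n d^(-j) k^(2j) e^(-eta k/2),
   and summing over k gives O(n d^(-j)): take j = 0 in (a), j = 1 in (c) and
   j = 2 in (d) and (e).  Components with at least eps n vertices and at most one
   cycle are exponentially unlikely, by the union bound over all sets; for
   alpha < 1 there are no components of linear size at all, since counting paths
   bounds the mean size of the component of a vertex by 1/(1-alpha). *)

Require Import Defs.
From mathcomp Require Import all_boot.

Set Implicit Arguments.
Unset Strict Implicit.
Unset Printing Implicit Defensive.

(** * Trees in finite graphs *)

(** Cycles are traded for edges at once: a component has at least as many cycles as edges beyond a
    spanning tree, so an isolated tree on [k] vertices has [k - 1] edges, a unicyclic component has
    [k], and excess components have at least two extra edges. After that only edge counts occur.
    Each condition on [d] comes from one error term. A [k]-set may span [k^2 / 2] edges of the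
    graph, and two disjoint [k]-sets may be joined by [k^2]; either changes a probability by a
    factor [exp(O(k^2 / d))], harmless for [k = O(log n)] once [d] is large against [(log n)^2]. The
    bound [n / d^j] stays bounded for [j = 1] and [d = Omega(n)], and vanishes for [j = 2] and [d]
    large against [sqrt n]. The mixing lemma loses a factor [exp(2 alpha eps k)]; the choice
    [alpha * eps = eta / 4] saves half of [eta]. This is too crude at the threshold in (a), where
    the factor [k^(-5/2)] matters. Hence sizes up to a multiple of [log n] use the trivial count
    [k^2 / 2] of inner edges, and the crude bound starts only where [exp(- eta k / 2)] is below
    [n^(-2)]. *)

Section GraphBasics.
Variable T : finType.
Implicit Types (E F H : {set {set T}}) (C X : {set T}) (u v w : T).

Definition connected_on C F := [forall u in C, forall v in C, connect (adj F) u v].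
Definition inside C F := [forall f in F, f \subset C].
Definition is_tree C F :=
  [&& simple_graph F, inside C F, connected_on C F & #|F|.+1 == #|C|].

Lemma adjC F : symmetric (adj F).
Proof. by move=> u v; rewrite /adj setUC. Qed.

Lemma connect_adjC F : connect_sym (adj F).
Proof. by apply: sym_connect_sym; exact: adjC. Qed.

Lemma adj_sub F H : F \subset H -> subrel (adj F) (adj H).
Proof. by move=> sFH u v; apply: (subsetP sFH). Qed.

Lemma connect_adj_sub F H : F \subset H ->
  subrel (connect (adj F)) (connect (adj H)).
Proof.
move=> sFH; apply: connect_sub => u v uv.
by apply: connect1; apply: adj_sub uv.
Qed.

Lemma connect_in F X u v : (forall a b, adj F a b -> a \in X -> b \in X) ->
  connect (adj F) u v -> u \in X -> v \in X.
Proof.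
move=> clX /connectP[p pp ->] {v}.
elim: p u pp => //= x p IH u /andP[ux pp] uX.
by apply: IH pp _; apply: clX ux uX.
Qed.

Lemma simple_adj_neq F u v : simple_graph F -> adj F u v -> u != v.
Proof.
move=> /forall_inP sF /sF; rewrite cards2; by case: (u == v).
Qed.

Lemma simple_edgeP F f : simple_graph F -> f \in F ->
  exists u w, [/\ u != w, f = [set u; w] & adj F u w].
Proof.
move=> /forall_inP sF fF; have /cards2P[u [w [uw fE]]] := sF _ fF.
by exists u, w; rewrite /adj -fE.
Qed.

Lemma simple_sub F H : F \subset H -> simple_graph H -> simple_graph F.
Proof.
by move=> /subsetP sFH /forall_inP sH; apply/forall_inP => f /sFH /sH.
Qed.

Lemma connected_onP C F : reflect (forall u v, u \in C -> v \in C ->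
  connect (adj F) u v) (connected_on C F).
Proof.
apply: (iffP forall_inP) => [cF u v uC vC|cF u uC]; last first.
  by apply/forall_inP => v vC; apply: cF.
by have /forall_inP/(_ _ vC) := cF _ uC.
Qed.

Lemma connected_on_root C F r : (forall v, v \in C -> connect (adj F) r v) ->
  connected_on C F.
Proof.
move=> cF; apply/connected_onP => u v uC vC.
by apply: connect_trans (cF _ vC); rewrite connect_adjC cF.
Qed.

Lemma inside_adj C F u v : inside C F -> adj F u v -> (u \in C) && (v \in C).
Proof.
move=> /forall_inP iF /iF /subsetP sC.
by rewrite !sC // !inE eqxx ?orbT.
Qed.

Lemma exit_edge F X r v : r \in X -> v \notin X -> connect (adj F) r v ->
  exists a b, [/\ a \in X, b \notin X & adj F a b].
Proof.
move=> rX vX rv.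
have [/existsP[a /existsP[b /and3P[? ? ?]]]|] :=
  boolP [exists a, exists b, [&& a \in X, b \notin X & adj F a b]].
  by exists a, b.
rewrite negb_exists => /forallP nX; case/negP: vX.
apply: connect_in rv rX => a b ab aX; apply/negPn/negP => bX.
by have := nX a; rewrite negb_exists => /forallP/(_ b); rewrite aX bX ab.
Qed.

(** Prim's growth: an edge leaving [D] adds one vertex [b], whose parent is the old end of that
    edge. Recording [par] indexes the tree edges by the vertices other than [r], which later bounds
    the number of spanning trees. *)
Lemma grow_tree C F r j : inside C F -> connected_on C F ->
  r \in C -> 0 < j <= #|C| ->
  exists (D : {set T}) (K : {set {set T}}) (par : T -> T),
  [/\ [/\ r \in D, D \subset C & #|D| = j],
      [/\ K \subset F, inside D K & #|K|.+1 = j],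
      (forall v, v \in D -> connect (adj K) r v) &
      (forall v, v \in D :\ r -> adj F v (par v)) /\
      K = [set [set v; par v] | v in D :\ r]].
Proof.
move=> iF cF rC; elim: j => // -[|j] IH /andP[_ jC].
  exists [set r], set0, id; split.
  - by rewrite set11 sub1set cards1.
  - by rewrite sub0set cards0; split=> //; apply/forall_inP => f; rewrite inE.
  - by move=> v /set1P->; exact: connect0.
  - have -> : [set r] :\ r = set0 by apply/setP => x; rewrite !inE andNb.
    split=> [v|]; first by rewrite inE.
    by apply/setP => x; rewrite inE; symmetry; apply/imsetP => -[y]; rewrite inE.
case: IH => [|D [K [par [[rD DC cardD] [KF iK cardK] conn [parP KE]]]]].
  by rewrite ltn0Sn ltnW.
have /properP[_ [x xC xD]] : D \proper C.
  by rewrite properEcard DC cardD.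
have rx : connect (adj F) r x by have /connected_onP := cF; apply.
have [a [b [aD bD ab]]] := exit_edge rD xD rx.
have /andP[aC bC] := inside_adj iF ab.
have bK f : f \in K -> b \notin f.
  by move=> fK; apply: contra bD; apply: subsetP; apply: (forall_inP iK).
have abK : [set a; b] \notin K by apply/negP => /bK; rewrite !inE eqxx orbT.
exists (b |: D), ([set a; b] |: K), (fun v => if v == b then a else par v).
have br : b != r by apply: contraNneq bD => ->.
have -> : (b |: D) :\ r = b |: (D :\ r).
  by apply/setP => y; rewrite !inE; case: (eqVneq y b) => //= ->; rewrite br.
split.
- split; first by rewrite !inE rD orbT.
  + by rewrite subUset sub1set bC.
  + by rewrite cardsU1 bD cardD.
- split; last by rewrite cardsU1 abK add1n cardK.
  + by rewrite subUset sub1set KF andbT.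
  + apply/forall_inP => f /setU1P[->|fK].
      by rewrite subUset !sub1set !inE eqxx aD orbT.
    apply: subset_trans (subsetUr _ _).
    exact: (forall_inP iK).
- have conn' v : v \in D -> connect (adj ([set a; b] |: K)) r v.
    by move=> /conn; apply: connect_adj_sub; exact: subsetUr.
  move=> v /setU1P[->|//]; last exact: conn'.
  apply: connect_trans (conn' _ aD) (connect1 _).
  by rewrite /adj setU11.
- split=> [v|].
    move=> /setU1P[->|vD]; first by rewrite eqxx adjC.
    have vb : v != b by apply: contraNneq bD => <-; have /setD1P[] := vD.
    by rewrite (negPf vb) parP.
  rewrite imsetU1 eqxx setUC setUC; congr (_ |: _).
    by rewrite setUC.
  rewrite KE; apply: eq_in_imset => v vD.
  have vb : v != b by apply: contraNneq bD => <-; have /setD1P[] := vD.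
  by rewrite (negPf vb).
Qed.

Lemma inside_sub C F H : F \subset H -> inside C H -> inside C F.
Proof.
by move=> /subsetP sFH /forall_inP iH; apply/forall_inP => f /sFH /iH.
Qed.

Lemma spanning_tree C F r : simple_graph F -> inside C F -> connected_on C F ->
  r \in C ->
  exists (K : {set {set T}}) (par : T -> T), [/\ is_tree C K, K \subset F,
      (forall v, v \in C :\ r -> adj F v (par v)) &
      K = [set [set v; par v] | v in C :\ r]].
Proof.
move=> sF iF cF rC; have C0 : 0 < #|C| by rewrite card_gt0; apply/set0Pn; exists r.
have [|D [K [par [[rD DC cardD] [KF iK cardK] conn [parP KE]]]]] :=
  grow_tree (j := #|C|) iF cF rC; first by rewrite C0 leqnn.
have DE : D = C by apply/eqP; rewrite eqEcard DC cardD leqnn.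
rewrite DE in KE conn parP iK.
exists K, par; split=> //; rewrite /is_tree (simple_sub KF) // iK cardK eqxx andbT.
exact: connected_on_root conn.
Qed.

Lemma connected_card C F : simple_graph F -> inside C F -> connected_on C F ->
  #|C| <= #|F|.+1.
Proof.
move=> sF iF cF; have [->|/set0Pn[r rC]] := eqVneq C set0; first by rewrite cards0.
have [K [par [/and4P[_ _ _ /eqP <-] KF _ _]]] := spanning_tree sF iF cF rC.
by rewrite ltnS subset_leq_card.
Qed.

(** The spanning tree grown inside [F] has as many edges as [F], hence equals it. *)
Lemma tree_par C F r : is_tree C F -> r \in C ->
  exists par : T -> T, (forall v, v \in C :\ r -> adj F v (par v)) /\
      F = [set [set v; par v] | v in C :\ r].
Proof.
move=> /and4P[sF iF cF /eqP cardF] rC.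
have [K [par [/and4P[_ _ _ /eqP cK] KF parP KE]]] := spanning_tree sF iF cF rC.
exists par; split=> //; rewrite -KE; apply/eqP; rewrite eq_sym eqEcard KF.
by rewrite -ltnS cK -cardF ltnSn.
Qed.

End GraphBasics.

(** * Cutting a tree at an edge, joining two trees by an edge *)

Section TreeSurgery.
Variable T : finType.
Implicit Types (E F H : {set {set T}}) (C X : {set T}) (u v w : T).

Lemma connect_edges_in F X u v :
  (forall a b, adj F a b -> a \in X -> b \in X) -> u \in X ->
  connect (adj F) u v -> connect (adj (edges_in F X)) u v.
Proof.
move=> clX uX uv.
have : v \in [set y in X | connect (adj (edges_in F X)) u y].
  apply: connect_in uv _; last by rewrite inE uX connect0.
  move=> a b ab; rewrite !inE => /andP[aX ua].
  have bX := clX _ _ ab aX; rewrite bX /=.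
  apply: connect_trans ua (connect1 _).
  rewrite /adj inE; apply/andP; split; first exact: ab.
  by rewrite subUset !sub1set aX bX.
by rewrite inE => /andP[].
Qed.

Lemma component_closed F v a b : adj F a b -> a \in component F v ->
  b \in component F v.
Proof. by rewrite !inE => ab va; apply: connect_trans va (connect1 ab). Qed.

Lemma edges_in_inside F X : inside X (edges_in F X).
Proof. by apply/forall_inP => f; rewrite inE => /andP[]. Qed.

Lemma edges_in_sub F X : edges_in F X \subset F.
Proof. by apply/subsetP => f; rewrite inE => /andP[]. Qed.

Lemma simple_disjoint_edges F C1 C2 F1 F2 : simple_graph F -> F1 \subset F ->
  inside C1 F1 -> inside C2 F2 -> [disjoint C1 & C2] -> [disjoint F1 & F2].
Proof.
move=> sF /subsetP F1F /forall_inP i1 /forall_inP i2 dC.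
rewrite disjoint_subset; apply/subsetP => f f1; apply/negP => f2.
have /(simple_edgeP sF)[a [b [_ fE _]]] := F1F _ f1.
have aC1 : a \in C1 by apply: (subsetP (i1 _ f1)); rewrite fE !inE eqxx.
have aC2 : a \in C2 by apply: (subsetP (i2 _ f2)); rewrite fE !inE eqxx.
by rewrite (disjointFr dC aC1) in aC2.
Qed.

Lemma card_disjointU (U : finType) (A B : {set U}) :
  [disjoint A & B] -> #|A :|: B| = #|A| + #|B|.
Proof. by rewrite -setI_eq0 => /eqP d; rewrite cardsU d cards0 subn0. Qed.

(** [C1] is the component of [v] once [e] is removed. It is not all of [C], since [F :\ e] has too
    few edges to connect [C]; and an edge of [F] leaving it can only be [e]. *)
Lemma cut_tree C F v e : is_tree C F -> v \in C -> e \in F ->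
  exists (C1 : {set T}) (F1 : {set {set T}}) u w (C2 : {set T}) (F2 : {set {set T}}),
  [/\ is_tree C1 F1, is_tree C2 F2, [disjoint C1 & C2] &
      [/\ v \in C1, u \in C1 & w \in C2] /\
      [/\ e = [set u; w], C = C1 :|: C2 & F = e |: (F1 :|: F2)]].
Proof.
move=> /and4P[sF iF cF /eqP cardF] vC eF.
pose F' := F :\ e; pose C1 := component F' v; pose C2 := C :\: C1.
have F'F : F' \subset F by exact: subsetDl.
have sF' := simple_sub F'F sF; have iF' := inside_sub F'F iF.
have vC1 : v \in C1 by rewrite inE connect0.
have C1C : C1 \subset C.
  apply/subsetP => x; rewrite inE => vx; apply: connect_in vx vC => a b ab _.
  by have /andP[] := inside_adj iF' ab.
have CE : C = C1 :|: C2.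
  by apply/setP => x; rewrite !inE; case vx : (connect _ v x) => //=;
     apply: (subsetP C1C); rewrite inE.
have dC : [disjoint C1 & C2].
  by rewrite -setI_eq0; apply/eqP/setP => x; rewrite !inE; case: (connect _ _ _); rewrite ?andbF.
have [x xC xC1] : exists2 x, x \in C & x \notin C1.
  apply/subsetPn; apply/negP => CC1.
  have cF' : connected_on C F'.
    by apply: (connected_on_root (r := v)) => y /(subsetP CC1); rewrite inE.
  have := connected_card sF' iF' cF'; rewrite -cardF (cardsD1 e F) eF.
  by rewrite ltnn.
have vx : connect (adj F) v x by apply: (connected_onP _ _ cF).
have [u [w [uC1 wC1 uw]]] := exit_edge vC1 xC1 vx.
have eE : e = [set u; w].
  apply/eqP; rewrite eq_sym; apply: contraR wC1 => ne.
  by apply: component_closed uC1; rewrite /adj /F' in_setD1 ne; exact: uw.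
have wC2 : w \in C2 by rewrite inE wC1; have /andP[] := inside_adj iF uw.
have F'E a b : adj F a b -> adj F' a b \/ [set a; b] = e.
  by rewrite /adj /F' in_setD1 => ->; case: eqP => [->|]; [right|left].
have cl2 a b : adj F' a b -> a \in C2 -> b \in C2.
  move=> ab; rewrite !inE => /andP[va aC]; have /andP[_ ->] := inside_adj iF' ab.
  rewrite andbT; apply: contra va => vb; apply: connect_trans vb (connect1 _).
  by rewrite adjC.
pose F1 := edges_in F' C1; pose F2 := edges_in F' C2.
have c1 : connected_on C1 F1.
  apply: (connected_on_root (r := v)) => y; rewrite inE => vy.
  by apply: connect_edges_in vy => // a b ab; apply: component_closed ab.
have c2 : connected_on C2 F2.
  apply: (connected_on_root (r := w)) => y yC2.
  apply: connect_edges_in => //.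
  (* The union of [C1] and the component of [w] is closed under [F]: only [e] is missing from [F'],
     and both its ends lie in the union. *)
  have : y \in C1 :|: component F' w.
    have vy : connect (adj F) v y.
      by apply: (connected_onP _ _ cF) => //; rewrite CE inE yC2 orbT.
    apply: connect_in vy _; last by rewrite inE vC1.
    move=> a b /F'E[ab|abe].
      by move=> /setUP[] aX; apply/setUP; [left|right]; apply: component_closed ab aX.
    have : b \in e by rewrite -abe !inE eqxx orbT.
    by rewrite eE => /set2P[]-> _; rewrite !inE ?connect0 ?orbT //; rewrite inE in uC1; rewrite uC1.
  by rewrite in_setU (disjointFl dC yC2) /= inE.
have F1F' : F1 \subset F' by exact: edges_in_sub.
have F2F' : F2 \subset F' by exact: edges_in_sub.
have s1 := simple_sub F1F' sF'; have s2 := simple_sub F2F' sF'.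
have i1 : inside C1 F1 by exact: edges_in_inside.
have i2 : inside C2 F2 by exact: edges_in_inside.
have F'U : F' = F1 :|: F2.
  apply/eqP; rewrite eqEsubset subUset F1F' F2F' !andbT.
  apply/subsetP => f fF'; have [a [b [_ fE ab]]] := simple_edgeP sF' fF'.
  have /andP[] := inside_adj iF' ab; rewrite {1}CE => /setUP[aX|aX] _.
    have bX := component_closed ab aX.
    by rewrite inE; apply/orP; left; rewrite inE fF' fE subUset !sub1set aX bX.
  have bX := cl2 _ _ ab aX.
  by rewrite inE; apply/orP; right; rewrite inE fF' fE subUset !sub1set aX bX.
have cF12 : #|F1| + #|F2| = #|F'|.
  by rewrite F'U card_disjointU // (simple_disjoint_edges sF' F1F' i1 i2).
have cC12 : #|C1| + #|C2| = #|C| by rewrite CE card_disjointU.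
have l1 := connected_card s1 i1 c1; have l2 := connected_card s2 i2 c2.
have cF' : #|F'|.+2 = #|C| by rewrite -cardF (cardsD1 e F) eF.
(* Connectedness bounds each vertex count by one more than the edge count; the totals agree, so both
   bounds are equalities. *)
have tot : #|F1|.+1 + #|F2|.+1 = #|C1| + #|C2|.
  by rewrite cC12 -cF' -cF12 addSn addnS.
have e1 : #|F1|.+1 = #|C1|.
  apply/eqP; rewrite eqn_leq l1 andbT -(leq_add2r #|F2|.+1) tot.
  by rewrite leq_add2l.
have e2 : #|F2|.+1 = #|C2|.
  by apply/eqP; rewrite -(eqn_add2l #|F1|.+1) tot e1.
exists C1, F1, u, w, C2, F2; split=> //.
- by rewrite /is_tree s1 i1 c1 e1 eqxx.
- by rewrite /is_tree s2 i2 c2 e2 eqxx.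
- by split=> //; split=> //; rewrite -F'U setD1K.
Qed.

Lemma join_notin C1 F1 C2 F2 u w : is_tree C1 F1 -> is_tree C2 F2 ->
  [disjoint C1 & C2] -> u \in C1 -> w \in C2 -> [set u; w] \notin F1 :|: F2.
Proof.
move=> /and4P[_ i1 _ _] /and4P[_ i2 _ _] dC uC wC.
rewrite inE negb_or; apply/andP; split; apply/negP.
  by move/(forall_inP i1); rewrite subUset !sub1set uC /= (disjointFl dC wC).
by move/(forall_inP i2); rewrite subUset !sub1set (disjointFr dC uC).
Qed.

Lemma join_tree C1 F1 C2 F2 u w : is_tree C1 F1 -> is_tree C2 F2 ->
  [disjoint C1 & C2] -> u \in C1 -> w \in C2 ->
  is_tree (C1 :|: C2) ([set u; w] |: (F1 :|: F2)).
Proof.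
move=> t1 t2 dC uC wC; have nuw := join_notin t1 t2 dC uC wC.
have uwN : u != w by apply/eqP => uw; rewrite uw (disjointFl dC wC) in uC.
move: t1 t2 => /and4P[s1 i1 c1 /eqP e1] /and4P[s2 i2 c2 /eqP e2].
apply/and4P; split.
- apply/forall_inP => f /setU1P[->|/setUP[]]; first by rewrite cards2 uwN.
    exact: (forall_inP s1).
  exact: (forall_inP s2).
- apply/forall_inP => f /setU1P[->|/setUP[]].
  + by rewrite subUset !sub1set !inE uC wC orbT.
  + by move=> /(forall_inP i1) fC; apply: subset_trans fC (subsetUl _ _).
  + by move=> /(forall_inP i2) fC; apply: subset_trans fC (subsetUr _ _).
- have sub1 : F1 \subset [set u; w] |: (F1 :|: F2).
    by apply/subsetP => f; rewrite !inE => ->; rewrite orbT.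
  have sub2 : F2 \subset [set u; w] |: (F1 :|: F2).
    by apply/subsetP => f; rewrite !inE => ->; rewrite !orbT.
  apply: (connected_on_root (r := u)) => y /setUP[yC|yC].
    by apply: connect_adj_sub sub1 _ _ _; apply: (connected_onP _ _ c1).
  apply: (@connect_trans _ _ w); first by apply: connect1; rewrite /adj setU11.
  by apply: connect_adj_sub sub2 _ _ _; apply: (connected_onP _ _ c2).
- rewrite cardsU1 nuw !card_disjointU -?e1 -?e2 ?addSn ?addnS //.
  apply: (simple_disjoint_edges s1 _ i1 i2 dC); exact: subxx.
Qed.

(** With [edges_in_join], this inverts [join_tree]: once the joining edge is gone, [v] alone tells
    the two pieces apart. *)
Lemma component_join C1 F1 C2 F2 v : is_tree C1 F1 -> inside C2 F2 ->
  [disjoint C1 & C2] -> v \in C1 -> component (F1 :|: F2) v = C1.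
Proof.
move=> /and4P[s1 i1 c1 _] i2 dC vC; apply/setP => x; rewrite inE.
apply/idP/idP => [vx|xC].
  apply: connect_in vx vC => a b ab aC; move: ab; rewrite /adj inE => /orP[] ab.
    by have /andP[] := inside_adj i1 ab.
  by have /andP[aC2] := inside_adj i2 ab; rewrite (disjointFr dC aC) in aC2.
apply: (connect_adj_sub (subsetUl _ _)).
exact: (connected_onP _ _ c1).
Qed.

Lemma edges_in_join C1 F1 C2 F2 : is_tree C1 F1 -> is_tree C2 F2 ->
  [disjoint C1 & C2] -> edges_in (F1 :|: F2) C1 = F1.
Proof.
move=> /and4P[s1 i1 _ _] /and4P[s2 i2 _ _] dC.
apply/setP => f; rewrite !inE; case f1 : (f \in F1) => /=.
  exact: (forall_inP i1).
apply/negbTE/negP => /andP[f2 fC].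
have [a [b [_ fE _]]] := simple_edgeP s2 f2.
have af : a \in f by rewrite fE !inE eqxx.
have aC1 := subsetP fC _ af; have aC2 := subsetP (forall_inP i2 _ f2) _ af.
by rewrite (disjointFr dC aC1) in aC2.
Qed.

End TreeSurgery.

(** * Recursion for trees through a vertex *)

Section TreeCount.
Variables (T : finType) (E : {set {set T}}).
Implicit Types (F H : {set {set T}}) (C X : {set T}) (u v w : T).
Local Notation tree := ({set T} * {set {set T}})%type.
Implicit Type t : tree.

Definition trees k v X : {set tree} :=
  [set t | [&& is_tree t.1 t.2, t.2 \subset E, v \in t.1, [disjoint t.1 & X]
             & #|t.1| == k]].

Lemma treesP k v X t : reflect
  [/\ is_tree t.1 t.2, t.2 \subset E, v \in t.1, [disjoint t.1 & X] & #|t.1| = k]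
  (t \in trees k v X).
Proof.
by rewrite inE; apply: (iffP and5P) => -[? ? ? ?] => [/eqP|->].
Qed.

Lemma disjoint_setU (A B X : {set T}) :
  [disjoint A :|: B & X] = [disjoint A & X] && [disjoint B & X].
Proof. by rewrite -!setI_eq0 setIUl setU_eq0. Qed.

Lemma trees0 v X : trees 0 v X = set0.
Proof.
apply/setP => t; rewrite [RHS]inE; apply/negP => /treesP[_ _ vt _ /eqP].
by rewrite cards_eq0 => /eqP t0; rewrite t0 inE in vt.
Qed.

Lemma trees1 v X : v \notin X -> trees 1 v X = [set ([set v], set0)].
Proof.
move=> vX; apply/setP => -[C F]; rewrite in_set1 -pair_eqE /=.
apply/treesP/andP => /= [[/and4P[_ _ _ cF] _ vC _ /eqP C1]|[/eqP-> /eqP->]].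
  move: cF; rewrite (eqP C1) eqSS cards_eq0 => /eqP ->.
  by move: C1 vC => /cards1P[x ->] /set1P->.
split; rewrite ?sub0set ?set11 ?cards1 ?disjoints1 //.
apply/and4P; split; rewrite ?cards0 ?cards1 //.
- by apply/forall_inP => f; rewrite inE.
- by apply/forall_inP => f; rewrite inE.
- by apply/connected_onP => a b /set1P-> /set1P->; exact: connect0.
Qed.

(* Double count pairs (tree, edge): cutting the edge uw leaves a tree t through v
   with u in t, and a tree through w that avoids X and t. *)
Lemma trees_cut k v X : k.-1 * #|trees k v X| =
  \sum_(i < k) \sum_(t in trees i v X) \sum_(u in t.1)
    \sum_(w | adj E u w && (w \notin X :|: t.1))
      #|trees (k - i) w (X :|: t.1)|.
Proof.
pose P := [set p : tree * {set T} | (p.1 \in trees k v X) && (p.2 \in p.1.2)].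
pose Q := [set q : 'I_k * tree * T * T * tree |
  [&& q.1.1.1.2 \in trees q.1.1.1.1 v X, q.1.1.2 \in q.1.1.1.2.1,
      adj E q.1.1.2 q.1.2 && (q.1.2 \notin X :|: q.1.1.1.2.1)
    & q.2 \in trees (k - q.1.1.1.1) q.1.2 (X :|: q.1.1.1.2.1)]].
have -> : k.-1 * #|trees k v X| = #|P|.
  rewrite -sum1_card big_distrr /= -[RHS]sum1_card.
  rewrite [RHS](eq_bigl (fun p : tree * {set T} =>
    (p.1 \in trees k v X) && (p.2 \in p.1.2))) => [|p]; last by rewrite inE.
  rewrite -(pair_big_dep (fun t => t \in trees k v X)
    (fun t e => e \in t.2) (fun _ _ => 1)) /=.
  apply: eq_bigr => t /treesP[/and4P[_ _ _ /eqP tc] _ _ _ <-].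
  by rewrite sum1_card -tc muln1.
transitivity #|Q|; last first.
  rewrite -sum1_card !pair_big_dep /=.
  under [RHS]eq_bigr do rewrite -sum1_card.
  rewrite pair_big_dep /=; apply: eq_bigl => q; rewrite inE.
  by rewrite -!andbA.
pose g (q : 'I_k * tree * T * T * tree) : tree * {set T} :=
  let: (i, (C1, F1), u, w, (C2, F2)) := q in
  ((C1 :|: C2, [set u; w] |: (F1 :|: F2)), [set u; w]).
have QP i C1 F1 u w C2 F2 : (i, (C1, F1), u, w, (C2, F2)) \in Q ->
  [/\ is_tree C1 F1, is_tree C2 F2, [disjoint C1 & C2] &
     [/\ v \in C1, u \in C1 & w \in C2] /\
     [/\ [disjoint C1 & X], [disjoint C2 & X],
      F1 \subset E, F2 \subset E & [/\ adj E u w, #|C1| = i & #|C2| = k - i] ]].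
  rewrite inE /= => /and4P[/treesP/= [t1 E1 vC1 dX1 c1] uC1 /andP[uw wX]].
  move=> /treesP/=[t2 E2 wC2 dX2 c2].
  move: dX2; rewrite disjoint_sym disjoint_setU => /andP[dX2 dC].
  by split=> //; split=> //; split=> //; rewrite disjoint_sym.
have <- : g @: Q = P.
  apply/setP => -[[C F] e]; apply/imsetP/idP => [[q]|].
    case: q => [[[[i [C1 F1]] u] w] [C2 F2]] /QP[t1 t2 dC [[vC uC wC]]].
    move=> [d1 d2 E1 E2 [uw c1 c2]] [-> -> ->].
    rewrite inE /= setU11 andbT; apply/treesP => /=; split.
    - exact: join_tree.
    - by rewrite !subUset E1 E2 sub1set !andbT; exact: uw.
    - by rewrite inE vC.
    - by rewrite disjoint_setU d1.
    - by rewrite card_disjointU // c1 c2 subnKC // ltnW.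
  rewrite inE /= => /andP[/treesP[/= tF FE vC dX cC] eF].
  have [C1 [F1 [u [w [C2 [F2 [t1 t2 dC [[vC1 uC1 wC2] [eE CE FE']]]]]]]]] :=
    cut_tree tF vC eF.
  have cC12 : #|C1| + #|C2| = k by rewrite -cC CE card_disjointU.
  have C1k : #|C1| < k.
    by rewrite -cC12 -addn1 leq_add2l card_gt0; apply/set0Pn; exists w.
  have C1F : F1 \subset F by rewrite FE'; apply/subsetP => f fF; rewrite !inE fF orbT.
  have C2F : F2 \subset F by rewrite FE'; apply/subsetP => f fF; rewrite !inE fF !orbT.
  have dX1 : [disjoint C1 & X] by apply: disjointWl dX; rewrite CE subsetUl.
  have dX2 : [disjoint C2 & X] by apply: disjointWl dX; rewrite CE subsetUr.
  exists (Ordinal C1k, (C1, F1), u, w, (C2, F2)); last first.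
    by rewrite /= CE FE' eE.
  rewrite inE /=; apply/and4P; split=> //.
  - by apply/treesP; split=> //=; apply: subset_trans FE.
  - apply/andP; split; first by rewrite /adj -eE; apply: (subsetP FE).
    by rewrite in_setU negb_or (disjointFr dX2 wC2) (disjointFl dC wC2).
  - apply/treesP; split=> //=; first by apply: subset_trans FE.
      by rewrite disjoint_sym disjoint_setU ![[disjoint _ & C2]]disjoint_sym dX2 disjoint_sym.
    by rewrite -cC12 addKn.
(* Injectivity: removing the marked edge leaves [F1 :|: F2], where the component of [v] is [C1]. The
   ends of the edge are told apart by [u] lying in [C1] and [w] in [C2]. *)
rewrite card_in_imset // => q q'.
case: q => [[[[i [C1 F1]] u] w] [C2 F2]] qQ.
case: q' => [[[[i' [C1' F1']] u'] w'] [C2' F2']] qQ' [].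
have [t1 t2 dC [[vC uC wC] [_ _ _ _ [_ c1 _]]]] := QP _ _ _ _ _ _ _ qQ.
have [t1' t2' dC' [[vC' uC' wC'] [_ _ _ _ [_ c1' _]]]] := QP _ _ _ _ _ _ _ qQ'.
move=> CE FE eE.
have F12 : F1 :|: F2 = F1' :|: F2'.
  rewrite -(setU1K (join_notin t1 t2 dC uC wC)) FE eE.
  by rewrite (setU1K (join_notin t1' t2' dC' uC' wC')).
have i2 : inside C2 F2 by case/and4P: t2.
have i2' : inside C2' F2' by case/and4P: t2'.
have C1E : C1 = C1'.
  by rewrite -(component_join t1 i2 dC vC) F12 (component_join t1' i2' dC' vC').
have C2E : C2 = C2'.
  have h (A B : {set T}) : [disjoint A & B] -> B = (A :|: B) :\: A.
    move=> dAB; apply/setP => x; rewrite !inE; case xA : (x \in A) => //=.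
    by rewrite (disjointFr dAB xA).
  by rewrite (h _ _ dC) CE C1E -h // -C1E.
have F1E : F1 = F1' by rewrite -(edges_in_join t1 t2 dC) F12 C1E (edges_in_join t1' t2' dC').
have F2E : F2 = F2'.
  have dC2 : [disjoint C2 & C1] by rewrite disjoint_sym.
  have dC2' : [disjoint C2' & C1'] by rewrite disjoint_sym.
  rewrite -(edges_in_join t2 t1 dC2) setUC F12 C2E setUC.
  by rewrite (edges_in_join t2' t1' dC2').
have uE : u = u'.
  have /set2P[//|uw] : u \in [set u'; w'] by rewrite -eE !inE eqxx.
  by move: uC; rewrite uw C1E (disjointFl dC' wC').
have wE : w = w'.
  have /set2P[wu|//] : w \in [set u'; w'] by rewrite -eE !inE eqxx orbT.
  by move: wC; rewrite wu C2E (disjointFr dC' uC').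
have -> : i = i' by apply: val_inj; rewrite /= -c1 -c1' C1E.
by rewrite C1E C2E F1E F2E uE wE.
Qed.

End TreeCount.

(** * Cycles and edges of a component *)

Section Cycles.
Variable T : finType.
Implicit Types (E F H K : {set {set T}}) (C X : {set T}) (u v w : T).

Lemma component_connected H r :
  connected_on (component H r) (edges_in H (component H r)).
Proof.
apply: (connected_on_root (r := r)) => y; rewrite inE => ry.
apply: connect_edges_in ry; last by rewrite inE connect0.
by move=> a b; apply: component_closed.
Qed.

(** The simple path of [K] between the ends of [f], closed up by [f]. It has more than two vertices
    because [f] is not in [K]. *)
Lemma fundamental_cycle H C K f : simple_graph H -> is_tree C K -> K \subset H ->
  f \in edges_in H C -> f \notin K ->
  exists2 F, F \in cycles_in H C & (f \in F) && (F \subset f |: K).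
Proof.
move=> sH /and4P[sK iK cK _] KH; rewrite inE => /andP[fH fC] fK.
have [a [b [ab fE abH]]] := simple_edgeP sH fH.
have aC : a \in C by apply: (subsetP fC); rewrite fE !inE eqxx.
have bC : b \in C by apply: (subsetP fC); rewrite fE !inE eqxx orbT.
have /connectP[p0 pp0 lp0] : connect (adj K) a b by apply: (connected_onP _ _ cK).
move: lp0; case: (shortenP pp0) => p pp up _ lp {p0 pp0}.
pose e := adj (f |: K).
have ce : cycle e (a :: p).
  rewrite /= rcons_path -lp; apply/andP; split.
    by apply: sub_path pp; apply: adj_sub; exact: subsetUr.
  by rewrite /e adjC /adj -fE setU11.
have eH : subrel e (adj H).
  by apply: adj_sub; rewrite subUset sub1set fH.
have sz : size (a :: p) < #|T|.+1.
  by rewrite ltnS -(card_uniqP up) max_card.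
exists [set [set x; next (a :: p) x] | x in a :: p].
  rewrite inE; apply/existsP; exists (Ordinal sz).
  apply/existsP; exists (in_tuple (a :: p)); apply/and5P; split=> //=.
  - case: p pp lp {ce up sz} => [_ /= ba|x [|y p]] //=; first by rewrite ba eqxx in ab.
    by rewrite andbT => ax bx; move: fK; rewrite fE bx; rewrite /adj in ax; rewrite ax.
  - exact: sub_cycle eH _ ce.
  - rewrite aC; apply/allP => x xp; apply: connect_in _ (aC); last first.
      by apply: (path_connect pp); rewrite inE xp orbT.
    by move=> y z yz _; have /andP[] := inside_adj iK yz.
apply/andP; split.
  apply/imsetP; exists b; first by rewrite lp mem_last.
  have -> : next (a :: p) b = a.
    by rewrite next_nth lp mem_last index_last // nth_default.
  by rewrite fE setUC.
by apply/subsetP => g /imsetP[x xp ->]; apply: (next_cycle ce).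
Qed.

(** A fundamental cycle contains only one edge outside the spanning tree [K], so sending each such
    edge to its cycle is injective. *)
Lemma card_edges_cycles H C : simple_graph H -> C \in components H ->
  #|edges_in H C|.+1 <= #|C| + #|cycles_in H C|.
Proof.
move=> sH /imsetP[r _ ->] {C}; set C := component H r; set I := edges_in H C.
have rC : r \in C by rewrite inE connect0.
have sI : simple_graph I := simple_sub (edges_in_sub _ _) sH.
have [K [_ [tK KI _ _]]] :=
  spanning_tree sI (edges_in_inside _ _) (component_connected H r) rC.
have KH : K \subset H := subset_trans KI (edges_in_sub _ _).
have /and4P[_ _ _ /eqP <-] := tK.
rewrite -[X in X.+1](cardsID K) (setIidPr KI) addSn ltnS leq_add2l.
pose c (f : {set T}) : {set {set T}} :=
  odflt set0 [pick F in cycles_in H C | (f \in F) && (F \subset f |: K)].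
have cP f : f \in I :\: K ->
    [&& c f \in cycles_in H C, f \in c f & c f \subset f |: K].
  move=> /setDP[fI fK]; rewrite /c; case: pickP => [F /= ->//|nF].
  have [F FH fF] := fundamental_cycle sH tK KH fI fK.
  by have := nF F; rewrite FH fF.
rewrite -(card_in_imset (f := c)).
  by apply/subset_leq_card/subsetP => F /imsetP[f /cP/and3P[? ? ?] ->].
move=> f g fI gI cfg; have /setDP[_ fK] := fI.
have /and3P[_ fc _] := cP _ fI; have /and3P[_ _ /subsetP gc] := cP _ gI.
by rewrite cfg in fc; have /setU1P[//|] := gc _ fc; rewrite (negPf fK).
Qed.

(** Dropping one edge of a cycle would leave [C] connected with fewer than [#|C| - 1] edges. *)
Lemma tree_no_cycle H C : is_tree C (edges_in H C) -> #|cycles_in H C| = 0.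
Proof.
move=> /and4P[sK iK cK /eqP kK]; apply/eqP; rewrite cards_eq0 -subset0.
apply/subsetP => F; rewrite inE => /existsP[k /existsP[p]].
case/and5P; case: p => p /= /eqP <- {k} k2 cp up pC _.
case: p k2 cp up pC => [|a q] /=; rewrite ?ltnS ?rcons_path // => q2 /andP[pq ba] up.
move=> /andP[aC qC].
set K := edges_in H C in sK iK cK kK.
pose b := last a q; pose f := [set a; b].
have bC : b \in C.
  by have := mem_last a q; rewrite -/b inE => /orP[/eqP->//|]; apply: (allP qC).
have fK : f \in K.
  rewrite inE subUset !sub1set aC bC andbT.
  by move: ba; rewrite -/b adjC andbT; apply.
have nthC i : nth a (a :: q) i \in C.
  have [iq|iq] := ltnP i (size (a :: q)); last by rewrite nth_default.
  have := mem_nth a iq; rewrite inE => /orP[/eqP->//|]; exact: (allP qC).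
have pq' : path (adj (K :\ f)) a q.
  apply/(pathP a) => i iq; have /(pathP a)/(_ i iq) xy := pq.
  have iq1 : i < size (a :: q) by rewrite /= ltnS ltnW.
  have nq : nth a q i \in C := nthC i.+1.
  rewrite /adj in_setD1 inE subUset !sub1set nthC nq !andbT.
  apply/andP; split; last exact: xy.
  (* If the path edge at position [i] were [f], both [i] and [i + 1] would be 0 or [size q], so
     [size q = 1]; but a cycle has more than two vertices. *)
  apply/eqP => fE.
  have bE : b = nth a (a :: q) (size q) by rewrite nth_last.
  have h j : j < size (a :: q) -> nth a (a :: q) j \in f -> (j == 0) || (j == size q).
    move=> jq /set2P[] e0; apply/orP; [left|right].
      by rewrite -(nth_uniq a jq (ltn0Sn (size q)) up) e0.
    by rewrite -(nth_uniq a jq (ltnSn (size q)) up) e0 bE.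
  have := h _ iq1; rewrite -fE !inE eqxx (ltn_eqF iq) orbF => /(_ isT)/eqP i0.
  have iq2 : i.+1 < size (a :: q) by rewrite ltnS.
  have := h _ iq2; rewrite -fE !inE eqxx orbT => /(_ isT).
  by rewrite i0 /= => /eqP q1; rewrite -q1 in q2.
have ab : connect (adj (K :\ f)) a b by apply/connectP; exists q.
have cK' : connected_on C (K :\ f).
  apply/connected_onP => u v uC vC.
  have: connect (adj K) u v by apply: (connected_onP _ _ cK).
  apply: connect_sub => x y xy.
  have [xyf|xyf] := eqVneq [set x; y] f; last first.
    by apply: connect1; rewrite /adj in_setD1 xyf; exact: xy.
  have xN := simple_adj_neq sK xy.
  have : x \in f by rewrite -xyf !inE eqxx.
  have : y \in f by rewrite -xyf !inE eqxx orbT.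
  move=> /set2P[] yE /set2P[] xE; rewrite xE yE ?connect0 //.
  by rewrite connect_adjC.
have sub : K :\ f \subset K := subsetDl _ _.
have := connected_card (simple_sub sub sK) (inside_sub sub iK) cK'.
by rewrite -kK (cardsD1 f K) fK ltnn.
Qed.

Lemma component_card_edges H C : simple_graph H -> C \in components H ->
  #|C| <= #|edges_in H C|.+1.
Proof.
move=> sH /imsetP[r _ ->].
apply: (connected_card (simple_sub (edges_in_sub _ _) sH) (edges_in_inside _ _)).
exact: component_connected.
Qed.

Lemma component_card_gt0 H C : C \in components H -> 0 < #|C|.
Proof.
by move=> /imsetP[r _ ->]; rewrite card_gt0; apply/set0Pn; exists r;
  rewrite inE connect0.
Qed.

Lemma component_tree H C : simple_graph H -> C \in components H ->
  exists2 K, is_tree C K & K \subset edges_in H C.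
Proof.
move=> sH /imsetP[r _ ->].
have rC : r \in component H r by rewrite inE connect0.
have [K [_ [tK KI _ _]]] :=
  spanning_tree (simple_sub (edges_in_sub _ _) sH) (edges_in_inside _ _)
    (component_connected H r) rC.
by exists K.
Qed.

Lemma isolated_tree_edges H C : simple_graph H -> isolated_tree H C ->
  is_tree C (edges_in H C).
Proof.
move=> sH /andP[cC /eqP cyc].
have [r _ CE] := imsetP cC.
apply/and4P; split.
- exact: simple_sub (edges_in_sub _ _) sH.
- exact: edges_in_inside.
- by rewrite CE; exact: component_connected.
have := card_edges_cycles sH cC; rewrite cyc addn0 => le1.
by rewrite eqn_leq le1 component_card_edges.
Qed.

(** One cycle allows at most [#|C|] edges; with fewer the component would be a tree, which has no
    cycle. *)
Lemma unicyclic_edges H C : simple_graph H -> unicyclic_component H C ->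
  #|edges_in H C| = #|C|.
Proof.
move=> sH /andP[cC /eqP cyc].
have [r _ CE] := imsetP cC.
have := card_edges_cycles sH cC; rewrite cyc addn1 ltnS => le1.
apply/eqP; rewrite eqn_leq le1 /= leqNgt; apply/negP => lt1.
suff /tree_no_cycle : is_tree C (edges_in H C) by rewrite cyc.
apply/and4P; split.
- exact: simple_sub (edges_in_sub _ _) sH.
- exact: edges_in_inside.
- by rewrite CE; exact: component_connected.
- by rewrite eqn_leq lt1 component_card_edges.
Qed.

End Cycles.

(** * Edges meeting a vertex set *)

Section EdgeCounts.
Variable T : finType.
Implicit Types (E F H K : {set {set T}}) (C X : {set T}) (u v w : T).

(** These edges decide whether [C] is a component and which edges it then contains. *)
Definition touching E C := [set f in E | f :&: C != set0].
Definition boundary E C := touching E C :\: edges_in E C.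

Lemma degree_edges F v : simple_graph F ->
  #|[set u | adj F v u]| = #|[set f in F | v \in f]|.
Proof.
move=> sF; rewrite -(card_in_imset (f := fun u => [set v; u])).
  apply: eq_card => f; rewrite inE; apply/imsetP/andP => [[u]|[fF vf]].
    by rewrite inE => vu ->; rewrite set21.
  have [a [b [ab fE abF]]] := simple_edgeP sF fF.
  move: vf; rewrite fE => /set2P[]->; [exists b|exists a] => //.
    by rewrite inE.
  by rewrite inE adjC.
  by rewrite setUC.
move=> u w; rewrite !inE => vu vw uw.
have uv := simple_adj_neq sF vu.
have : u \in [set v; w] by rewrite -uw set22.
by move=> /set2P[uv'|//]; rewrite uv' eqxx in uv.
Qed.

Lemma handshake F C : simple_graph F ->
  \sum_(v in C) #|[set u | adj F v u]| = \sum_(f in F) #|f :&: C|.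
Proof.
move=> sF; under eq_bigr do rewrite degree_edges // -sum1_card.
under [RHS]eq_bigr do rewrite -sum1_card.
rewrite (exchange_big_dep (fun f => f \in F)) /=; last by move=> v f _; rewrite inE => /andP[].
by apply: eq_bigr => f fF; apply: eq_bigl => v; rewrite !inE fF andbC.
Qed.

Lemma sum_inner_degree F C : simple_graph F ->
  \sum_(v in C) #|[set w in C | adj F v w]| = 2 * #|edges_in F C|.
Proof.
move=> sF; have sI := simple_sub (edges_in_sub F C) sF.
transitivity (\sum_(v in C) #|[set u | adj (edges_in F C) v u]|).
  apply: eq_bigr => v vC; apply: eq_card => w; rewrite !inE /adj inE subUset !sub1set vC /=.
  by rewrite andbC.
rewrite handshake // -sum1_card big_distrr /=; apply: eq_bigr => f.
rewrite inE => /andP[fF fC]; rewrite (setIidPl fC) muln1.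
by apply/eqP; apply: (forall_inP sF).
Qed.

(** Of the [d * #|C|] edge ends at [C], an edge inside [C] owns two and any other edge touching [C]
    owns one. *)
Lemma touching_card E C d : simple_graph E -> regular d E ->
  #|touching E C| + #|edges_in E C| = d * #|C|.
Proof.
move=> sE /forallP rE; have := handshake C sE.
rewrite (eq_bigr (fun=> d)) => [|v _]; last by apply/eqP; apply: rE.
rewrite sum_nat_const mulnC => ->.
rewrite -!sum1_card.
rewrite (eq_bigl (fun f => (f \in E) && (f :&: C != set0))) => [|f]; last by rewrite inE.
rewrite [X in _ + X](eq_bigl (fun f => (f \in E) && (f \subset C))) => [|f]; last by rewrite inE.
rewrite !big_mkcondr -big_split /=; apply: eq_bigr => f fE.
have [a [b [ab -> _]]] := simple_edgeP sE fE.
rewrite subUset !sub1set.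
have -> : [set a; b] :&: C = (if a \in C then [set a] else set0) :|: (if b \in C then [set b]
    else set0).
  apply/setP => x; rewrite !inE andb_orl; congr (_ || _).
    by case: ifP => h; rewrite !inE; case: eqVneq => //= ->; rewrite h.
  by case: ifP => h; rewrite !inE; case: eqVneq => //= ->; rewrite h.
by rewrite -card_gt0; case: (a \in C); case: (b \in C);
  rewrite ?setU0 ?set0U ?cards0 ?cards1 ?cards2 ?ab.
Qed.

Lemma edges_in_touching E C : simple_graph E -> edges_in E C \subset touching E C.
Proof.
move=> sE; apply/subsetP => f; rewrite !inE => /andP[fE fC]; rewrite fE /=.
have [a [b [_ fab _]]] := simple_edgeP sE fE.
by apply/set0Pn; exists a; rewrite inE (subsetP fC) fab !inE eqxx.
Qed.

Lemma edges_in_card_sq E C : simple_graph E -> 2 * #|edges_in E C| <= #|C| ^ 2.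
Proof.
move=> sE; rewrite -sum_inner_degree //.
apply: (@leq_trans (\sum_(v in C) #|C|)); last by rewrite sum_nat_const.
apply: leq_sum => v vC; apply/subset_leq_card/subsetP => w.
by rewrite inE => /andP[].
Qed.

Lemma component_touching E H C : simple_graph E -> H \subset E -> C \in components H ->
  H :&: touching E C = edges_in H C.
Proof.
move=> sE HE /imsetP[r _ CE]; apply/setP => f; rewrite !inE.
case fH : (f \in H) => //=; rewrite (subsetP HE) //=.
have [a [b [ab fab aH]]] := simple_edgeP (simple_sub HE sE) fH.
apply/set0Pn/idP => [[x]|fC].
  rewrite inE fab subUset !sub1set CE => /andP[/set2P[]->] xC; rewrite xC ?andbT /=;
  by apply: component_closed xC; rewrite // adjC.
by exists a; rewrite inE (subsetP fC) fab !inE eqxx.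
Qed.

(** Converse of [component_touching]. Together they express that [C] is an isolated tree with edge
    set [K] as an exact trace on [touching E C], whose probability is a single product. *)
Lemma tree_component E H C K : simple_graph E -> H \subset E -> is_tree C K ->
  H :&: touching E C = K -> (C \in components H) && (edges_in H C == K).
Proof.
move=> sE HE tK HK; have /and4P[sK iK cK /eqP kK] := tK.
have : 0 < #|C| by rewrite -kK.
rewrite card_gt0 => /set0Pn[r rC].
have KH : K \subset H by rewrite -HK subsetIl.
have cl a b : adj H a b -> a \in C -> b \in C.
  move=> ab aC; suff /(inside_adj iK)/andP[] : adj K a b by [].
  rewrite -HK /adj !inE; apply/and3P; split; [exact: ab|exact: (subsetP HE)|].
  by apply/set0Pn; exists a; rewrite !inE eqxx aC.
apply/andP; split.
  apply/imsetP; exists r => //; apply/setP => x; rewrite inE.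
  apply/idP/idP => [xC|rx]; last exact: connect_in rx rC.
  by apply: (connect_adj_sub KH); apply: (connected_onP _ _ cK).
rewrite eqEsubset; apply/andP; split; apply/subsetP => f.
  rewrite inE => /andP[fH fC]; rewrite -HK inE fH.
  by apply: (subsetP (edges_in_touching C sE)); rewrite inE (subsetP HE).
by move=> fK; rewrite inE (subsetP KH) // (forall_inP iK).
Qed.

Lemma boundary_card E C d : simple_graph E -> regular d E ->
  #|boundary E C| + 2 * #|edges_in E C| = d * #|C|.
Proof.
move=> sE rE; rewrite -(touching_card C sE rE) mul2n -addnn addnA; congr (_ + _).
by rewrite cardsD (setIidPr (edges_in_touching C sE)) subnK //
  subset_leq_card // edges_in_touching.
Qed.

Lemma component_boundary E H C : simple_graph E -> H \subset E ->
  C \in components H -> [disjoint boundary E C & H].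
Proof.
move=> sE HE cC; rewrite -setI_eq0 setIDAC setIC component_touching // setD_eq0.
by apply/subsetP => f; rewrite !inE => /andP[/(subsetP HE)->].
Qed.

(** Source of the exponent [k ^ 2] in the second moment: an edge touching both sets has one end in
    each, so a pair of vertices names it. *)
Lemma touching_cross E C1 C2 : simple_graph E -> [disjoint C1 & C2] ->
  #|touching E C1 :&: touching E C2| <= #|C1| * #|C2|.
Proof.
move=> sE dC; rewrite -cardsX.
pose g (ab : T * T) := [set ab.1; ab.2].
apply: leq_trans (leq_imset_card g _); apply/subset_leq_card/subsetP => f.
rewrite !inE => /andP[/andP[fE /set0Pn[a aI]] /andP[_ /set0Pn[b bI]]].
move: aI bI; rewrite !inE => /andP[af aC1] /andP[bf bC2].
have ab : a != b by apply/eqP => ab; rewrite -ab (disjointFr dC aC1) in bC2.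
apply/imsetP; exists (a, b); first by rewrite !inE aC1.
apply/eqP; rewrite eq_sym eqEcard subUset !sub1set af bf /=.
by rewrite cards2 ab; have /forall_inP/(_ f fE)/eqP-> := sE.
Qed.

(* A spanning tree is determined by the parents of the vertices other than r. *)
Lemma card_spanning_trees E C r : r \in C ->
  #|[set K | is_tree C K && (K \subset E)]| <=
    \prod_(v in C :\ r) #|[set w in C | adj E v w]|.
Proof.
move=> rC; pose D := C :\ r.
pose N v : {set T} := [set w in C | adj E v w].
have -> : \prod_(v in D) #|N v| = #|pfamily r (mem D) (fun v => mem (N v))|.
  by rewrite card_pfamily foldrE big_image.
pose g (h : {ffun T -> T}) := [set [set v; h v] | v in D].
apply: leq_trans (leq_imset_card g _); apply/subset_leq_card/subsetP => K.
rewrite inE => /andP[tK KE]; have [par [parP KP]] := tree_par tK rC.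
apply/imsetP; exists [ffun v => if v \in D then par v else r].
  apply/pfamilyP; split.
    by apply/supportP => v vD; rewrite ffunE (negPf vD).
  move=> v vD; rewrite ffunE vD; change (par v \in N v); rewrite inE.
  have aK := parP _ vD; have /and4P[_ iK _ _] := tK.
  by have /andP[_ ->] := inside_adj iK aK; rewrite (adj_sub KE).
by rewrite {1}KP; apply: eq_in_imset => v vD; rewrite ffunE vD.
Qed.

End EdgeCounts.

(** * Walks and open paths from a vertex *)

Section Paths.
Variable T : finType.
Implicit Types (E F H : {set {set T}}) (u v w x : T) (p q : seq T).

Fixpoint path_edges v p : {set {set T}} :=
  if p is x :: q then [set v; x] |: path_edges x q else set0.

Fixpoint walks E l v : seq (seq T) :=
  if l is l'.+1 then
    flatten [seq [seq x :: q | q <- walks E l' x] | x <- enum [set x | adj E v x]]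
  else [:: [::]].

Lemma size_walks E d l v : regular d E -> size (walks E l v) = d ^ l.
Proof.
move=> /forallP rE; elim: l v => //= l IH v.
rewrite size_flatten /shape -map_comp sumnE big_map.
rewrite (eq_bigr (fun=> d ^ l)) => [|x _]; last by rewrite /= size_map IH.
by rewrite big_const_seq count_predT iter_addn_0 -cardE (eqP (rE v)) mulnC -expnS.
Qed.

Lemma mem_walks E p v : path (adj E) v p -> p \in walks E (size p) v.
Proof.
elim: p v => //= x p IH v /andP[vx /IH pp]; apply/flatten_mapP.
by exists x; [rewrite mem_enum inE | apply: map_f].
Qed.

Lemma walks_path E l v q : q \in walks E l v ->
  path (adj E) v q && (size q == l).
Proof.
elim: l v q => [|l IH] v q /=; first by rewrite inE => /eqP->.
move=> /flatten_mapP[x]; rewrite mem_enum inE => vx /mapP[q' /IH/andP[pq /eqP <-] ->].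
by rewrite /= vx pq eqxx.
Qed.

Lemma path_edges_sub H v p : (path_edges v p \subset H) = path (adj H) v p.
Proof.
by elim: p v => [|x p IH] v /=; rewrite ?sub0set // subUset sub1set IH.
Qed.

Lemma path_edges_mem v p f : f \in path_edges v p -> {subset f <= v :: p}.
Proof.
elim: p v => [|x p IH] v /=; first by rewrite inE.
move=> /setU1P[->|/IH h] y; last by move/h => yp; rewrite inE yp orbT.
by move=> /set2P[]->; rewrite !inE eqxx ?orbT.
Qed.

Lemma card_path_edges v p : uniq (v :: p) -> #|path_edges v p| = size p.
Proof.
elim: p v => [|x p IH] v; first by rewrite cards0.
rewrite [uniq _]/= => /andP[vp up] /=; rewrite cardsU1 IH //.
suff -> : [set v; x] \notin path_edges x p by [].
by apply: contra vp => /path_edges_mem; apply; rewrite set21.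
Qed.

(** Every vertex of the component is the last vertex of a simple path of [H] from [v]. *)
Lemma component_le_paths E H v : H \subset E ->
  #|component H v| <= \sum_(l < #|T|)
    \sum_(p <- walks E l v | uniq (v :: p) && (path_edges v p \subset H)) 1.
Proof.
move=> HE.
pose s := flatten [seq [seq p <- walks E l v | uniq (v :: p) && (path_edges v p \subset H)] |
    l : 'I_#|T| <- enum 'I_#|T|].
have -> : \sum_(l < #|T|)
    \sum_(p <- walks E l v | uniq (v :: p) && (path_edges v p \subset H)) 1 = size s.
  rewrite /s size_flatten /shape -map_comp sumnE big_map big_enum.
  by apply: eq_bigr => l _; rewrite /= sum1_count size_filter.
rewrite -(size_map (last v)) cardE; apply: uniq_leq_size; first exact: enum_uniq.
move=> u; rewrite mem_enum inE => /connectP[p0 pp0 ->].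
case: (shortenP pp0) => p pp up _ {p0 pp0 u}.
apply: map_f; apply/flatten_mapP.
have sz : size p < #|T| by rewrite -[_.+1]/(size (v :: p)) -(card_uniqP up) max_card.
exists (Ordinal sz); first by rewrite mem_enum.
rewrite mem_filter up path_edges_sub pp /=; apply: mem_walks.
by apply: sub_path pp; apply: adj_sub.
Qed.

End Paths.

From mathcomp Require Import all_order all_algebra.
From mathcomp Require Import polyrcf spectral complex reals.
From mathcomp Require Import zify ring lra.
Import Order.TTheory GRing.Theory Num.Theory.

(** * The expander mixing lemma *)

Section Mixing.
Local Open Scope ring_scope.
Local Open Scope sesquilinear_scope.
Variable R : realType.
Local Notation rc := (real_complex R).

(** [eigenvalues] is defined by roots of the characteristic polynomial. That polynomial is also the
    product of the linear factors of a unitary diagonalisation over [R[i]], so the two lists agree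
    up to order. *)
Lemma symmetric_spectrum n (A : 'M[R]_n) : A^T = A ->
  exists (D : 'I_n -> R) (P : 'M[R[i]]_n),
  [/\ P \is unitarymx, P *m map_mx rc A = diag_mx (\row_j rc (D j)) *m P &
      perm_eq (eigenvalues A) [seq D j | j <- enum 'I_n]].
Proof.
move=> symA; pose B : 'M[R[i]]_n := map_mx rc A.
have hB : B \is hermsymmx.
  apply: realsym_hermsym.
    by apply/is_hermitianmxP; rewrite expr0 scale1r map_mx_id // map_trmx symA.
  by apply/mxOverP => i j; rewrite mxE complex_real.
pose D j := complex.Re (spectral_diag B 0 j).
have DE : spectral_diag B = \row_j rc (D j).
  apply/rowP => j; rewrite mxE.
  have /mxOverP/(_ 0 j) := hermitian_spectral_diag_real hB.
  by move=> /RRe_real.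
have eqB : spectralmx B *m B = diag_mx (\row_j rc (D j)) *m spectralmx B.
  have /hermitian_normalmx/orthomx_spectralP := hB.
  rewrite DE => {2}->.
  by rewrite !mulmxA (mulmxV (spectral_unit _)) mul1mx.
exists D, (spectralmx B); split=> //; first exact: spectral_unitarymx.
apply: prod_XsubC_eq; rewrite -char_poly_eigenvalues //.
apply: (map_poly_inj rc); rewrite map_char_poly -/B.
rewrite big_map big_enum /= rmorph_prod /=.
have uP : map_mx polyC (spectralmx B) \in unitmx.
  by rewrite unitmxE det_map_mx rmorph_unit // -unitmxE spectral_unit.
transitivity (char_poly (diag_mx (\row_j rc (D j)))).
  have e : map_mx polyC (spectralmx B) *m char_poly_mx B =
      char_poly_mx (diag_mx (\row_j rc (D j))) *m map_mx polyC (spectralmx B).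
    by rewrite /char_poly_mx mulmxBr mulmxBl scalar_mxC -!map_mxM eqB.
  apply: (mulrI (x := \det (map_mx polyC (spectralmx B)))).
    by rewrite -unitmxE.
  by rewrite -[LHS]det_mulmx e det_mulmx; apply: mulrC.
rewrite char_poly_trig ?diag_mx_is_trig //.
by apply: eq_bigr => j _; rewrite !mxE eqxx mulr1n map_polyXsubC.
Qed.

(** [second_eigenvalue] drops one copy of the head of the list, so all indices but one are covered.
    Which eigenvector belongs to [j0] is settled only in [quadratic_form_le]. *)
Lemma second_eigenvalue_index n (E : {set {set 'I_n}}) (D : 'I_n -> R) :
  perm_eq (eigenvalues (adjmx R E)) [seq D j | j <- enum 'I_n] -> (0 < n)%N ->
  exists j0, forall j, j != j0 -> `|D j| <= second_eigenvalue R E.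
Proof.
rewrite /second_eigenvalue; case: (eigenvalues _) => [/perm_size|h t pm n0].
  by rewrite size_map size_enum_ord => e0 n0; exfalso; move: n0; rewrite -e0.
have /mapP[j0 j0e hE] : h \in [seq D j | j <- enum 'I_n].
  by rewrite -(perm_mem pm) mem_head.
exists j0 => j jj0 /=; have jt : D j \in t.
  have : perm_eq (h :: t) (D j0 :: [seq D j | j <- rem j0 (enum 'I_n)]).
    rewrite (perm_trans pm) //.
    exact: (perm_map D (perm_to_rem j0e)).
  rewrite hE perm_cons => /perm_mem->; apply: map_f.
  by rewrite (mem_rem_uniq _ (enum_uniq _)) inE jj0 mem_enum.
elim: t jt {pm} => // y t IH; rewrite inE big_cons le_max => /orP[/eqP->|/IH->].
  by rewrite lexx.
by rewrite orbT.
Qed.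

Lemma second_eigenvalue_ge0 n (E : {set {set 'I_n}}) : 0 <= second_eigenvalue R E.
Proof.
by rewrite /second_eigenvalue; elim/big_rec: _ => // y z _; rewrite le_max normr_ge0.
Qed.

(** The all-ones vector [O] is an eigenvector for [d], and [second_eigenvalue R E < d%:R] leaves
    only the index [j0] for it. A vector of sum zero is orthogonal to [O], so it has no [j0]
    coordinate and meets only eigenvalues of modulus at most [lam]. *)
Lemma quadratic_form_le n (E : {set {set 'I_n}}) d (x : 'rV[R]_n) :
  regular d E -> second_eigenvalue R E < d%:R -> \sum_j x 0 j = 0 ->
  (x *m adjmx R E *m x^T) 0 0 <= second_eigenvalue R E * \sum_j x 0 j ^+ 2.
Proof.
move=> /forallP rE lamd x0; set lam := second_eigenvalue R E.
have [n0|n0] := posnP n.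
  have nI : 'I_n -> False by rewrite n0; case.
  rewrite mxE big1 => [|j]; last by case: (nI j).
  by rewrite big1 ?mulr0 // => j; case: (nI j).
pose A := adjmx R E; pose B : 'M[R[i]]_n := map_mx rc A.
have symA : A^T = A by apply/matrixP => i j; rewrite !mxE adjC.
have [D [P [uP PB pm]]] := symmetric_spectrum symA.
have [j0 Dj0] := second_eigenvalue_index pm n0.
have PPt : P *m P^t* = 1%:M by apply/unitarymxP.
have PtP : P^t* *m P = 1%:M by rewrite -invmx_unitary // mulVmx // unitarymx_unit.
pose Dg := diag_mx (\row_j rc (D j)).
have BPt : B *m P^t* = P^t* *m Dg.
  rewrite -[B]mul1mx -PtP -mulmxA -/A -/B in PB *.
  by rewrite !mulmxA -(mulmxA (P^t*)) PB -!mulmxA PPt mulmx1.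
pose O : 'rV[R[i]]_n := const_mx 1; pose X : 'rV[R[i]]_n := map_mx rc x.
pose Y := X *m P^t*; pose Z := O *m P^t*.
have OB : O *m B = (rc d%:R) *: O.
  apply/rowP => j; rewrite !mxE mulr1.
  under eq_bigr do rewrite !mxE mul1r.
  rewrite -rmorph_sum; congr (rc _); rewrite -natr_sum; congr (_%:R).
  rewrite -[RHS](eqP (rE j)) -sum1_card [RHS]big_mkcond /=; apply: eq_bigr => i _.
  by rewrite inE adjC; case: (adj _ _ _).
have ZD : Z *m Dg = (rc d%:R) *: Z.
  by rewrite /Z -mulmxA -BPt mulmxA OB scalemxAl.
(* A nonzero coordinate at [j != j0] would make [d] one of the eigenvalues bounded by
   [second_eigenvalue]. *)
have Z0 j : j != j0 -> Z 0 j = 0.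
  move=> jj0; have /rowP/(_ j) := ZD; rewrite mul_mx_diag !mxE -/(Z 0 j) mulrC.
  set z := \sum_(_ < _) _; move/eqP; rewrite -subr_eq0 -mulrBl mulf_eq0 => /orP[|/eqP->//].
  rewrite -rmorphB fmorph_eq0 subr_eq0 => /eqP Djd.
  have := Dj0 _ jj0; rewrite Djd ger0_norm ?ler0n // => /le_lt_trans/(_ lamd).
  by rewrite ltxx.
have Yj0 : Y 0 j0 = 0.
  have : (X *m O^t*) 0 0 = 0.
    rewrite mxE -[RHS](rmorph0 rc) -x0 rmorph_sum; apply: eq_bigr => j _.
    by rewrite !mxE conjC1 mulr1.
  have -> : X *m O^t* = Y *m Z^t*.
    rewrite /Y /Z trmx_mul map_mxM /= trmxCK mulmxA.
    by rewrite -(mulmxA X) PtP mulmx1.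
  rewrite mxE (bigD1 j0) //= big1 => [|j jj0]; last first.
    by rewrite !mxE -/(Z 0 j) ; have := Z0 _ jj0; rewrite mxE => ->; rewrite conjC0 mulr0.
  rewrite addr0 => /eqP; rewrite mulf_eq0 => /orP[/eqP//|].
  rewrite 2!mxE conjC_eq0 => /eqP Zj0.
  have Z00 : Z = 0.
    by apply/rowP => j; rewrite [RHS]mxE; have [->|/Z0] := eqVneq j j0.
  have : O = 0 by rewrite -[O]mulmx1 -PtP mulmxA -/Z Z00 mul0mx.
  by move=> /rowP/(_ j0)/eqP; rewrite !mxE oner_eq0.
have XY : X = Y *m P by rewrite /Y -mulmxA PtP mulmx1.
have XX : rc (\sum_j x 0 j ^+ 2) = \sum_j Y 0 j * (Y 0 j)^*.
  transitivity ((X *m X^t*) 0 0).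
    rewrite mxE rmorph_sum; apply: eq_bigr => j _.
    by rewrite !mxE expr2 rmorphM /=; congr (_ * _); rewrite conj_Creal // complex_real.
  have -> : X *m X^t* = Y *m Y^t*.
    by rewrite /Y trmx_mul map_mxM /= trmxCK mulmxA -(mulmxA X) PtP mulmx1.
  by rewrite mxE; apply: eq_bigr => j _; rewrite 2![in X in _ * X]mxE.
have XBX : rc ((x *m A *m x^T) 0 0) = \sum_j rc (D j) * (Y 0 j * (Y 0 j)^*).
  transitivity ((X *m B *m X^t*) 0 0).
    have -> : X^t* = map_mx rc x^T.
      by apply/matrixP => i j; rewrite !mxE; rewrite conj_Creal // complex_real.
    by rewrite /X /B -!map_mxM [RHS]mxE.
  have -> : X *m B *m X^t* = Y *m Dg *m Y^t*.
    rewrite {2}XY trmx_mul map_mxM /= !mulmxA; congr (_ *m _).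
    by rewrite /Y -!mulmxA BPt.
  by rewrite mul_mx_diag mxE; apply: eq_bigr => j _; rewrite !mxE; ring.
rewrite -lecR -/A XBX rmorphM /= XX mulr_sumr; apply: ler_sum => j _.
have [->|jj0] := eqVneq j j0; first by rewrite Yj0 mul0r !mulr0.
apply: ler_wpM2r; first exact: mul_conjC_ge0.
by rewrite lecR (le_trans (ler_norm _)) // Dj0.
Qed.

(** The quadratic form at the indicator of [C] minus its mean [k / n], a vector of sum zero. Its
    squared norm is [k - k^2 / n], bounded by [k]. *)
Lemma expander_mixing n (E : {set {set 'I_n}}) d (C : {set 'I_n}) :
  simple_graph E -> regular d E -> second_eigenvalue R E < d%:R ->
  (2 * #|edges_in E C|)%:R <=
    d%:R * #|C|%:R ^+ 2 / n%:R + second_eigenvalue R E * #|C|%:R :> R.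
Proof.
move=> sE rE lamd; set lam := second_eigenvalue R E; set k := #|C|%:R : R.
have lam0 : 0 <= lam := second_eigenvalue_ge0 E.
have [n0|n0] := posnP n.
  have C0 : #|C| = 0%N by apply/eqP; rewrite cards_eq0 -subset0; apply/subsetP; move: C {k};
      rewrite n0 => C -[].
  have := edges_in_card_sq C sE; rewrite C0 /= leqn0 => /eqP ->.
  by rewrite /k C0 expr0n /= mulr0 mul0r mulr0 addr0.
have nR : 0 < n%:R :> R by rewrite ltr0n.
pose ind j : R := (j \in C)%:R.
have ind1 : \sum_j ind j = k.
  by rewrite /ind -natr_sum /k -sum1_card [in RHS]big_mkcond; congr (_%:R).
pose x : 'rV[R]_n := \row_j (ind j - k / n%:R).
have x0 : \sum_j x 0 j = 0.
  under eq_bigr do rewrite mxE.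
  rewrite sumrB ind1 sumr_const card_ord -[_ *+ n]mulr_natr divfK ?subrr //.
  by rewrite gt_eqF.
have := quadratic_form_le rE lamd x0; rewrite -/lam.
have -> : \sum_j x 0 j ^+ 2 = k - k ^+ 2 / n%:R.
  under eq_bigr => j _.
    have -> : x 0 j ^+ 2 = ind j - 2 * (k / n%:R) * ind j + (k / n%:R) ^+ 2.
      by rewrite mxE /ind; case: (j \in C) => /=; ring.
    over.
  rewrite big_split sumrB /= -mulr_sumr ind1 sumr_const card_ord -[_ *+ n]mulr_natr.
  by field; rewrite gt_eqF.
have deg i : \sum_j (adj E i j)%:R = d%:R :> R.
  rewrite -natr_sum; congr (_%:R); rewrite -[RHS](eqP (forallP rE i)) -sum1_card [RHS]big_mkcond /=.
  by apply: eq_bigr => j _; rewrite inE; case: (adj _ _ _).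
have deg' j : \sum_i (adj E i j)%:R = d%:R :> R.
  by rewrite -(deg j); apply: eq_bigr => i _; rewrite adjC.
have -> : (x *m adjmx R E *m x^T) 0 0 = (2 * #|edges_in E C|)%:R - d%:R * k ^+ 2 / n%:R.
  transitivity (\sum_j \sum_i (x 0 i * (adj E i j)%:R * x 0 j)).
    rewrite mxE; apply: eq_bigr => j _; rewrite !mxE mulr_suml.
    by apply: eq_bigr => i _; rewrite !mxE.
  pose c := k / n%:R.
  transitivity (\sum_j \sum_i (ind i * ind j * (adj E i j)%:R - c * (ind i * (adj E i j)%:R) - c *
      (ind j * (adj E i j)%:R) + c ^+ 2 * (adj E i j)%:R)).
    by apply: eq_bigr => j _; apply: eq_bigr => i _; rewrite !mxE -/c; ring.
  under eq_bigr do rewrite big_split !sumrB /= -!mulr_sumr deg'.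
  rewrite big_split !sumrB /= -!mulr_sumr.
  have -> : \sum_j \sum_i ind i * (adj E i j)%:R = d%:R * k.
    rewrite exchange_big /=; under eq_bigr do rewrite -mulr_sumr deg.
    by rewrite -mulr_suml ind1 mulrC.
  rewrite -mulr_suml ind1 sumr_const card_ord -[d%:R *+ n]mulr_natr.
  have -> : \sum_j \sum_i ind i * ind j * (adj E i j)%:R = (2 * #|edges_in E C|)%:R.
    rewrite -sum_inner_degree // [RHS]natr_sum [RHS]big_mkcond /=; apply: eq_bigr => j _.
    rewrite /ind; case: (j \in C) => /=; last by rewrite big1 // => i _; rewrite mulr0 mul0r.
    rewrite -sum1_card [RHS]natr_sum [RHS]big_mkcond /=; apply: eq_bigr => i _.
    by rewrite inE mulr1 adjC; case: (i \in C); case: (adj _ _ _); rewrite ?mulr1 ?mulr0.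
  by rewrite /c; field; rewrite gt_eqF.
rewrite lerBlDl => /le_trans; apply; rewrite lerD2l ler_wpM2l //.
by rewrite lerBlDr lerDl divr_ge0 ?exprn_ge0 ?ler0n.
Qed.

End Mixing.

From mathcomp Require Import all_classical all_reals all_analysis.
Import numFieldNormedType.Exports.

(** * Random subgraphs *)

Section RandomSubgraph.
Local Open Scope ring_scope.
Variables (R : realType) (T : finType) (E : {set {set T}}) (p : R).
Implicit Types (H F D : {set {set T}}) (f g : {set {set T}} -> R).
Implicit Types (A B : pred {set {set T}}).

Definition subgraph_mean f : R :=
  \sum_(H : {set {set T}} | H \subset E) p ^+ #|H| * (1 - p) ^+ #|(E :\: H)%SET| * f H.

Lemma subgraph_probE A : subgraph_prob E p A = subgraph_mean (fun H => (A H)%:R).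
Proof.
rewrite /subgraph_prob big_mkcondr; apply: eq_bigr => H _.
by case: (A H); rewrite ?mulr1 ?mulr0.
Qed.

(** Expand the product of [x e + y e] over all vertex sets [e], with [x] the weight of keeping [e]
    and [y] that of leaving it out: [(p, 0)] on [F], [(0, 1 - p)] on the rest of [D], [(p, 1 - p)]
    on the rest of [E] and [(0, 1)] off [E]. Only subsets of [E] with the right trace survive. *)
Lemma subgraph_mean_trace F D : F \subset D -> D \subset E ->
  subgraph_mean (fun H => (H :&: D == F)%SET%:R) =
    p ^+ #|F| * (1 - p) ^+ #|(D :\: F)%SET|.
Proof.
move=> FD DE.
pose x e : R := if e \in E then if e \in D then if e \in F then p else 0 else p else 0.
pose y e : R := if e \in E then if e \in D then if e \in F then 0 else 1 - p else 1 - p else 1.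
have prodif (J K : {set {set T}}) (a : R) : \prod_(e in J) (if e \in K then a else 1) = a ^+
    #|(J :&: K)%SET|.
  rewrite -big_mkcondr /= prodr_const; congr (_ ^+ _); apply: eq_card => e.
  by rewrite !inE.
transitivity (\prod_(e : {set T}) (x e + y e)).
  rewrite bigA_distr /subgraph_mean big_mkcond /=; apply: eq_bigr => H _.
  rewrite (bigID (fun e => e \in H)) /=.
  rewrite (eq_bigr x) => [|e ->//].
  rewrite [X in _ = _ * X](eq_bigr y) => [|e /negPf ->//].
  have [HE|/subsetPn[e eH eE]] := boolP (H \subset E); last first.
    by rewrite (bigD1 e) //= /x (negPf eE) !mul0r.
  have [HD|HD] := eqVneq (H :&: D)%SET F; last first.
    rewrite mulr0.
    have [e eD eHF] : exists2 e, e \in D & (e \in H) != (e \in F).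
      apply/exists_inP; apply: contraR HD => /exists_inPn nD.
      apply/eqP/setP => e; rewrite inE; have [eD|eD] := boolP (e \in D).
        by rewrite andbT; have := nD e eD; rewrite negbK => /eqP.
      by rewrite andbF; apply/esym/negbTE; apply: contra eD => /(fintype.subsetP FD).
    have eE := fintype.subsetP DE _ eD.
    have [eH|eH] := boolP (e \in H).
      by rewrite (bigD1 e) //= /x eE eD; move: eHF; rewrite eH; case: (e \in F) => //;
          rewrite !mul0r.
    rewrite [X in _ = _ * X](bigD1 e) //= /y eE eD; move: eHF; rewrite (negPf eH).
    by case: (e \in F) => //; rewrite !(mul0r, mulr0).
  rewrite mulr1; congr (_ * _).
    rewrite (eq_bigr (fun=> p)) ?prodr_const // => e eH.
    rewrite /x (fintype.subsetP HE _ eH); case: ifP => // eD.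
    by rewrite -HD inE eH eD.
  rewrite (eq_bigr (fun e => if e \in E then 1 - p else 1)).
    rewrite -big_mkcondr /= prodr_const; congr (_ ^+ _).
    by apply: eq_card => e; rewrite !inE.
  move=> e eH; rewrite /y; case: ifP => // eE; case: ifP => // eD.
  by rewrite -HD inE (negPf eH).
rewrite (bigID (fun e => e \in F)) /=; congr (_ * _).
  rewrite (eq_bigr (fun=> p)) ?prodr_const // => e eF.
  have eD := fintype.subsetP FD _ eF.
  by rewrite /x /y (fintype.subsetP DE _ eD) eD eF addr0.
rewrite (eq_bigr (fun e => if e \in D then 1 - p else 1)).
  rewrite -big_mkcondr /= prodr_const; congr (_ ^+ _).
  by apply: eq_card => e; rewrite !inE.
move=> e eF; rewrite /x /y (negPf eF); case: ifPn => eE; case: ifPn => eD;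
  rewrite ?add0r //; first by rewrite addrC subrK.
by rewrite (fintype.subsetP DE _ eD) in eE.
Qed.

Lemma subgraph_mean_cst (c : R) : subgraph_mean (fun=> c) = c.
Proof.
have := @subgraph_mean_trace finset.set0 finset.set0 (finset.sub0set _) (finset.sub0set _).
rewrite finset.setD0 cards0 !expr0 mulr1 => e1.
rewrite -[RHS]mul1r -[in RHS]e1 /subgraph_mean big_distrl /=.
by apply: eq_bigr => H _; rewrite finset.setI0 eqxx mulr1.
Qed.

Lemma subgraph_meanD f g :
  subgraph_mean (fun H => f H + g H) = subgraph_mean f + subgraph_mean g.
Proof. by rewrite -big_split; apply: eq_bigr => H _; rewrite mulrDr. Qed.

Lemma subgraph_meanZ c f : subgraph_mean (fun H => c * f H) = c * subgraph_mean f.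
Proof. by rewrite big_distrr; apply: eq_bigr => H _; rewrite /= mulrCA. Qed.

Lemma subgraph_mean_sum (I : Type) (s : seq I) (P : pred I)
    (f : I -> {set {set T}} -> R) :
  subgraph_mean (fun H => \sum_(i <- s | P i) f i H) =
  \sum_(i <- s | P i) subgraph_mean (f i).
Proof.
rewrite /subgraph_mean [RHS]exchange_big; apply: eq_bigr => H _.
by rewrite big_distrr.
Qed.

Lemma eq_subgraph_mean f g : (forall H, H \subset E -> f H = g H) ->
  subgraph_mean f = subgraph_mean g.
Proof. by move=> fg; apply: eq_bigr => H HE; rewrite fg. Qed.

Hypotheses (p0 : 0 <= p) (p1 : p <= 1).

Lemma le_subgraph_mean f g : (forall H, H \subset E -> f H <= g H) ->
  subgraph_mean f <= subgraph_mean g.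
Proof.
move=> fg; apply: ler_sum => H HE; apply: ler_wpM2l; last exact: fg.
by rewrite mulr_ge0 // exprn_ge0 // subr_ge0.
Qed.

Lemma subgraph_prob_ge0 A : 0 <= subgraph_prob E p A.
Proof.
rewrite subgraph_probE -(subgraph_mean_cst 0); apply: le_subgraph_mean => H _.
by rewrite ler0n.
Qed.

Lemma subgraph_probC A :
  subgraph_prob E p A = 1 - subgraph_prob E p (fun H => ~~ A H).
Proof.
apply/eqP; rewrite eq_sym subr_eq !subgraph_probE -subgraph_meanD.
rewrite -[X in X == _](subgraph_mean_cst 1); apply/eqP/eq_subgraph_mean => H _.
by case: (A H); rewrite ?addr0 ?add0r.
Qed.

Lemma prob_le_subgraph_mean A f : (forall H, H \subset E -> 0 <= f H) ->
  (forall H, H \subset E -> A H -> 1 <= f H) ->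
  subgraph_prob E p A <= subgraph_mean f.
Proof.
move=> f0 f1; rewrite subgraph_probE; apply: le_subgraph_mean => H HE.
by case: (boolP (A H)) => AH; [apply: f1|apply: f0].
Qed.

Lemma prob_le A B : (forall H, H \subset E -> A H -> B H) ->
  subgraph_prob E p A <= subgraph_prob E p B.
Proof.
move=> AB; rewrite [leRHS]subgraph_probE; apply: prob_le_subgraph_mean => [H _|H HE AH].
  by rewrite ler0n.
by rewrite AB.
Qed.

Lemma prob_union A B (A0 : pred {set {set T}}) :
  (forall H, H \subset E -> A0 H -> A H \/ B H) ->
  subgraph_prob E p A0 <= subgraph_prob E p A + subgraph_prob E p B.
Proof.
move=> DAB.
rewrite [X in _ <= X + _]subgraph_probE [X in _ <= _ + X]subgraph_probE -subgraph_meanD.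
apply: prob_le_subgraph_mean => [H _|H HE /(DAB _ HE)[]->]; rewrite ?addr_ge0 //.
  by rewrite lerDl.
by rewrite lerDr.
Qed.

Lemma union_bound (I : finType) (P : pred I) (B : I -> pred {set {set T}}) A :
  (forall H, H \subset E -> A H -> exists2 i, P i & B i H) ->
  subgraph_prob E p A <= \sum_(i | P i) subgraph_prob E p (B i).
Proof.
move=> AB; under eq_bigr do rewrite subgraph_probE.
rewrite -subgraph_mean_sum; apply: prob_le_subgraph_mean => [H _|H HE AH].
  by rewrite sumr_ge0.
have [i Pi Bi] := AB _ HE AH; rewrite (bigD1 i) //= Bi lerDl sumr_ge0 //.
Qed.

Lemma prob_open_closed F D : F \subset E -> D \subset E -> [disjoint F & D] ->
  subgraph_prob E p (fun H => (F \subset H) && [disjoint D & H]) =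
    p ^+ #|F| * (1 - p) ^+ #|D|.
Proof.
move=> FE DE FD.
have sub : F \subset F :|: D by exact: finset.subsetUl.
have FDD : ((F :|: D) :\: F = D)%SET.
  apply/setP => e; rewrite !inE; case eF : (e \in F) => //=.
  by rewrite (disjointFr FD eF).
rewrite -[in RHS]FDD -(subgraph_mean_trace sub); last by rewrite finset.subUset FE.
rewrite subgraph_probE; apply: eq_subgraph_mean => H _; congr (nat_of_bool _)%:R.
apply/idP/idP => [/andP[FH DH]|/eqP HE].
  apply/eqP/setP => e; rewrite !inE; case eF : (e \in F) => /=.
    by rewrite (fintype.subsetP FH).
  by apply/negbTE/negP => /andP[eH eD]; rewrite (disjointFr DH eD) in eH.
apply/andP; split; first by rewrite -HE finset.subsetIl.
rewrite disjoint_subset; apply/fintype.subsetP => e eD; rewrite inE; apply/negP => eH.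
have : e \in F by rewrite -HE !inE eH eD orbT.
by rewrite (disjointFl FD eD).
Qed.

End RandomSubgraph.

(** * Counting trees in regular graphs *)

Section Abel.
Local Open Scope ring_scope.
Variable R : numFieldType.
Implicit Types (P Q : {poly R}) (k n : nat).

(** The coefficients of the tree function: [k^(k-1)] is Cayley's number of rooted labelled trees on
    [k] vertices. *)
Definition rho k : R := k%:R ^+ k.-1 / k`!%:R.

(* The Abel polynomials x (x+k)^(k-1) / k! and their companions (x+k)^k / k!:
   differentiation lowers k by one and shifts x by one. *)
Definition abel_a k : {poly R} :=
  if k is k'.+1 then k`!%:R^-1 *: ('X * ('X + k%:R%:P) ^+ k') else 1.
Definition abel_b k : {poly R} := k`!%:R^-1 *: ('X + k%:R%:P) ^+ k.

Lemma deriv_inj P Q : P^`() = Q^`() -> P.[0] = Q.[0] -> P = Q.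
Proof.
move=> dPQ; rewrite !horner_coef0 => PQ0; apply/polyP => -[//|i].
have /polyP/(_ i) := dPQ; rewrite !coef_deriv -mulr_natr -[RHS]mulr_natr => /mulIf; apply.
by rewrite pnatr_eq0.
Qed.

Lemma deriv_abel_a k : (abel_a k.+1)^`() = abel_a k \Po ('X + 1).
Proof.
have fE : ((k.+1)`!%:R : R)^-1 * k.+1%:R = k`!%:R^-1.
  by rewrite factS natrM invfM mulrAC mulVf ?mul1r // pnatr_eq0.
rewrite /abel_a derivZ derivM derivX deriv_exp; case: k fE => [|k] fE.
  by rewrite mulr0n mulr0 addr0 expr0 mulr1 factS fact0 muln1 invr1 scale1r comp_polyC.
rewrite derivD derivX derivC addr0 !mul1r [_.-1]/=.
rewrite comp_polyZ comp_polyM comp_polyX rmorphXn /= comp_polyD comp_polyX comp_polyC.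
have -> : 'X + 1 + (k.+1%:R)%:P = 'X + (k.+2%:R)%:P :> {poly R}.
  by rewrite -addrA -[k.+2%:R]natr1 polyCD [1 + _]addrC.
rewrite -fE -scalerA scaler_nat; congr (_ *: _).
rewrite [(k.+2%:R)%:P]rmorph_nat exprS; set Z := _ ^+ k.
rewrite -[Z *+ _]mulr_natr -[RHS]mulr_natr; ring.
Qed.

Lemma deriv_abel_b k : (abel_b k.+1)^`() = abel_b k \Po ('X + 1).
Proof.
have fE : ((k.+1)`!%:R : R)^-1 * k.+1%:R = k`!%:R^-1.
  by rewrite factS natrM invfM mulrAC mulVf ?mul1r // pnatr_eq0.
rewrite /abel_b derivZ deriv_exp derivD derivX derivC addr0 mul1r.
rewrite comp_polyZ rmorphXn /= comp_polyD comp_polyX comp_polyC.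
rewrite -fE -scalerA scaler_nat; congr (_ *: (_ ^+ _ *+ _)).
by rewrite -addrA; congr (_ + _); rewrite -natr1 polyCD addrC.
Qed.

Lemma abel_a0 k : (abel_a k.+1).[0] = 0.
Proof. by rewrite hornerZ hornerM hornerX mul0r mulr0. Qed.

(** Induction by integration: differentiating turns the identity for [n + 1] into the one for [n]
    shifted by one, and at 0 only the term [i = 0] is left. *)
Lemma abel_identity n (y : R) :
  \sum_(i < n.+1) (abel_b (n - i)).[y] *: abel_a i = abel_b n \Po ('X + y%:P).
Proof.
elim: n y => [|n IH] y.
  by rewrite big_ord1 /abel_a /abel_b /= expr0 fact0 invr1 scale1r hornerC scale1r comp_polyC.
apply: deriv_inj.
  rewrite deriv_comp derivD derivX derivC addr0 mulr1 deriv_abel_b.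
  rewrite raddf_sum big_ord_recl /= derivZ derivC scaler0 add0r.
  rewrite -comp_polyA comp_polyD comp_polyX.
  have -> : 'X + y%:P + (1 \Po ('X + y%:P)) = ('X + y%:P) \Po ('X + 1) :> {poly R}.
    by rewrite comp_polyD comp_polyX !comp_polyC; ring.
  rewrite comp_polyA -IH raddf_sum /=; apply: eq_bigr => i _.
  by rewrite derivZ deriv_abel_a linearZ /= /bump /= add1n subSS.
rewrite horner_comp hornerD hornerX hornerC add0r.
rewrite horner_sum big_ord_recl big1 => [|i _]; last first.
  by rewrite hornerZ lift0 abel_a0 mulr0.
by rewrite addr0 subn0 /= hornerZ hornerC mulr1.
Qed.

Lemma rho1 : rho 1 = 1.
Proof. by rewrite /rho expr0 factS fact0 muln1 divr1. Qed.

Lemma rho_ge0 k : 0 <= rho k.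
Proof. by rewrite divr_ge0 ?exprn_ge0 ?ler0n. Qed.

Lemma abel_b00 : (abel_b 0).[0] = 1.
Proof. by rewrite hornerZ expr0 fact0 invr1 mul1r hornerC. Qed.

Lemma abel_b0 k : (0 < k)%N -> (abel_b k).[0] = k%:R * rho k.
Proof.
case: k => // k _; rewrite /rho hornerZ horner_exp hornerD hornerX hornerC add0r.
by rewrite exprS mulrC mulrA.
Qed.

(** The derivative at 0 of Abel's identity for [y = 0]. Its last term is one copy of [rho k], which
    moves to the other side and lowers the factor [k] to [k - 1]; what remains is the sum in reverse
    order. *)
Lemma rho_rec k : k.-1%:R * rho k = \sum_(i < k) i%:R * rho i * rho (k - i).
Proof.
case: k => [|m]; first by rewrite big_ord0 mul0r.
have /(congr1 (fun P => P^`().[0])) := abel_identity m.+1 0.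
rewrite addr0 comp_polyXr deriv_abel_b horner_comp hornerD hornerX hornerC add0r.
rewrite raddf_sum /= horner_sum big_ord_recl /= derivZ derivC scaler0 horner0 add0r.
have aE i : (abel_a i.+1)^`().[0] = rho i.+1.
  rewrite deriv_abel_a horner_comp hornerD hornerX hornerC add0r; case: i => [|i].
    by rewrite hornerC rho1.
  rewrite hornerZ hornerM hornerX mul1r horner_exp hornerD hornerX hornerC /rho.
  rewrite [in RHS]factS [_.-1]/= addrC natr1 exprS natrM invfM.
  have h : i.+2%:R != 0 :> R by rewrite pnatr_eq0.
  by rewrite mulrACA divff // mul1r mulrC.
under eq_bigr => i _ do rewrite derivZ hornerZ aE /bump /= add1n subSS.
rewrite big_ord_recr /= subnn abel_b00 mul1r.
move=> e.
have {}e : \sum_(i < m) (abel_b (m - i)).[0] * rho i.+1 = m%:R * rho m.+1.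
  apply: (addIr (rho m.+1)); rewrite e.
  rewrite -[X in _ = _ + X]mul1r -mulrDl natr1.
  rewrite /abel_b hornerZ horner_exp hornerD hornerX hornerC addrC natr1 /rho [_.-1]/=.
  rewrite factS natrM invfM.
  have h : m.+1%:R != 0 :> R by rewrite pnatr_eq0.
  by rewrite [RHS]mulrCA mulVKf // mulrC.
rewrite -e /= big_ord_recl !mul0r add0r.
rewrite [RHS](reindex_inj rev_ord_inj) /=; apply: eq_bigr => i _.
have im : (i < m)%N := ltn_ord i.
rewrite abel_b0 ?subn_gt0 // /bump /= add1n subSS.
by rewrite -subSn // subSS; congr (_ * rho _); lia.
Qed.

End Abel.

(** * Bounds for the logarithm and Stirling's formula *)

Section LogBounds.
Local Open Scope ring_scope.
Variable R : realType.
Implicit Types (x t : R).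

Lemma derive_ge0_le (f df : R -> R) (a b : R) : a <= b ->
  (forall x, a <= x <= b -> is_derive x 1 f (df x)) ->
  (forall x, a <= x <= b -> 0 <= df x) -> f a <= f b.
Proof.
move=> ab fd df0.
have [c cab fE] : exists2 c, c \in `[a, b]%R & f b - f a = df c * (b - a).
  apply: MVT_segment => //.
    by move=> x /[!in_itv]/= /andP[ax xb]; apply: fd; rewrite !ltW.
  apply: derivable_within_continuous => x; rewrite in_itv/= => xab.
  by have [] := fd _ xab.
by rewrite -subr_ge0 fE mulr_ge0 ?subr_ge0// df0 //; rewrite in_itv /= in cab.
Qed.

Lemma is_derive_xlnx x : 0 < x -> is_derive x 1 (fun y => y * ln y) (ln x + 1).
Proof.
move=> x0; have := is_derive1_ln x0 => dln.
have -> : ln x + 1 = x *: x^-1 + ln x *: 1.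
  by rewrite /GRing.scale /= divff ?gt_eqF // mulr1 addrC.
exact: (is_deriveM (is_derive_id x 1) dln).
Qed.

(** At [t = 1 + 1/j] this is [(j + 1/2) ln (1 + 1/j) >= 1], the monotone half of Stirling's formula.
    The function [(1 + x) ln x - 2 x] has derivative [ln x + 1/x - 1], nonnegative because
    [ln (1/x) <= 1/x - 1]. *)
Lemma ln_lower t : 1 <= t -> 2 * (t - 1) <= (1 + t) * ln t.
Proof.
move=> t1; pose f x : R := x * ln x + ln x + ((-2)%:P * 'X).[x].
pose df x : R := (ln x + 1) + x^-1 + ((-2)%:P * 'X)^`().[x].
have : f 1 <= f t.
  apply: (@derive_ge0_le f df) => // x /andP[x1 xt];
    have x0 : 0 < x by rewrite (lt_le_trans _ x1).
    exact: (is_deriveD (is_deriveD (is_derive_xlnx x0) (is_derive1_ln x0)) (is_derive_poly _ x)).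
  have := @le_ln1Dx R (x^-1 - 1); rewrite [1 + _]addrC subrK lnV ?posrE //.
  rewrite ltrBrDr addNr invr_gt0 => /(_ x0).
  by rewrite /df derivM derivX derivC mul0r add0r !hornerE; lra.
by rewrite /f !hornerE ln1; lra.
Qed.

(** The difference of the two sides, as a function of [y = 1 + x], has derivative
    [(y - 1)^3 / y]. *)
Lemma ln_upper x : 0 <= x -> ln (1 + x) <= x - x ^+ 2 / 2 + x ^+ 3 / 3.
Proof.
move=> x0; pose p : {poly R} := ('X - 1%:P) - 2^-1 *: ('X - 1%:P) ^+ 2 + 3^-1 *: ('X - 1%:P) ^+ 3.
pose f y : R := p.[y] + - ln y.
pose df y : R := p^`().[y] + - y^-1.
have : f 1 <= f (1 + x).
  apply: (@derive_ge0_le f df) => //; first by rewrite lerDl.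
    move=> y /andP[y1 yt]; have y0 : 0 < y by rewrite (lt_le_trans _ y1).
    exact: (is_deriveD (is_derive_poly p y) (is_deriveN (is_derive1_ln y0))).
  move=> y /andP[y1 yt]; have y0 : 0 < y by rewrite (lt_le_trans _ y1).
  have -> : df y = (y - 1) ^+ 3 / y.
    rewrite /df /p !(derivD, derivN, derivZ, derivX, deriv_exp, derivC) /= !hornerE /=; field.
    by rewrite gt_eqF.
  by rewrite divr_ge0 ?exprn_ge0 ?subr_ge0 // ltW.
have pE z : p.[z] = (z - 1) - (z - 1) ^+ 2 / 2 + (z - 1) ^+ 3 / 3.
  by rewrite /p !(hornerD, hornerN, hornerZ, horner_exp, hornerX, hornerC); ring.
have -> : f 1 = 0 by rewrite /f pE ln1; ring.
have -> : f (1 + x) = x - x ^+ 2 / 2 + x ^+ 3 / 3 - ln (1 + x).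
  by rewrite /f pE; congr (_ - _); ring.
by rewrite subr_ge0.
Qed.

Lemma fact_rho k : (0 < k)%N ->
  ln (rho R k) + 3 / 2 * ln k%:R - k%:R = (k%:R + 1 / 2) * ln k%:R - k%:R - ln k`!%:R.
Proof.
case: k => // k _; have k0 : 0 < k.+1%:R :> R by rewrite ltr0n.
rewrite /rho ln_div ?posrE ?exprn_gt0 ?ltr0n ?fact_gt0 // lnXn // -[_ *+ _]mulr_natr.
set L := ln k.+1%:R; set Q := ln (k.+1)`!%:R.
by rewrite -[k.+1.-1]/k -natr1; field.
Qed.

(** Stirling: [rho k = exp(k - 3/2 ln k + v k)]. The sequence [v] starts at -1 and increases, with
    increments below half of [1/j - 1/(j+1)]; these telescope, so [v k] lies between -1 and 0. One
    more factor [1/k], for the choice of the root, makes the exponent 3/2 into 5/2. *)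
Lemma rho_bounds k : (0 < k)%N ->
  expR (k%:R - 3 / 2 * ln k%:R - 1) <= rho R k <= expR (k%:R - 3 / 2 * ln k%:R).
Proof.
move=> k0; pose v j : R := (j%:R + 1 / 2) * ln j%:R - j%:R - ln j`!%:R.
have v1 : v 1 = -1 by rewrite /v factS fact0 muln1 ln1; ring.
have step j : (0 < j)%N -> 0 <= v j.+1 - v j <= 2^-1 * (j%:R^-1 - j.+1%:R^-1).
  move=> j0; have jR : 0 < j%:R :> R by rewrite ltr0n.
  have jR1 : 1 <= j%:R :> R by rewrite ler1n.
  have vE : v j.+1 - v j = (j%:R + 1 / 2) * ln (1 + j%:R^-1) - 1.
    have -> : 1 + j%:R^-1 = j.+1%:R / j%:R :> R by rewrite -natr1; field; rewrite gt_eqF.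
    rewrite ln_div ?posrE ?ltr0n // /v factS natrM lnM ?posrE ?ltr0n ?fact_gt0 //.
    by rewrite -natr1; ring.
  set x := j%:R^-1 in vE *; have x0 : 0 < x by rewrite invr_gt0.
  have jx : j%:R = x^-1 by rewrite invrK.
  have := @ln_lower (1 + x); rewrite lerDl ltW // => /(_ isT) lo.
  have hi := ln_upper (ltW x0).
  have x1 : x <= 1 by rewrite invf_le1.
  rewrite vE; apply/andP; split.
    have -> : (j%:R + 1 / 2) * ln (1 + x) - 1 = ((1 + (1 + x)) * ln (1 + x) - 2 * (1 + x - 1))
        / (2 * x).
      by rewrite jx; field; rewrite gt_eqF.
    by rewrite divr_ge0 ?subr_ge0 // mulr_ge0 // ltW.
  have -> : j.+1%:R^-1 = x / (1 + x).
    by rewrite -natr1 jx; field; rewrite !gt_eqF ?addr_gt0.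
  apply: (@le_trans _ _ ((j%:R + 1 / 2) * (x - x ^+ 2 / 2 + x ^+ 3 / 3) - 1)).
    by rewrite lerD2r ler_pM2l // addr_gt0.
  have -> : (j%:R + 1 / 2) * (x - x ^+ 2 / 2 + x ^+ 3 / 3) - 1 = x ^+ 2 / 12 + x ^+ 3 / 6.
    by rewrite jx; field; rewrite gt_eqF.
  have -> : 2^-1 * (x - x / (1 + x)) = x ^+ 2 / (2 * (1 + x)).
    by field; rewrite gt_eqF // addr_gt0.
  rewrite ler_pdivlMr; last by rewrite mulr_gt0 ?addr_gt0.
  have x2 : x ^+ 2 <= x by rewrite expr2 ler_piMl // ltW.
  have x20 : 0 <= x ^+ 2 by rewrite exprn_ge0 // ltW.
  have -> : (x ^+ 2 / 12 + x ^+ 3 / 6) * (2 * (1 + x)) = x ^+ 2 * ((1 + 2 * x) * (1 + x) / 6) by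
      field.
  rewrite ler_piMr // ler_pdivrMr //; nra.
have [vlo vhi] : -1 <= v k /\ v k <= -1 + 2^-1 * (1 - k%:R^-1).
  elim: k k0 => // -[_ _|k /(_ isT)[lo hi] _].
    by rewrite v1 invr1; split; lra.
  have /andP[] := step k.+1 isT; move: lo hi.
  move: (v k.+1) (v k.+2) (k.+1%:R^-1) (k.+2%:R^-1) => a b c e.
  by split; lra.
have rk : 0 < rho R k by rewrite divr_gt0 ?exprn_gt0 ?ltr0n ?fact_gt0.
have kV : 0 <= k%:R^-1 :> R by rewrite invr_ge0.
have := fact_rho k0; rewrite -[RHS]/(v k) => vE; move: (v k) vE vlo vhi => vk vE vlo vhi.
by rewrite -[rho R k]lnK ?posrE // !ler_expR; move: (k%:R^-1) kV vhi => i *; apply/andP; split; lra.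
Qed.

End LogBounds.

Section TreeCountBounds.
Local Open Scope ring_scope.
Variables (R : numFieldType) (T : finType) (E : {set {set T}}) (d : nat).
Hypothesis rE : regular d E.
Implicit Types (C X : {set T}) (v w : T).

Lemma regular_degree v : #|[set u | adj E v u]%SET| = d.
Proof. by apply/eqP; move: v; apply/forallP. Qed.

Lemma card_trees1_le v X : (#|trees E 1 v X| <= 1)%N.
Proof.
have [vX|vX] := boolP (v \in X); last by rewrite trees1 // cards1.
rewrite eq_card0 // => t; apply/negP => /treesP[_ _ vt dX _].
by rewrite (disjointFr dX vt) in vX.
Qed.

(** [trees_cut] and [rho_rec] have the same shape: each of the [i] vertices [u] has at most [d]
    neighbours [w], so the bound passes through the recursion term by term. *)
Lemma trees_upper k v X : (#|trees E k v X|)%:R <= d%:R ^+ k.-1 * rho R k.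
Proof.
elim/ltn_ind: k v X => k IH v X.
case: k IH => [|[|k]] IH; first by rewrite trees0 cards0 mulr_ge0 ?rho_ge0 ?exprn_ge0.
  by rewrite expr0 mul1r rho1 lern1 card_trees1_le.
rewrite -(ler_pM2l (_ : 0 < k.+1%:R)) ?ltr0n // -natrM.
rewrite -[k.+1 in X in X <= _]/(k.+2.-1) trees_cut mulrCA (rho_rec R k.+2).
rewrite mulr_sumr natr_sum; apply: ler_sum => i _.
have [i0|i0] := posnP i.
  by rewrite i0 mul0r mul0r mulr0 trees0 big_set0.
have ik : (i < k.+2)%N := ltn_ord i.
have ki : (k.+2 - i < k.+2)%N by rewrite ltn_subrL i0.
apply: (@le_trans _ _ ((#|trees E i v X|)%:R * (i%:R * (d%:R * (d%:R ^+ (k.+2 - i).-1 *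
    rho R (k.+2 - i)))))).
  rewrite natr_sum -sum1_card natr_sum mulr_suml; apply: ler_sum => t /treesP[_ _ _ _ ti].
  rewrite mul1r natr_sum -[X in _ <= X%:R * _]ti -sum1_card natr_sum mulr_suml;
      apply: ler_sum => u _.
  rewrite mul1r natr_sum.
  apply: (@le_trans _ _ (\sum_(w | adj E u w && (w \notin X :|: t.1)%SET) (d%:R ^+ (k.+2 - i).-1 *
      rho R (k.+2 - i)))).
    by apply: ler_sum => w _; apply: IH.
  rewrite sumr_const -[leLHS]mulr_natl ler_wpM2r ?mulr_ge0 ?rho_ge0 ?exprn_ge0 //.
  rewrite ler_nat -(regular_degree u); apply/subset_leq_card/fintype.subsetP => w.
  by rewrite [in X in _ -> X]inE => /andP[].
rewrite -[k.+2.-1]/k.+1.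
have -> : d%:R ^+ k.+1 * (i%:R * rho R i * rho R (k.+2 - i)) =
   d%:R ^+ i.-1 * rho R i * (i%:R * (d%:R * (d%:R ^+ (k.+2 - i).-1 * rho R (k.+2 - i)))) :> R.
  have kE : k.+1 = (i.-1 + (k.+2 - i).-1.+1)%N by lia.
  by rewrite [X in _ ^+ X * (_ * _ * _) = _]kE exprD exprS; ring.
apply: ler_wpM2r; last exact: IH.
by rewrite !mulr_ge0 ?rho_ge0 ?exprn_ge0.
Qed.

(** The hypothesis survives the recursion: [X] gains the [i] vertices of the first piece, while the
    size of the second drops to [k - i]. It also leaves each [u] at least [D] neighbours outside
    [X :|: t.1]. *)
Lemma trees_lower (D : nat) k v X : (0 < k)%N -> v \notin X -> (#|X| + k + D <= d)%N ->
  D%:R ^+ k.-1 * rho R k <= (#|trees E k v X|)%:R.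
Proof.
elim/ltn_ind: k v X => k IH v X.
case: k IH => [|[|k]] IH // _ vX XD.
  by rewrite expr0 mul1r rho1 trees1 // cards1.
rewrite -(ler_pM2l (_ : 0 < k.+1%:R)) ?ltr0n // -[leRHS]natrM.
rewrite -[k.+1 in X in _ <= X]/(k.+2.-1) trees_cut mulrCA (rho_rec R k.+2).
rewrite mulr_sumr natr_sum; apply: ler_sum => i _.
have [i0|i0] := posnP i.
  by rewrite i0 mul0r mul0r mulr0 trees0 big_set0.
have ik : (i < k.+2)%N := ltn_ord i.
have ki : (k.+2 - i < k.+2)%N by rewrite ltn_subrL i0.
apply: (@le_trans _ _ ((#|trees E i v X|)%:R * (i%:R * (D%:R * (D%:R ^+ (k.+2 - i).-1 *
    rho R (k.+2 - i)))))); last first.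
  rewrite natr_sum -sum1_card natr_sum mulr_suml; apply: ler_sum => t /treesP[_ _ _ dX ti].
  rewrite mul1r natr_sum -[X in X%:R * _ <= _]ti -sum1_card natr_sum mulr_suml;
      apply: ler_sum => u _.
  rewrite mul1r natr_sum.
  have cX : #|(X :|: t.1)%SET| = (#|X| + i)%N.
    by rewrite card_disjointU ?ti // disjoint_sym.
  apply: (@le_trans _ _ (\sum_(w | adj E u w && (w \notin X :|: t.1)%SET) (D%:R ^+ (k.+2 - i).-1 *
      rho R (k.+2 - i)))); last first.
    apply: ler_sum => w /andP[_ wX]; apply: IH => //; first by rewrite subn_gt0.
    by rewrite cX; lia.
  rewrite sumr_const -[leRHS]mulr_natl ler_wpM2r ?mulr_ge0 ?rho_ge0 ?exprn_ge0 //.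
  rewrite ler_nat; apply: (@leq_trans (d - (#|X| + i))); first lia.
  rewrite leq_subLR -(regular_degree u) -cX.
  rewrite -[X in (_ <= _ + X)%N]cardsE; apply: leq_trans (leq_card_setU _ _).1.
  apply/subset_leq_card/fintype.subsetP => w.
  rewrite inE => uw; have [wX|wX] := boolP (w \in X :|: t.1)%SET.
    by apply/finset.setUP; left.
  by apply/finset.setUP; right; rewrite inE; apply/andP.
rewrite -[k.+2.-1]/k.+1.
have -> : D%:R ^+ k.+1 * (i%:R * rho R i * rho R (k.+2 - i)) =
   D%:R ^+ i.-1 * rho R i * (i%:R * (D%:R * (D%:R ^+ (k.+2 - i).-1 * rho R (k.+2 - i)))) :> R.
  have kE : k.+1 = (i.-1 + (k.+2 - i).-1.+1)%N by lia.
  by rewrite [X in _ ^+ X * (_ * _ * _) = _]kE exprD exprS; ring.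
apply: ler_wpM2r; last by apply: IH => //; lia.
by rewrite !mulr_ge0 ?rho_ge0 ?exprn_ge0.
Qed.

Definition all_trees k : {set {set T} * {set {set T}}} :=
  [set t | [&& is_tree t.1 t.2, t.2 \subset E & #|t.1| == k]]%SET.

Lemma all_trees_sum k : (k * #|all_trees k|)%N = (\sum_v #|trees E k v finset.set0|)%N.
Proof.
under eq_bigr do rewrite -sum1_card.
rewrite (exchange_big_dep (fun t => t \in all_trees k)) /=; last first.
  by move=> v t _ /treesP[tt tE _ _ tk]; rewrite inE tt tE tk /=.
rewrite -sum1_card big_distrr /=; apply: eq_bigr => t.
rewrite inE => /and3P[tt tE /eqP tk]; rewrite muln1 -[LHS]tk -sum1_card.
apply: eq_bigl => v; rewrite inE tt tE tk eqxx andbT /=.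
by rewrite -setI_eq0 finset.setI0 eqxx andbT.
Qed.

Lemma all_trees_upper k : k%:R * (#|all_trees k|)%:R <= #|T|%:R * d%:R ^+ k.-1 * rho R k.
Proof.
rewrite -natrM all_trees_sum natr_sum -mulrA mulr_natl.
apply: (@le_trans _ _ (\sum_(v : T) (d%:R ^+ k.-1 * rho R k))).
  by apply: ler_sum => v _; apply: trees_upper.
by rewrite sumr_const.
Qed.

Lemma all_trees_lower (D : nat) k : (0 < k)%N -> (k + D <= d)%N ->
  #|T|%:R * D%:R ^+ k.-1 * rho R k <= k%:R * (#|all_trees k|)%:R.
Proof.
move=> k0 kD; rewrite -natrM all_trees_sum natr_sum -mulrA.
apply: (@le_trans _ _ (\sum_(v : T) (D%:R ^+ k.-1 * rho R k))).
  by rewrite sumr_const mulr_natl.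
by apply: ler_sum => v _; apply: trees_lower => //; rewrite ?inE // cards0 add0n.
Qed.

End TreeCountBounds.

(** * The exponent for components of linear size *)

Section LargeExponent.
Local Open Scope ring_scope.
Variable R : realType.
Implicit Types (x y z alpha eps : R).

(* With [F y = y ln y - y^2/2] the exponent in [large_exponent] is
   [(F alpha - F (alpha (1 - x))) / alpha]. *)
Local Notation F y := (y * ln y - y ^+ 2 / 2).

Lemma ln_le_subr1 y : 0 < y -> ln y <= y - 1.
Proof.
move=> y0; have := @le_ln1Dx R (y - 1); rewrite [1 + _]addrC subrK; apply.
by rewrite ltrBrDr addNr.
Qed.

Lemma xlnx_decr y z : 0 < y -> y <= z -> F z <= F y.
Proof.
move=> y0 yz; pose P : {poly R} := 2^-1 *: 'X ^+ 2.
pose f x : R := P.[x] + - (x * ln x).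
pose df x : R := P^`().[x] + - (ln x + 1).
have : f y <= f z.
  apply: (@derive_ge0_le R f df) => // x /andP[yx _].
    have x0 : 0 < x by rewrite (lt_le_trans y0).
    exact: (is_deriveD (is_derive_poly P x) (is_deriveN (is_derive_xlnx x0))).
  have x0 : 0 < x by rewrite (lt_le_trans y0).
  have := ln_le_subr1 x0.
  have -> : df x = x - (ln x + 1).
    by rewrite /df /P derivZ derivXn hornerZ hornerMn hornerXn expr1; field.
  lra.
by rewrite /f /P !hornerZ !hornerXn; lra.
Qed.

(** Amounts to [ln y <= y / 2], the sum of [ln z <= z - 1] at [z = y / 2] and at [z = 2]. It covers
    the end [x = 1] of the next lemma, where [alpha * (1 - x)] is 0 and [xlnx_decr] does not
    apply. *)
Lemma xlnx_le0 y : 0 <= y -> F y <= 0.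
Proof.
rewrite le0r => /orP[/eqP->|y0]; first by rewrite mul0r expr0n mul0r subr0.
have y20 : 0 < y / 2 by rewrite divr_gt0.
have := ln_le_subr1 y20; rewrite ln_div ?posrE //.
have := @ln_le_subr1 2 (ltr0n _ 2) => l2 ly.
have : ln y <= y / 2 by lra.
rewrite -(ler_pM2l y0) => h; lra.
Qed.

(** [F] decreases, so the worst case is [x = eps]. With [y = alpha * (1 - eps)], the inequality
    [y (ln alpha - ln y) <= alpha - y] leaves [alpha eps (alpha eps / 2 - eta)], and
    [alpha eps <= eta] makes this at most [- alpha eps eta / 2]. *)
Lemma large_exponent alpha eps x : 0 < alpha -> 0 < eps ->
  alpha * eps <= alpha - 1 - ln alpha -> eps <= x -> x <= 1 ->
  - (1 - x) * ln (1 - x) + x * ln alpha - alpha * x + alpha * x ^+ 2 / 2 <=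
    - (eps * (alpha - 1 - ln alpha) / 2).
Proof.
move=> a0 e0 ae ex x1; set eta := alpha - 1 - ln alpha in ae *.
have fE : alpha * (- (1 - x) * ln (1 - x) + x * ln alpha - alpha * x + alpha * x ^+ 2 / 2) =
    F alpha - F (alpha * (1 - x)).
  have -> : alpha * (1 - x) * ln (alpha * (1 - x)) = alpha * (1 - x) * (ln alpha + ln (1 - x)).
    move: x1; rewrite le_eqVlt => /orP[/eqP->|x1]; first by rewrite subrr mulr0 !mul0r.
    by rewrite lnM ?posrE ?subr_gt0.
  by field.
rewrite -(ler_pM2l a0) fE.
have e1 : eps <= 1 by rewrite (le_trans ex).
have Fx : F (alpha * (1 - eps)) <= F (alpha * (1 - x)).
  have [x1'|x1'] := ltrP x 1.
    apply: xlnx_decr; first by rewrite mulr_gt0 // subr_gt0.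
    by rewrite ler_pM2l // lerD2l lerN2.
  have -> : x = 1 by apply/eqP; rewrite eq_le x1.
  rewrite subrr mulr0 mul0r expr0n mul0r subr0; apply: xlnx_le0.
  by rewrite mulr_ge0 ?subr_ge0 // ltW.
have yln : alpha * (1 - eps) * (ln alpha - ln (alpha * (1 - eps))) <= alpha - alpha * (1 - eps).
  have [e1'|e1'] := ltrP eps 1; last first.
    have -> : eps = 1 by apply/eqP; rewrite eq_le e1.
    by rewrite subrr mulr0 mul0r subr0 ltW.
  have y0 : 0 < alpha * (1 - eps) by rewrite mulr_gt0 // subr_gt0.
  set y := alpha * (1 - eps) in y0 *.
  rewrite -ln_div ?posrE //.
  apply: (@le_trans _ _ (y * (alpha / y - 1))).
    by rewrite ler_pM2l // ln_le_subr1 // divr_gt0.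
  by rewrite mulrBr mulr1 mulrCA divff ?mulr1 // gt_eqF.
move: Fx yln; set y := alpha * (1 - eps); set Y := y * _ - _ => Fx.
rewrite mulrBr => yln.
have aE : alpha = y + alpha * eps by rewrite /y; ring.
suff : F alpha - Y <= - (alpha * eps * (eta / 2)).
  move: Fx; set Z := alpha * (1 - x) * _ - _; nra.
have ley : y * ln alpha - y * ln y <= alpha * eps by move: yln aE; lra.
have : F alpha - Y <= alpha * eps * ln alpha + alpha * eps - (alpha ^+ 2 - y ^+ 2) / 2.
  by rewrite /Y; have -> : alpha * eps * ln alpha = alpha * ln alpha - y * ln alpha;
    [by rewrite /y; ring|move: ley; lra].
move=> /le_trans; apply.
have -> : alpha ^+ 2 - y ^+ 2 = alpha * eps * (2 * alpha - alpha * eps) by rewrite /y; ring.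
have -> : alpha * eps * ln alpha + alpha * eps - alpha * eps * (2 * alpha - alpha * eps) / 2 =
   alpha * eps * (alpha * eps / 2 - eta) by rewrite /eta; field.
by rewrite -mulrN ler_pM2l ?mulr_gt0 //; lra.
Qed.

End LargeExponent.

(** With [c] edges in a tree on [k = c + 1] vertices and [e] edges of the graph inside them, this
    leaves at least [d k - k^2] edges to be deleted. *)
Lemma half_square_bound c e : (2 * e <= c.+1 ^ 2 -> c + e <= c.+1 ^ 2)%N.
Proof.
have : (2 * c <= c.+1 ^ 2)%N by rewrite -mulnn mulSn mulnS; lia.
by move: (c.+1 ^ 2)%N => s; lia.
Qed.

(** Inclusion and exclusion for the deleted edges around two disjoint trees: [a] and [b] belong to
    the single trees, [m] to their union, and the [i] edges touching both are counted twice. *)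
Lemma union_excess_bound x y a b m u i v w z : (x + a = v -> y + b = w ->
  x + y + m = u -> u + i = v + w -> i <= z -> a + b <= m + z)%N.
Proof. lia. Qed.

Lemma bernoulli_le (R : realDomainType) (m : nat) (x : R) : (0 <= x -> x <= 1 ->
  1 - m%:R * x <= (1 - x) ^+ m)%R.
Proof.
move=> x0 x1; elim: m => [|m IH]; first by rewrite mul0r subr0 expr0.
rewrite exprS; have q0 : (0 <= 1 - x)%R by rewrite subr_ge0.
apply: le_trans (ler_wpM2l q0 IH); rewrite -natr1.
have : (0 <= m%:R * (x * x))%R by rewrite !mulr_ge0.
by move: (m%:R)%R => y; lra.
Qed.

(** [(1 - x) (1 + x + 2 x^2) = 1 + x^2 (1 - 2 x)], which is at least 1 here. *)
Lemma expRN_le_1B (R : realType) (x : R) : (0 <= x -> x <= 2^-1 ->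
  expR (- (x + 2 * x ^+ 2)) <= 1 - x)%R.
Proof.
move=> x0 x2; have y0 : (0 < 1 + (x + 2 * x ^+ 2))%R by nra.
rewrite expRN; apply: (@le_trans _ _ (1 + (x + 2 * x ^+ 2))^-1%R).
  by rewrite lef_pV2 ?posrE ?expR_gt0 // expR_ge1Dx.
rewrite -[leLHS]mul1r ler_pdivrMr //; have : (0 <= x ^+ 2 * (1 - 2 * x))%R.
  by rewrite mulr_ge0 ?exprn_ge0 //; lra.
lra.
Qed.

Lemma inv_expr1B_le (R : realType) (x e : R) m :
  (0 <= x <= 1 -> m%:R * x <= e -> e <= 2^-1 -> (1 - x) ^- m - 1 <= 2 * e)%R.
Proof.
move=> /andP[x0 x1] mx e2; have e0 : (0 <= e)%R by rewrite (le_trans _ mx) // mulr_ge0.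
have bern := bernoulli_le m x0 x1.
have pos : (0 < 1 - e)%R by lra.
have low : (1 - e <= (1 - x) ^+ m)%R by apply: le_trans bern; lra.
have inv : ((1 - x) ^- m <= (1 - e)^-1)%R.
  by rewrite lef_pV2 // posrE // (lt_le_trans pos).
suff : ((1 - e)^-1 <= 1 + 2 * e)%R by move: inv; lra.
by rewrite -[leLHS]mul1r ler_pdivrMr //; nra.
Qed.

Lemma bin_le_exp n k : ('C(n, k) <= n ^ k)%N.
Proof.
elim: n k => [|n IH] [|k] //.
rewrite binS; apply: (@leq_trans (n ^ k.+1 + n ^ k)); first by rewrite leq_add.
rewrite expnS -mulSnr expnS leq_mul2l /=.
by case: k => // k; rewrite leq_exp2r.
Qed.

Lemma card_draws_le (U : finType) (A : {set U}) j :
  (#|[set B : {set U} | B \subset A & #|B| == j]%SET| <= #|A| ^ j)%N.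
Proof. by rewrite cards_draws bin_le_exp. Qed.

Lemma subset_of_card (U : finType) (A : {set U}) j : (j <= #|A|)%N ->
  exists2 B : {set U}, B \subset A & #|B| = j.
Proof.
move=> jA; have : (0 < #|[set B : {set U} | B \subset A & #|B| == j]%SET|)%N.
  by rewrite cards_draws bin_gt0.
rewrite card_gt0 => /finset.set0Pn[B]; rewrite inE => /andP[BA /eqP Bj].
by exists B.
Qed.

(** * Bounds for a fixed graph *)

Section ComponentBounds.
Local Open Scope ring_scope.
Variables (R : realType) (T : finType) (E : {set {set T}}) (d : nat).
Variables (alpha delta : R).
Local Notation N := #|T|.
Local Notation p := (alpha / d%:R).
Hypotheses (sE : simple_graph E) (rE : regular d E).
Hypotheses (alpha0 : 0 < alpha) (d0 : (0 < d)%N) (alphad : alpha <= d%:R).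
(** The spectrum enters only through [mix], with [delta] in the role of [lambda / d]. *)
Hypotheses (delta0 : 0 <= delta) (mix : forall C : {set T},
  (2 * #|edges_in E C|)%:R <= d%:R * #|C|%:R * (#|C|%:R / N%:R + delta) :> R).
Implicit Types (C : {set T}) (H K F : {set {set T}}).

Let p0 : 0 <= p. Proof. by rewrite divr_ge0 // ltW. Qed.
Let p1 : p <= 1. Proof. by rewrite ler_pdivrMr ?ltr0n // mul1r. Qed.
Let dR : 0 < d%:R :> R. Proof. by rewrite ltr0n. Qed.

Lemma expr1B_le (m : nat) (y : R) : y <= m%:R -> (1 - p) ^+ m <= expR (- (p * y)).
Proof.
move=> ym; apply: (@le_trans _ _ (expR (m%:R * - p))).
  by rewrite expRM_natl; apply: lerXn2r; rewrite ?nnegrE ?expR_ge0 ?subr_ge0 ?expR_ge1Dx.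
by rewrite ler_expR mulrN lerN2 [leRHS]mulrC ler_wpM2l.
Qed.

Lemma sum_by_tree_size (P : pred nat) (G : nat -> R) :
  \sum_(C : {set T} | P #|C|) \sum_(K : {set {set T}} | is_tree C K && (K \subset E)) G #|C| =
  \sum_(k < N.+1 | P k) #|all_trees E k|%:R * G k.
Proof.
rewrite pair_big_dep /=.
rewrite (partition_big (fun t : {set T} * {set {set T}} => inord #|t.1| : 'I_N.+1)
    (fun k => P (val k))) /=.
  apply: eq_bigr => k Pk; rewrite (eq_bigr (fun=> G k)) => [|t /andP[_ /eqP <-]]; last first.
    by rewrite inordK // ltnS max_card.
  rewrite sumr_const -[LHS]mulr_natl; congr (_%:R * _); apply: eq_card => t.
  rewrite [RHS]inE unfold_in /=.
  have tk : (inord #|t.1| == k :> 'I_N.+1) = (#|t.1| == k).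
    by rewrite -val_eqE /= inordK // ltnS max_card.
  rewrite tk; case: (eqVneq #|t.1| k) => [->|]; rewrite ?andbF //.
  by rewrite Pk /= andbA.
by move=> t /andP[Pt _]; rewrite inordK // ltnS max_card.
Qed.

(** The powers of [d] cancel against those of [p], leaving [alpha^(k-1)]; the rest is Stirling. *)
Lemma tree_count_le k : (0 < k)%N ->
  k%:R * #|all_trees E k|%:R * p ^+ k.-1 <=
    N%:R / alpha * expR (k%:R * (1 + ln alpha) - 3 / 2 * ln k%:R).
Proof.
move=> k0; apply: (@le_trans _ _ (N%:R * d%:R ^+ k.-1 * rho R k * p ^+ k.-1)).
  by rewrite ler_wpM2r ?exprn_ge0 // all_trees_upper.
have -> : N%:R * d%:R ^+ k.-1 * rho R k * p ^+ k.-1 = N%:R / alpha * (alpha ^+ k * rho R k).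
  have -> : alpha ^+ k = alpha * (d%:R ^+ k.-1 * p ^+ k.-1).
    by rewrite -exprMn mulrCA divff ?mulr1 ?gt_eqF // -exprS prednK.
  by field; rewrite gt_eqF.
rewrite ler_wpM2l ?divr_ge0 ?(ltW alpha0) //.
have -> : alpha ^+ k = expR (k%:R * ln alpha) by rewrite expRM_natl lnK ?posrE.
have /andP[_ hi] := rho_bounds R k0.
apply: (@le_trans _ _ (expR (k%:R * ln alpha) * expR (k%:R - 3 / 2 * ln k%:R))).
  by rewrite ler_wpM2l ?expR_ge0.
by rewrite -expRD ler_expR; lra.
Qed.

(* Each component with excess at least [j] is charged to a spanning tree and [j] of
   its further edges; the boundary has at least [d k (1 - 2 eps)] edges. *)
Lemma mid_components (j a : nat) (eps : R) : delta <= eps ->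
  subgraph_mean E p (fun H => \sum_(C in components H |
      [&& (a <= #|C|)%N, #|C|%:R <= eps * N%:R & (#|C| + j <= #|edges_in H C|.+1)%N])
    #|C|%:R) <=
  N%:R / alpha * p ^+ j * \sum_(k < N.+1 | (a <= k)%N && (0 < k)%N)
    k%:R ^+ (2 * j) * expR (- ((alpha - 1 - ln alpha - 2 * alpha * eps) * k%:R)).
Proof.
move=> de; pose P (k : nat) := [&& (a <= k)%N, (0 < k)%N & (k%:R <= eps * N%:R)].
pose W C K F H : bool := (K :|: F \subset H)%SET && [disjoint boundary E C & H].
apply: (@le_trans _ _ (subgraph_mean E p (fun H => \sum_(C : {set T} | P #|C|)
   \sum_(K : {set {set T}} | is_tree C K && (K \subset E))
   \sum_(F : {set {set T}} | (F \subset edges_in E C :\: K)%SET && (#|F| == j))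
      #|C|%:R * (W C K F H)%:R))).
  apply: le_subgraph_mean => // H HE.
  rewrite [leLHS](_ : _ = \sum_(C : {set T} | P #|C|)
     if (C \in components H) && (#|C| + j <= #|edges_in H C|.+1)%N then #|C|%:R else 0); last first.
    rewrite -big_mkcondr /=; apply: eq_bigl => C; rewrite /P.
    case cC : (C \in components H) => /=; last by rewrite andbF.
    by rewrite (component_card_gt0 cC) /= andbA.
  apply: ler_sum => C _; case: ifP => [/andP[cC jC]|_]; last first.
    by apply: sumr_ge0 => ? _; apply: sumr_ge0 => ? _; rewrite mulr_ge0.
  have [K tK KH] := component_tree (simple_sub HE sE) cC.
  have /and4P[_ _ _ /eqP kK] := tK.
  have HEC : edges_in H C \subset edges_in E C.
    by apply/fintype.subsetP => f; rewrite !inE => /andP[/(fintype.subsetP HE)->].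
  have KE : K \subset E by rewrite (fintype.subset_trans KH) // (fintype.subset_trans HEC)
      ?edges_in_sub.
  have : (j <= #|(edges_in H C :\: K)%SET|)%N.
    rewrite cardsD (finset.setIidPr KH) leq_subRL ?subset_leq_card //.
    by rewrite -ltnS -addSn kK.
  move=> /subset_of_card[F FH Fj].
  rewrite (bigD1 K) ?tK //= (bigD1 F) /=; last first.
    by rewrite Fj eqxx andbT (fintype.subset_trans FH) // finset.setSD.
  have -> : W C K F H.
    apply/andP; split; last exact: (component_boundary sE HE cC).
    rewrite finset.subUset (fintype.subset_trans KH) ?edges_in_sub //=.
    by rewrite (fintype.subset_trans FH) // (fintype.subset_trans (finset.subsetDl _ _))
        ?edges_in_sub.
  rewrite mulr1 -addrA lerDl addr_ge0 //.
    by apply: sumr_ge0 => ? _; rewrite mulr_ge0.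
  by apply: sumr_ge0 => ? _; apply: sumr_ge0 => ? _; rewrite mulr_ge0.
rewrite subgraph_mean_sum.
pose G (k : nat) : R := (k ^ 2)%:R ^+ j * (k%:R * (p ^+ (k.-1 + j) * expR (- (alpha * k%:R *
    (1 - 2 * eps))))).
apply: (@le_trans _ _ (\sum_(C : {set T} | P #|C|) \sum_(K : {set {set T}} |
    is_tree C K && (K \subset E)) G #|C|)).
  apply: ler_sum => C /and3P[aC C0 Ceps]; rewrite subgraph_mean_sum.
  apply: ler_sum => K /andP[tK KE]; rewrite subgraph_mean_sum.
  have /and4P[_ iK _ /eqP kK] := tK.
  apply: (@le_trans _ _ (\sum_(F : {set {set T}} | (F \subset edges_in E C :\: K)%SET && (#|F|
      == j))
     #|C|%:R * (p ^+ (#|C|.-1 + j) * expR (- (alpha * #|C|%:R * (1 - 2 * eps)))))).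
    apply: ler_sum => F /andP[FK /eqP Fj].
    rewrite subgraph_meanZ -subgraph_probE ler_wpM2l // prob_open_closed //.
    - have -> : #|(K :|: F)%SET| = (#|C|.-1 + j)%N.
        rewrite card_disjointU ?Fj -?kK //.
        by rewrite disjoint_sym -setI_eq0; apply/eqP/setP => f; rewrite !inE;
          apply/negP => /andP[/(fintype.subsetP FK)]; rewrite !inE => /andP[/negPf->].
      rewrite ler_wpM2l ?exprn_ge0 //.
      have -> : alpha * #|C|%:R * (1 - 2 * eps) = p * (d%:R * #|C|%:R * (1 - 2 * eps)).
        by field; rewrite gt_eqF.
      apply: expr1B_le.
      have := boundary_card C sE rE => /(congr1 (fun m => m%:R : R)).
      rewrite natrD [RHS]natrM => bE; have := mix C.
      have : #|C|%:R / N%:R <= eps.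
        by rewrite ler_pdivrMr // ltr0n (leq_trans C0) // max_card.
      move: bE; set b := #|boundary E C|%:R; set e2 := (2 * _)%:R; set dk := d%:R * _.
      have dk0 : 0 <= dk by rewrite mulr_ge0.
      (* Both [#|C| / N] and [delta] are at most [eps], so at most a share [2 * eps] of the edge
         ends at [C] stays inside. *)
      move=> bE xe; have : dk * (#|C|%:R / N%:R + delta) <= dk * (2 * eps).
        by rewrite ler_wpM2l //; lra.
      by lra.
    - rewrite finset.subUset KE /= (fintype.subset_trans FK) //.
      by rewrite (fintype.subset_trans (finset.subsetDl _ _)) ?edges_in_sub.
    - by apply/fintype.subsetP => f; rewrite !inE => /andP[_ /andP[]].
    - rewrite -setI_eq0; apply/eqP/setP => f; rewrite [RHS]inE; apply/negP.
      rewrite finset.in_setI => /andP[fKF]; rewrite finset.in_setD => /andP[/negP fE _]; apply: fE.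
      move: fKF => /finset.setUP[fK|/(fintype.subsetP FK)/finset.setDP[]//].
      by rewrite inE (fintype.subsetP KE) // (forall_inP iK).
  rewrite -[X in _ <= X]/(G #|C|) sumr_const -[leLHS]mulr_natl /G ler_wpM2r //.
    by rewrite !mulr_ge0 ?exprn_ge0 ?expR_ge0.
  rewrite -natrX ler_nat -[X in (X <= _)%N]cardsE.
  apply: leq_trans (card_draws_le _ _) _; case: (posnP j) => [->//|j0].
  rewrite leq_exp2r //; apply: (@leq_trans #|edges_in E C|).
    exact/subset_leq_card/finset.subsetDl.
  by apply: leq_trans (edges_in_card_sq C sE); rewrite leq_pmull.
rewrite sum_by_tree_size mulr_sumr.
rewrite [leRHS]big_mkcond [leLHS]big_mkcond; apply: ler_sum => k _.
have rhs0 : 0 <= N%:R / alpha * p ^+ j * (k%:R ^+ (2 * j) * expR (- ((alpha - 1 - ln alpha - 2 *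
    alpha * eps) * k%:R))).
  by rewrite !mulr_ge0 ?exprn_ge0 ?expR_ge0 ?divr_ge0 ?invr_ge0 ?(ltW alpha0).
rewrite /P; case: (leqP a k) => //= ak; case: (posnP k) => //= k0; case: ifP => // _.
have -> : #|all_trees E k|%:R * G k = k%:R * #|all_trees E k|%:R * p ^+ k.-1 *
   (p ^+ j * (k%:R ^+ (2 * j) * expR (- (alpha * k%:R * (1 - 2 * eps))))).
  by rewrite /G exprD natrX -exprM; ring.
apply: (@le_trans _ _ (N%:R / alpha * expR (k%:R * (1 + ln alpha) - 3 / 2 * ln k%:R) *
   (p ^+ j * (k%:R ^+ (2 * j) * expR (- (alpha * k%:R * (1 - 2 * eps))))))).
  by rewrite ler_wpM2r ?tree_count_le // !mulr_ge0 ?exprn_ge0 ?expR_ge0.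
rewrite -mulrA -[leRHS]mulrA ler_wpM2l ?divr_ge0 ?(ltW alpha0) //.
rewrite mulrCA ler_wpM2l ?exprn_ge0 // mulrCA ler_wpM2l ?exprn_ge0 //.
rewrite -expRD ler_expR.
(* The factor [k^(-3/2)] of the tree count is given up here. *)
have : 0 <= ln k%:R :> R by rewrite ln_ge0 // ler1n.
lra.
Qed.

(** AM-GM in the form [f i / m <= exp(f i / m - 1)], convenient when [m] is only close to the mean
    of the factors. *)
Lemma prod_le_expR (I : finType) (A : {set I}) (f : I -> R) (m : R) : 0 < m ->
  (forall i, 0 <= f i) ->
  \prod_(i in A) f i <= m ^+ #|A| * expR ((\sum_(i in A) f i) / m - #|A|%:R).
Proof.
move=> m0 f0; have -> : (\sum_(i in A) f i) / m - #|A|%:R = \sum_(i in A) (f i / m - 1).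
  by rewrite sumrB mulr_suml sumr_const.
rewrite expR_sum -prodr_const -big_split /=.
apply: ler_prod => i _; rewrite f0 /= -ler_pdivrMl // mulrC.
by apply: le_trans (expR_ge1Dx _); rewrite addrC subrK.
Qed.

(** The parent count is a product of [k - 1] inner degrees, whose sum is at most [2 e(C) <= k m] by
    [mix]. Comparing with [m] for each factor leaves [exp(k - (k - 1))], the constant [expR 1]. *)
Lemma spanning_trees_le C : (0 < #|C|)%N ->
  #|[set K : {set {set T}} | is_tree C K && (K \subset E)]%SET|%:R * p ^+ #|C|.-1 <=
    expR 1 * (alpha * (#|C|%:R / N%:R + delta)) ^+ #|C|.-1.
Proof.
move=> C0; have N0 : (0 < N)%N by rewrite (leq_trans C0) ?max_card.
set k := #|C| in C0 *; set x := k%:R / N%:R; set m := d%:R * (x + delta).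
have x0 : 0 < x by rewrite divr_gt0 ?ltr0n.
have m0 : 0 < m by rewrite mulr_gt0 // ltr_pwDl.
have [r rC] : exists r, r \in C by apply/finset.set0Pn; rewrite -card_gt0.
have -> : alpha * (x + delta) = m * p by rewrite /m; field; rewrite gt_eqF.
rewrite [(m * _) ^+ _]exprMn mulrA ler_wpM2r ?exprn_ge0 //.
apply: (@le_trans _ _ (\prod_(v in C :\ r) #|[set w in C | adj E v w]%SET|)%:R).
  by rewrite ler_nat card_spanning_trees.
rewrite natr_prod.
apply: le_trans (prod_le_expR (C :\ r)%SET m0 _) _ => //.
have -> : #|(C :\ r)%SET| = k.-1 by rewrite /k (cardsD1 r C) rC.
rewrite mulrC ler_wpM2r ?exprn_ge0 ?(ltW m0) // ler_expR.
have kE : k%:R = k.-1%:R + 1 :> R by rewrite natr1 prednK.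
suff : (\sum_(v in C :\ r) #|[set w in C | adj E v w]%SET|%:R) / m <= k%:R by rewrite kE; lra.
rewrite ler_pdivrMr // (le_trans _ (_ : (2 * #|edges_in E C|)%:R <= _)) //; last first.
  by have := mix C; rewrite -/k -/x /m [k%:R * (_ * _)]mulrCA mulrA.
rewrite -sum_inner_degree // natr_sum [leRHS](bigD1 r) //=.
rewrite (eq_bigl (fun v => (v \in C) && (v != r))) ?lerDr // => v.
by rewrite !inE andbC.
Qed.

(** [F] holds the at most one edge that closes a cycle. [K :|: F] has at least [k - 1] edges, which
    gives the power of [p], and at most [k], which costs [alpha k / d] among the deleted edges. *)
Lemma trace_prob_le C K F : is_tree C K -> K \subset E -> F \subset edges_in E C ->
  (#|F| <= 1)%N ->
  subgraph_prob E p (fun H => (H :&: touching E C == K :|: F)%SET) <=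
    p ^+ #|C|.-1 * expR (- (alpha * #|C|%:R) +
      alpha * #|C|%:R * (#|C|%:R / N%:R + delta) / 2 + alpha * #|C|%:R / d%:R).
Proof.
move=> tK KE FC F1; have /and4P[_ iK _ /eqP kK] := tK.
have sub : (K :|: F)%SET \subset touching E C.
  apply: fintype.subset_trans (edges_in_touching C sE).
  rewrite finset.subUset FC andbT; apply/fintype.subsetP => f fK.
  by rewrite inE (fintype.subsetP KE) // (forall_inP iK).
have tE : touching E C \subset E by apply/fintype.subsetP => f; rewrite inE => /andP[].
rewrite subgraph_probE subgraph_mean_trace //.
have lek : (#|C|.-1 <= #|(K :|: F)%SET| <= #|C|)%N.
  rewrite -kK subset_leq_card ?finset.subsetUl //=.
  by rewrite (leq_trans (leq_card_setU _ _).1) // -addn1 leq_add2l.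
apply: ler_pM; rewrite ?exprn_ge0 ?subr_ge0 //.
  by apply: ler_wiXn2l => //; case/andP: lek.
have -> : - (alpha * #|C|%:R) + alpha * #|C|%:R * (#|C|%:R / N%:R + delta) / 2 + alpha *
    #|C|%:R / d%:R
   = - (p * (d%:R * #|C|%:R - d%:R * #|C|%:R * (#|C|%:R / N%:R + delta) / 2 - #|C|%:R)).
  by move: (_ / N%:R + delta) => y; field; rewrite gt_eqF.
apply: expr1B_le.
have := touching_card C sE rE; rewrite -[#|touching _ _|](cardsID (K :|: F)%SET)
    (finset.setIidPr sub).
move=> /(congr1 (fun m => m%:R : R)); rewrite !natrD [RHS]natrM => tc.
have := mix C; rewrite natrM.
have : #|(K :|: F)%SET|%:R <= #|C|%:R :> R by rewrite ler_nat; case/andP: lek.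
move: tc; set dk := d%:R * #|C|%:R; set y := dk * _; lra.
Qed.

Lemma small_sets_card (U : finType) (A : {set U}) :
  (#|[set F : {set U} | (F \subset A) && (#|F| <= 1)%N]%SET| <= #|A|.+1)%N.
Proof.
apply: (@leq_trans #|finset.set0 |: [set [set x]%SET | x in A]|%SET).
  apply/subset_leq_card/fintype.subsetP => F; rewrite inE => /andP[FA].
  case: (eqVneq F finset.set0) => [->|F0 F1]; first by rewrite !inE eqxx.
  have /cards1P[x Fx] : #|F| == 1%N by rewrite eqn_leq F1 card_gt0.
  apply/finset.setUP; right; apply/imsetP; exists x => //.
  by rewrite -finset.sub1set -Fx.
by rewrite cardsU1 -add1n; apply: leq_add; [exact: leq_b1|exact: leq_imset_card].
Qed.

(** With [x = k / N], the number [C(N, k) x^k (1 - x)^(N - k)] is one term of the expansion of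
    [(1 - x + x)^N = 1]. *)
Lemma binomial_entropy k : (0 < k <= N)%N ->
  'C(N, k)%:R * (k%:R / N%:R) ^+ k <=
    expR (- ((N%:R - k%:R) * ln (1 - k%:R / N%:R))) :> R.
Proof.
move=> /andP[k0 kN]; set x : R := k%:R / N%:R.
have N0 : (0 < N)%N by rewrite (leq_trans k0).
have NR : 0 < N%:R :> R by rewrite ltr0n.
move: kN; rewrite leq_eqVlt => /orP[/eqP kN|kN].
  by rewrite /x kN binn subrr mul0r oppr0 expR0 mul1r divff ?gt_eqF // expr1n.
have x1 : 0 < 1 - x by rewrite subr_gt0 /x ltr_pdivrMr // mul1r ltr_nat.
have x0 : 0 <= x by rewrite divr_ge0.
rewrite expRN -natrB ?(ltnW kN) // expRM_natl lnK ?posrE //.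
rewrite -[leRHS]mul1r ler_pdivlMr ?exprn_gt0 //.
have := exprDn (1 - x) x N; rewrite subrK expr1n => e1; rewrite [leRHS]e1.
have kN1 : (k < N.+1)%N by rewrite ltnS ltnW.
rewrite (bigD1 (Ordinal kN1)) //= -[X in _ <= X + _]mulr_natl -mulrA [x ^+ k * _]mulrC lerDl.
by apply: sumr_ge0 => i _; rewrite mulrn_wge0 // mulr_ge0 ?exprn_ge0 // ltW.
Qed.

Lemma sum_by_size (P : pred nat) (G : nat -> R) :
  \sum_(C : {set T} | P #|C|) G #|C| = \sum_(k < N.+1 | P k) 'C(N, k)%:R * G k.
Proof.
rewrite (partition_big (fun C : {set T} => inord #|C| : 'I_N.+1) (fun k => P (val k))) /=.
  apply: eq_bigr => k Pk; rewrite (eq_bigr (fun=> G k)) => [|C /andP[_ /eqP <-]]; last first.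
    by rewrite inordK // ltnS max_card.
  rewrite sumr_const -[LHS]mulr_natl -card_draws -[#|_|]cardsE; congr (_%:R * _).
  apply: eq_card => C; rewrite [LHS]inE [RHS]inE unfold_in /=.
  have tk : (inord #|C| == k :> 'I_N.+1) = (#|C| == k).
    by rewrite -val_eqE /= inordK // ltnS max_card.
  by rewrite tk; case: (eqVneq #|C| k) => [->|]; rewrite ?andbF // Pk.
by move=> C PC; rewrite inordK // ltnS max_card.
Qed.

(* Here trees are counted as spanning trees of a [k]-set, at most
   [e (dk/n + lambda)^(k-1)] of them by AM-GM: the count [d^(k-1) k^(k-1)/k!] is
   too large for [k] linear in [n]. *)
Lemma large_components (eps : R) : 0 < eps ->
  alpha * eps <= alpha - 1 - ln alpha ->
  delta * (1 + alpha / 2) + alpha / d%:R <= eps * (alpha - 1 - ln alpha) / 4 ->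
  subgraph_prob E p (fun H => [exists C : {set T}, [&& C \in components H,
      eps * N%:R <= #|C|%:R & (#|edges_in H C| <= #|C|)%N]]) <=
  N.+1%:R * (N ^ 2).+1%:R * (expR 1 / (alpha * eps)) *
    expR (- (N%:R * (eps * (alpha - 1 - ln alpha) / 4))).
Proof.
move=> e0 ae small; set eta := alpha - 1 - ln alpha in ae small *.
pose P (k : nat) := (0 < k)%N && (eps * N%:R <= k%:R :> R).
pose I := ({set T} * {set {set T}} * {set {set T}})%type.
pose Q (i : I) := [&& P #|i.1.1|, is_tree i.1.1 i.1.2 && (i.1.2 \subset E) &
  (i.2 \subset edges_in E i.1.1) && (#|i.2| <= 1)%N].
apply: le_trans (@union_bound R _ _ _ p0 p1 I Q
  (fun i H => (H :&: touching E i.1.1 == i.1.2 :|: i.2)%SET) _ _) _.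
  move=> H HE /existsP[C /and3P[cC Ce ee]].
  have [K tK KH] := component_tree (simple_sub HE sE) cC.
  have /and4P[_ _ _ /eqP kK] := tK.
  have HEC : edges_in H C \subset edges_in E C.
    by apply/fintype.subsetP => f; rewrite !inE => /andP[/(fintype.subsetP HE)->].
  exists (C, K, (edges_in H C :\: K)%SET).
    rewrite /Q /P /= (component_card_gt0 cC) Ce tK /=; apply/and3P; split.
    - by rewrite (fintype.subset_trans KH) // (fintype.subset_trans HEC) ?edges_in_sub.
    - by apply: fintype.subset_trans HEC; apply: finset.subsetDl.
    - by rewrite cardsD (finset.setIidPr KH) leq_subLR addn1 kK.
  rewrite /= component_touching //; apply/eqP/setP => f; rewrite !inE.
  case fK : (f \in K) => //=; have := fintype.subsetP KH _ fK.
  by rewrite inE.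
pose B (k : nat) : R := (N ^ 2).+1%:R * (expR 1 * (alpha * (k%:R / N%:R + delta)) ^+ k.-1 *
  expR (- (alpha * k%:R) + alpha * k%:R * (k%:R / N%:R + delta) / 2 + alpha * k%:R / d%:R)).
apply: (@le_trans _ _ (\sum_(C : {set T} | P #|C|) B #|C|)).
  have -> : \sum_(i | Q i) subgraph_prob E p (fun H => (H :&: touching E i.1.1 == i.1.2 :|:
      i.2)%SET) =
    \sum_(C : {set T} | P #|C|) \sum_(K : {set {set T}} | is_tree C K && (K \subset E))
      \sum_(F : {set {set T}} | (F \subset edges_in E C) && (#|F| <= 1)%N)
        subgraph_prob E p (fun H => (H :&: touching E C == K :|: F)%SET).
    rewrite [RHS]pair_big_dep [RHS]pair_big_dep /=.
    by apply: eq_bigl => i; rewrite /Q -!andbA.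
  apply: ler_sum => C /andP[C0 _]; pose ex : R := - (alpha * #|C|%:R) +
      alpha * #|C|%:R * (#|C|%:R / N%:R + delta) / 2 + alpha * #|C|%:R / d%:R.
  apply: (@le_trans _ _ (\sum_(K : {set {set T}} | is_tree C K && (K \subset E))
      (N ^ 2).+1%:R * (p ^+ #|C|.-1 * expR ex))).
    apply: ler_sum => K /andP[tK KE].
    apply: (@le_trans _ _ (\sum_(F : {set {set T}} | (F \subset edges_in E C) && (#|F| <= 1)%N)
       p ^+ #|C|.-1 * expR ex)).
      by apply: ler_sum => F /andP[FC F1]; apply: trace_prob_le.
    rewrite sumr_const -[leLHS]mulr_natl ler_wpM2r ?mulr_ge0 ?exprn_ge0 ?expR_ge0 //.
    rewrite ler_nat -[X in (X <= _)%N]cardsE; apply: leq_trans (small_sets_card _) _.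
    rewrite ltnS (@leq_trans (#|C| ^ 2)) ?leq_exp2r ?max_card //.
    by apply: leq_trans (edges_in_card_sq C sE); rewrite leq_pmull.
  rewrite sumr_const -[leLHS]mulr_natl mulrCA /B ler_wpM2l // mulrA ler_wpM2r ?expR_ge0 //.
  by have := spanning_trees_le C0; rewrite cardsE.
rewrite sum_by_size.
have aep : 0 < alpha * eps by rewrite mulr_gt0.
have rhs0 : 0 <= (N ^ 2).+1%:R * (expR 1 / (alpha * eps)) * expR (- (N%:R * (eps * eta / 4))).
  by rewrite !mulr_ge0 ?expR_ge0 ?divr_ge0 ?ltW // invr_gt0.
apply: (@le_trans _ _ (\sum_(k < N.+1) (N ^ 2).+1%:R * (expR 1 / (alpha * eps)) *
    expR (- (N%:R * (eps * eta / 4))))); last first.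
  by rewrite sumr_const card_ord -[leLHS]mulr_natl !mulrA.
rewrite [leLHS]big_mkcond; apply: ler_sum => k _.
case: ifP => // /andP[k0 ek]; have kN : (k <= N)%N by rewrite -ltnS.
have NR : 0 < N%:R :> R by rewrite ltr0n (leq_trans k0).
set x : R := k%:R / N%:R; have kE : k%:R = x * N%:R by rewrite divfK ?gt_eqF.
have ex : eps <= x by rewrite ler_pdivlMr.
have x1 : x <= 1 by rewrite ler_pdivrMr // mul1r ler_nat.
have x0 : 0 < x by rewrite (lt_le_trans e0).
set y := alpha * (x + delta).
have yae : alpha * eps <= y by rewrite ler_pM2l // ler_wpDr.
have y0 : 0 < y by rewrite (lt_le_trans aep).
rewrite /B -/x -/y; set exo := - (alpha * k%:R) + _ + _.
(* Since [y] is at least [alpha * eps], raising the exponent from [k - 1] to [k] costs the constant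
   [1 / (alpha * eps)]. *)
have yk : y ^+ k.-1 <= (alpha * eps)^-1 * y ^+ k.
  by rewrite -[in leRHS](prednK k0) exprS mulrA ler_peMl ?exprn_ge0 ?(ltW y0)
      // mulrC ler_pdivlMr // mul1r.
have yk2 : 'C(N, k)%:R * y ^+ k <= expR (k%:R * ln alpha + delta * N%:R - (N%:R - k%:R) *
    ln (1 - x)).
  (* [(1 + delta / x)^k <= exp(k delta / x)], and [k / x = N]. *)
  have xd : (x + delta) ^+ k <= x ^+ k * expR (delta * N%:R).
    have -> : x + delta = x * (1 + delta / x) by field; rewrite gt_eqF.
    rewrite exprMn ler_wpM2l ?exprn_ge0 ?(ltW x0) //.
    have -> : delta * N%:R = k%:R * (delta / x) by rewrite kE; field; rewrite gt_eqF.
    rewrite expRM_natl; apply: lerXn2r; rewrite ?nnegrE ?expR_ge0 ?expR_ge1Dx //.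
    by rewrite addr_ge0 // divr_ge0 // ltW.
  rewrite /y exprMn !expRD expRM_natl lnK ?posrE //.
  rewrite mulrCA -mulrA ler_wpM2l ?exprn_ge0 ?(ltW alpha0) //.
  apply: (@le_trans _ _ ('C(N, k)%:R * (x ^+ k * expR (delta * N%:R)))).
    by rewrite ler_wpM2l.
  rewrite mulrA mulrC ler_wpM2l ?expR_ge0 //.
  by have := @binomial_entropy k; rewrite k0 kN => /(_ isT).
have expo : k%:R * ln alpha + delta * N%:R - (N%:R - k%:R) * ln (1 - x) + exo <= - (N%:R * (eps *
    eta / 4)).
  have -> : k%:R * ln alpha + delta * N%:R - (N%:R - k%:R) * ln (1 - x) + exo =
    N%:R * ((- (1 - x) * ln (1 - x) + x * ln alpha - alpha * x + alpha * x ^+ 2 / 2) +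
      (delta + alpha * x * delta / 2 + alpha * x / d%:R)).
    by rewrite /exo -/x kE; field; rewrite gt_eqF.
  rewrite -[leRHS]mulrN ler_wpM2l ?(ltW NR) //.
  have := large_exponent alpha0 e0 ae ex x1; rewrite -/eta.
  have : alpha * x * delta / 2 <= delta * (alpha / 2).
    have -> : alpha * x * delta / 2 = x * (delta * (alpha / 2)) by ring.
    by rewrite ler_piMl // mulr_ge0 // divr_ge0 // ltW.
  have : alpha * x / d%:R <= alpha / d%:R.
    by rewrite ler_wpM2r ?invr_ge0 // ler_piMr // ltW.
  move: small; lra.
set Z := expR (- (N%:R * _)) in expo *.
have -> : 'C(N, k)%:R * ((N ^ 2).+1%:R * (expR 1 * y ^+ k.-1 * expR exo)) =
  (N ^ 2).+1%:R * (expR 1 * ('C(N, k)%:R * (y ^+ k.-1 * expR exo))) by ring.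
rewrite -!mulrA ler_wpM2l // ler_wpM2l ?expR_ge0 //.
apply: (@le_trans _ _ ('C(N, k)%:R * ((alpha * eps)^-1 * y ^+ k * expR exo))).
  by rewrite ler_wpM2l // ler_wpM2r ?expR_ge0.
have -> : 'C(N, k)%:R * ((alpha * eps)^-1 * y ^+ k * expR exo) = (alpha * eps)^-1 * ('C(N, k)%:R *
    y ^+ k * expR exo) by ring.
rewrite ler_wpM2l ?invr_ge0 ?(ltW aep) //.
apply: le_trans (_ : expR _ * expR exo <= _); first by rewrite ler_wpM2r ?expR_ge0 //; exact: yk2.
by rewrite -expRD /Z ler_expR.
Qed.

(** Only the trivial bound on inner edges is used: at least [d k - k^2] edges are deleted, and the
    hypothesis on [b] keeps the correction [alpha k^2 / d] below 1. The cost is the constant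
    [expR 1], so the full rate [eta] and the power [k^(-5/2)] survive. *)
Lemma small_isolated_trees (a b : nat) : alpha * (b ^ 2)%:R <= d%:R ->
  subgraph_prob E p (fun H => [exists C : {set T},
    isolated_tree H C && (a <= #|C| <= b)%N]) <=
  N%:R / alpha * expR 1 * \sum_(k < N.+1 | (0 < k)%N && (a <= k <= b)%N)
    expR (- ((alpha - 1 - ln alpha) * k%:R) - 5 / 2 * ln k%:R).
Proof.
move=> bd; pose P (k : nat) := (0 < k)%N && (a <= k <= b)%N.
pose Q (t : {set T} * {set {set T}}) := P #|t.1| && (is_tree t.1 t.2 && (t.2 \subset E)).
apply: le_trans (@union_bound R _ _ _ p0 p1 _ Q
  (fun t H => (H :&: touching E t.1 == t.2)%SET) _ _) _.
  move=> H HE /existsP[C /andP[iC Cab]].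
  have tC := isolated_tree_edges (simple_sub HE sE) iC.
  have /andP[cC _] := iC.
  exists (C, edges_in H C); last by rewrite /= component_touching.
  rewrite /Q /P /= Cab (component_card_gt0 cC) tC /=.
  by apply: fintype.subset_trans HE; apply: edges_in_sub.
pose G (k : nat) : R := p ^+ k.-1 * expR (1 - alpha * k%:R).
apply: (@le_trans _ _ (\sum_(C : {set T} | P #|C|) \sum_(K : {set {set T}} |
    is_tree C K && (K \subset E)) G #|C|)).
  rewrite [leRHS]pair_big_dep /=; apply: ler_sum => -[C K] /andP[/= /andP[C0 /andP[_ Cb]]
      /andP[tK KE]].
  have /and4P[_ iK _ /eqP kK] := tK.
  have KEC : K \subset edges_in E C.
    by apply/fintype.subsetP => f fK; rewrite inE (fintype.subsetP KE) // (forall_inP iK).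
  have KD := fintype.subset_trans KEC (edges_in_touching C sE).
  rewrite subgraph_probE subgraph_mean_trace //; last by apply/fintype.subsetP => f;
      rewrite inE => /andP[].
  rewrite /G -kK /= ler_wpM2l ?exprn_ge0 // kK.
  apply: (@le_trans _ _ (expR (- (p * (d%:R * #|C|%:R - (#|C| ^ 2)%:R))))).
    apply: expr1B_le.
    have := touching_card C sE rE; rewrite -[#|touching _ _|](cardsID K) (finset.setIidPr KD).
    have := edges_in_card_sq C sE; rewrite -kK; set t := #|_ :\: _|%SET; set e := #|edges_in _ _|.
    move=> e2 tc; rewrite lerBlDr -natrM -natrD ler_nat -tc.
    by rewrite -addnA addnCA leq_add2l; apply: half_square_bound.
  rewrite ler_expR.
  have -> : - (p * (d%:R * #|C|%:R - (#|C| ^ 2)%:R)) = alpha * (#|C| ^ 2)%:R / d%:R - alpha *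
      #|C|%:R.
    by field; rewrite gt_eqF.
  rewrite lerD2r ler_pdivrMr // mul1r (le_trans _ bd) // ler_pM2l // ler_nat.
  by rewrite leq_exp2r.
rewrite sum_by_tree_size mulr_sumr; apply: ler_sum => k /andP[k0 _].
have kR : 0 < k%:R :> R by rewrite ltr0n.
rewrite -(ler_pM2l kR) /G.
have -> : k%:R * (#|all_trees E k|%:R * (p ^+ k.-1 * expR (1 - alpha * k%:R))) =
  k%:R * #|all_trees E k|%:R * p ^+ k.-1 * expR (1 - alpha * k%:R) by ring.
apply: (@le_trans _ _ (N%:R / alpha * expR (k%:R * (1 + ln alpha) - 3 / 2 * ln k%:R) *
    expR (1 - alpha * k%:R))).
  by rewrite ler_wpM2r ?expR_ge0 ?tree_count_le.
set Z := expR (- _ - _).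
have -> : k%:R * (N%:R / alpha * expR 1 * Z) = N%:R / alpha * (k%:R * expR 1 * Z) by ring.
rewrite -[leLHS]mulrA ler_wpM2l ?divr_ge0 ?(ltW alpha0) //.
rewrite -[X in X * expR 1](@lnK R k%:R) ?posrE // -!expRD ler_expR; lra.
Qed.

Lemma all_treesP k t : reflect [/\ is_tree t.1 t.2, t.2 \subset E & #|t.1| = k]
  (t \in all_trees E k).
Proof. by rewrite inE; apply: (iffP and3P) => -[? ?] => [/eqP|->]. Qed.

Definition isolated_prob (t : {set T} * {set {set T}}) : R :=
  p ^+ #|t.2| * (1 - p) ^+ #|(touching E t.1 :\: t.2)%SET|.

Definition mean_isolated_trees k : R := \sum_(t in all_trees E k) isolated_prob t.

Lemma tree_sub_touching k t : t \in all_trees E k -> t.2 \subset touching E t.1.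
Proof.
move=> /all_treesP[/and4P[_ iK _ _] KE _].
apply: fintype.subset_trans (edges_in_touching _ sE).
by apply/fintype.subsetP => f fK; rewrite inE (fintype.subsetP KE) // (forall_inP iK).
Qed.

Lemma touching_sub C : touching E C \subset E.
Proof. by apply/fintype.subsetP => f; rewrite inE => /andP[]. Qed.

Lemma isolated_probE k t : t \in all_trees E k ->
  subgraph_mean E p (fun H => (H :&: touching E t.1 == t.2)%SET%:R) = isolated_prob t.
Proof.
by move=> tt; rewrite subgraph_mean_trace ?touching_sub // (tree_sub_touching tt).
Qed.

(** Distinct trees sharing a vertex cannot both be components. For disjoint ones the two traces form
    one trace on the union; at most [k ^ 2] edges touch both, and each of these is charged [1 - p]
    once instead of twice. *)
Lemma two_isolated_trees k s t : p < 1 -> s \in all_trees E k -> t \in all_trees E k ->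
  subgraph_mean E p (fun H => ((H :&: touching E s.1 == s.2) && (H :&: touching E t.1 ==
      t.2))%SET%:R) <=
  (if s == t then isolated_prob s else 0) + isolated_prob s * isolated_prob t * (1 - p) ^- (k ^ 2).
Proof.
move=> p1' ss tt; have q0 : 0 < 1 - p by rewrite subr_gt0.
have ip0 u : 0 <= isolated_prob u by rewrite mulr_ge0 ?exprn_ge0 // ltW.
have r0 : 0 <= isolated_prob s * isolated_prob t * (1 - p) ^- (k ^ 2).
  by apply: divr_ge0; [exact: mulr_ge0|rewrite exprn_ge0 // ltW].
have sD := tree_sub_touching ss; have tD := tree_sub_touching tt.
have [eqst|nst] := eqVneq s t.
  rewrite -eqst -[leLHS]addr0 lerD //; last by rewrite eqst in r0 *.
  rewrite -(isolated_probE ss).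
  by apply: le_subgraph_mean => // H _; rewrite andbb.
have /all_treesP[ts sE' sk] := ss; have /all_treesP[tt' tE' tk] := tt.
have [dst|nd] := boolP [disjoint s.1 & t.1]; last first.
  rewrite add0r (le_trans _ r0) // -[leRHS](subgraph_mean_cst E p 0).
  apply: le_subgraph_mean => // H HE; case: eqP => //= Hs; case: eqP => //= Ht.
  exfalso; have /andP[cs /eqP es] := tree_component sE HE ts Hs.
  have /andP[ct /eqP et] := tree_component sE HE tt' Ht.
  move: nd; rewrite -setI_eq0 => /finset.set0Pn[x]; rewrite inE => /andP[xs xt].
  have compE C : C \in components H -> x \in C -> C = component H x.
    move=> /imsetP[r _ ->] xr; apply/setP => y; rewrite !inE in xr *.
    apply/idP/idP; last exact: connect_trans.
    by apply: connect_trans; rewrite connect_adjC.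
  move/eqP: nst; apply; rewrite (surjective_pairing s) (surjective_pairing t).
  by rewrite -es -et (compE _ cs xs) (compE _ ct xt).
rewrite add0r ler_pdivlMr ?exprn_gt0 //.
have /and4P[s1 i1 _ /eqP k1] := ts; have /and4P[s2 i2 _ /eqP k2] := tt'.
have dF : [disjoint s.2 & t.2] := simple_disjoint_edges sE sE' i1 i2 dst.
pose D := (touching E s.1 :|: touching E t.1)%SET; pose F := (s.2 :|: t.2)%SET.
have FD : F \subset D by apply: finset.setUSS.
have DE : D \subset E by rewrite finset.subUset !touching_sub.
apply: (@le_trans _ _ (p ^+ #|F| * (1 - p) ^+ #|(D :\: F)%SET| * (1 - p) ^+ (k ^ 2))).
  rewrite ler_wpM2r ?exprn_ge0 ?(ltW q0) // -(subgraph_mean_trace p FD DE).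
  apply: le_subgraph_mean => // H _; case: eqP => //= Hs; case: eqP => //= Ht.
  by rewrite /D finset.setIUr Hs Ht eqxx.
rewrite /isolated_prob mulrACA -!exprD -mulrA -exprD card_disjointU //.
rewrite ler_wpM2l ?exprn_ge0 //; apply: ler_wiXn2l; rewrite ?(ltW q0) ?lerBlDr ?lerDl //.
have cs := cardsID s.2 (touching E s.1); rewrite (finset.setIidPr sD) in cs.
have ct := cardsID t.2 (touching E t.1); rewrite (finset.setIidPr tD) in ct.
have cD := cardsID F D; rewrite (finset.setIidPr FD) card_disjointU // in cD.
have := cardsUI (touching E s.1) (touching E t.1).
have := touching_cross sE dst; rewrite sk tk mulnn -/D => le_k2 cUI.
exact: union_excess_bound cs ct cD cUI le_k2.
Qed.

(** Chebyshev's inequality: where no tree is isolated the count [X] vanishes, so [(X - mu)^2 / mu^2]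
    is 1 there. *)
Lemma second_moment k : p < 1 -> 0 < mean_isolated_trees k ->
  subgraph_prob E p (fun H => ~~ [exists C : {set T}, isolated_tree H C && (#|C| == k)]) <=
  (mean_isolated_trees k)^-1 + ((1 - p) ^- (k ^ 2) - 1).
Proof.
move=> p1' mu0; set mu := mean_isolated_trees k in mu0 *.
pose I t H : R := (H :&: touching E t.1 == t.2)%SET%:R.
pose X H := \sum_(t in all_trees E k) I t H.
have EX : subgraph_mean E p X = mu.
  rewrite subgraph_mean_sum; apply: eq_bigr => t tt.
  exact: isolated_probE tt.
have EX2 : subgraph_mean E p (fun H => X H ^+ 2) <= mu + mu ^+ 2 * (1 - p) ^- (k ^ 2).
  rewrite (@eq_subgraph_mean _ _ _ _ _ (fun H => \sum_(s in all_trees E k) \sum_(t in all_trees E k)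
     ((H :&: touching E s.1 == s.2) && (H :&: touching E t.1 == t.2))%SET%:R)); last first.
    move=> H _; rewrite expr2 /X mulr_suml; apply: eq_bigr => s _.
    rewrite mulr_sumr; apply: eq_bigr => t _; rewrite /I -natrM; congr (_%:R).
    by case: (_ == _); case: (_ == _).
  rewrite subgraph_mean_sum.
  have -> : mu + mu ^+ 2 * (1 - p) ^- (k ^ 2) = \sum_(s in all_trees E k)
    \sum_(t in all_trees E k) ((if s == t then isolated_prob s else 0) +
       isolated_prob s * isolated_prob t * (1 - p) ^- (k ^ 2)).
    transitivity (\sum_(s in all_trees E k) (isolated_prob s + isolated_prob s * mu * (1 - p)
        ^- (k ^ 2))).
      by rewrite big_split /= -mulr_suml -mulr_suml expr2.
    apply: eq_bigr => s ss; rewrite big_split /=; congr (_ + _).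
      by rewrite (bigD1 s) //= eqxx big1 ?addr0 // => t /andP[_]; rewrite eq_sym => /negPf->.
    by rewrite -mulr_suml -mulr_sumr.
  apply: ler_sum => s ss; rewrite subgraph_mean_sum; apply: ler_sum => t tt.
  exact: two_isolated_trees.
apply: (@le_trans _ _ (subgraph_mean E p (fun H => mu ^- 2 * (X H ^+ 2 + (mu ^+ 2 + - (2 * mu) *
    X H))))).
  apply: prob_le_subgraph_mean => // H HE.
    rewrite mulr_ge0 ?invr_ge0 ?exprn_ge0 ?(ltW mu0) //.
    have -> : X H ^+ 2 + (mu ^+ 2 + - (2 * mu) * X H) = (X H - mu) ^+ 2 by ring.
    exact: sqr_ge0.
  move=> nC; have -> : X H = 0.
    apply: big1 => t tt; rewrite /I; case: eqP => // Ht.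
    have /all_treesP[tT tE tk] := tt.
    have /andP[cC /eqP eC] := tree_component sE HE tT Ht.
    case/negP: nC; apply/existsP; exists t.1; rewrite tk eqxx andbT /isolated_tree cC /=.
    by apply/eqP/tree_no_cycle; rewrite eC.
  by rewrite expr0n mulr0 add0r addr0 mulVf // expf_neq0 // gt_eqF.
have -> : subgraph_mean E p (fun H => mu ^- 2 * (X H ^+ 2 + (mu ^+ 2 + - (2 * mu) * X H))) =
    mu ^- 2 * (subgraph_mean E p (fun H => X H ^+ 2) + (mu ^+ 2 + - (2 * mu) * mu)).
  rewrite subgraph_meanZ; congr (_ * _); rewrite subgraph_meanD; congr (_ + _).
  rewrite subgraph_meanD subgraph_mean_cst; congr (_ + _).
  by rewrite -[X in _ = _ * X]EX; apply: subgraph_meanZ.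
apply: (@le_trans _ _ (mu ^- 2 * (mu + mu ^+ 2 * (1 - p) ^- (k ^ 2) + (mu ^+ 2 - 2 * mu * mu)))).
  by rewrite ler_wpM2l ?invr_ge0 ?exprn_ge0 ?(ltW mu0) // mulNr lerD2r.
move: ((1 - p) ^- (k ^ 2)) => w.
by rewrite le_eqVlt; apply/orP; left; apply/eqP; field; rewrite gt_eqF.
Qed.

Lemma mean_isolated_trees_ge (D : nat) k : (0 < k)%N -> (k + D <= d)%N ->
  N%:R * D%:R ^+ k.-1 * rho R k * (p ^+ k.-1 * (1 - p) ^+ (d * k)) <=
    k%:R * mean_isolated_trees k.
Proof.
move=> k0 kD; apply: (@le_trans _ _ (k%:R * #|all_trees E k|%:R * (p ^+ k.-1 * (1 - p) ^+ (d *
    k)))).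
  apply: ler_wpM2r; last exact: (all_trees_lower R rE k0 kD).
  by rewrite mulr_ge0 ?exprn_ge0 ?subr_ge0.
rewrite -mulrA ler_wpM2l // mulr_natl -sumr_const; apply: ler_sum => t tt.
have /all_treesP[/and4P[_ _ _ /eqP kK] _ tk] := tt.
rewrite /isolated_prob -tk -kK /= ler_wpM2l ?exprn_ge0 // kK.
apply: ler_wiXn2l; rewrite ?subr_ge0 ?lerBlDr ?lerDl //.
rewrite -(touching_card t.1 sE rE) (leq_trans _ (leq_addr _ _)) //.
by rewrite subset_leq_card ?finset.subsetDl.
Qed.

(* The sum of [|C(v)|] over [v] is the sum of [|C|^2] over the components. *)
Lemma subcritical_components (a : R) : alpha < 1 -> 0 < a ->
  subgraph_prob E p (fun H => [exists C : {set T}, (C \in components H) && (a <= #|C|%:R)]) <=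
  N%:R / (1 - alpha) / a ^+ 2.
Proof.
move=> alpha1 a0.
apply: (@le_trans _ _ (subgraph_mean E p (fun H => (a ^+ 2)^-1 * \sum_(v : T)
    #|component H v|%:R))).
  apply: prob_le_subgraph_mean => // H HE.
    by rewrite mulr_ge0 ?invr_ge0 ?exprn_ge0 ?(ltW a0) ?sumr_ge0.
  move=> /existsP[C /andP[/imsetP[r _ CE] aC]].
  rewrite -ler_pdivrMl ?invr_gt0 ?exprn_gt0 // invrK mulr1.
  apply: (@le_trans _ _ (#|C|%:R ^+ 2)).
    by apply: lerXn2r; rewrite ?nnegrE ?(ltW a0).
  apply: (@le_trans _ _ (\sum_(v in C) #|component H v|%:R)); last first.
    by rewrite big_mkcond /=; apply: ler_sum => v _; case: ifP.
  rewrite (eq_bigr (fun=> #|C|%:R)) ?sumr_const -?[leRHS]mulr_natl ?expr2 //.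
  move=> v; rewrite CE inE => rv; congr (_%:R); apply: eq_card => y; rewrite !inE.
  apply/idP/idP; first exact: connect_trans.
  by apply: connect_trans; rewrite connect_adjC.
rewrite subgraph_meanZ mulrC ler_wpM2r ?invr_ge0 ?exprn_ge0 ?(ltW a0) //.
rewrite subgraph_mean_sum mulr_natl -sumr_const.
apply: ler_sum => v _.
(* There are [d^l] walks of length [l], and a simple one is open with probability [p^l]; the means
   [alpha^l] form a convergent geometric series. *)
apply: (@le_trans _ _ (subgraph_mean E p (fun H => \sum_(l < N)
    \sum_(q <- walks E l v | uniq (v :: q)) (path_edges v q \subset H)%:R))).
  apply: le_subgraph_mean => // H HE; apply: le_trans (_ : _ <= (_ : nat)%:R) _.
    by rewrite ler_nat; exact: (component_le_paths v HE).
  rewrite natr_sum; apply: ler_sum => l _; rewrite natr_sum big_mkcondr /=.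
  by apply: ler_sum => q _; case: ifP.
rewrite subgraph_mean_sum.
have geo m : \sum_(l < m) alpha ^+ l <= (1 - alpha)^-1.
  rewrite -[leRHS]mul1r ler_pdivlMr ?subr_gt0 // mulrC.
  by rewrite -opprB mulNr -subrX1 opprB lerBlDr lerDl exprn_ge0 ?(ltW alpha0).
apply: le_trans (geo N); apply: ler_sum => l _; rewrite subgraph_mean_sum.
have -> : alpha ^+ l = \sum_(q <- walks E l v) p ^+ l.
  rewrite big_const_seq count_predT (size_walks _ _ rE) iter_addr_0 -[RHS]mulr_natl natrX.
  by rewrite -exprMn mulrCA divff ?mulr1 // gt_eqF.
rewrite big_mkcond /= big_seq [leRHS]big_seq; apply: ler_sum => q qw.
case: ifP => [uq|_]; last by rewrite exprn_ge0.
have /andP[qE /eqP sq] := walks_path qw; rewrite -path_edges_sub in qE.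
have dq : [disjoint path_edges v q & (finset.set0 : {set {set T}})].
  by rewrite -setI_eq0 finset.setI0.
have := prob_open_closed p qE (finset.sub0set E) dq.
rewrite cards0 expr0 mulr1 card_path_edges // sq => <-; rewrite subgraph_probE.
apply: le_subgraph_mean => // H HE; rewrite ler_nat.
suff -> : [disjoint (finset.set0 : {set {set T}}) & H] by rewrite andbT.
by rewrite -setI_eq0 finset.set0I.
Qed.

(** Take [D = d - k]. Then [(1 - k / d)^(k - 1) >= 1/2] by Bernoulli's inequality and [2 k^2 <= d],
    while [(1 - p)^(d k)] and Stirling's lower bound lose a factor [exp(-1)] each; hence the 2 in
    the denominator and the 2 in the exponent. *)
Lemma mean_isolated_trees_expR k : (0 < k)%N -> (2 * k ^ 2 <= d)%N ->
  2 * alpha ^+ 2 * k%:R <= d%:R -> 2 * alpha <= d%:R ->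
  N%:R / (2 * alpha) * expR (- ((alpha - 1 - ln alpha) * k%:R) - 5 / 2 * ln k%:R - 2) <=
    mean_isolated_trees k.
Proof.
clear delta0 mix; move=> k0 kd ad a2d; have kR : 0 < k%:R :> R by rewrite ltr0n.
have kled : (k <= d)%N by rewrite (leq_trans _ kd) // -mulnn; nia.
have := @mean_isolated_trees_ge (d - k) k k0; rewrite subnKC // => /(_ (leqnn _)) low.
rewrite -(ler_pM2l kR); apply: le_trans low.
have p12 : p <= 2^-1 by rewrite ler_pdivrMr // mulrC ler_pdivlMr // mulrC.
have -> : N%:R * (d - k)%:R ^+ k.-1 * rho R k * (p ^+ k.-1 * (1 - p) ^+ (d * k)) =
    N%:R * (((d - k)%:R * p) ^+ k.-1 * (rho R k * (1 - p) ^+ (d * k))).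
  by rewrite [((d - k)%:R * _) ^+ _]exprMn; ring.
have b1 : expR (k%:R * ln alpha) / (2 * alpha) <= ((d - k)%:R * p) ^+ k.-1.
  have -> : (d - k)%:R * p = alpha * (1 - k%:R / d%:R).
    by rewrite natrB //; field; rewrite gt_eqF.
  have kd1 : k%:R / d%:R <= 1 :> R by rewrite ler_pdivrMr // mul1r ler_nat.
  have -> : expR (k%:R * ln alpha) / (2 * alpha) = alpha ^+ k.-1 * 2^-1.
    rewrite expRM_natl lnK ?posrE // -[in LHS](prednK k0) exprS.
    by field; rewrite gt_eqF.
  rewrite exprMn ler_wpM2l ?exprn_ge0 ?(ltW alpha0) //.
  apply: le_trans (bernoulli_le k.-1 _ kd1); last by rewrite divr_ge0.
  have : k.-1%:R * (k%:R / d%:R) <= 2^-1 :> R.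
    have : 2 * (k.-1%:R * k%:R) <= d%:R :> R.
      rewrite -!natrM ler_nat; apply: leq_trans kd.
      by rewrite leq_mul2l /= -mulnn leq_mul2r leq_pred orbT.
    by move=> kk; rewrite mulrA ler_pdivrMr //; move: (k.-1%:R * k%:R) kk => y; lra.
  lra.
have b2 : expR (- (alpha * k%:R) - 1) <= (1 - p) ^+ (d * k).
  apply: (@le_trans _ _ (expR ((d * k)%:R * - (p + 2 * p ^+ 2)))).
    rewrite ler_expR natrM.
    have -> : d%:R * k%:R * - (p + 2 * p ^+ 2) = - (alpha * k%:R) - 2 * alpha ^+ 2 * k%:R / d%:R.
      by field; rewrite gt_eqF.
    by rewrite lerD2l lerN2 ler_pdivrMr // mul1r.
  rewrite expRM_natl; apply: lerXn2r; rewrite ?nnegrE ?expR_ge0 ?subr_ge0 //.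
  exact: expRN_le_1B.
have /andP[b3 _] := rho_bounds R k0.
apply: (@le_trans _ _ (N%:R * (expR (k%:R * ln alpha) / (2 * alpha) *
    (expR (k%:R - 3 / 2 * ln k%:R - 1) * expR (- (alpha * k%:R) - 1))))); last first.
  rewrite ler_wpM2l //; apply: ler_pM => //.
  - by rewrite divr_ge0 ?expR_ge0 // mulr_ge0 // ltW.
  - by apply: ler_pM; rewrite ?expR_ge0.
set Z := expR (- _ - _ - 2).
have -> : k%:R * (N%:R / (2 * alpha) * Z) = N%:R / (2 * alpha) * (k%:R * Z) by ring.
set A1 := expR (k%:R * _); set A2 := expR (k%:R - _ - _); set A3 := expR (_ - 1).
have -> : N%:R * (A1 / (2 * alpha) * (A2 * A3)) = N%:R / (2 * alpha) * (A1 * (A2 * A3)) by ring.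
rewrite ler_wpM2l ?divr_ge0 // ?mulr_ge0 // ?(ltW alpha0) //.
rewrite -[X in X * Z](@lnK R k%:R) ?posrE // -!expRD ler_expR; lra.
Qed.

End ComponentBounds.

(** * Asymptotics *)

Section Sums.
Local Open Scope ring_scope.
Variable R : realType.

Lemma geometric_tail (c : R) (a m : nat) : 0 < c ->
  \sum_(k < m | (a <= k)%N) expR (- (c * k%:R)) <=
    expR (- (c * a%:R)) / (1 - expR (- c)).
Proof.
move=> c0; have e1 : expR (- c) < 1 by rewrite expR_lt1 oppr_lt0.
rewrite ler_pdivlMr ?subr_gt0 //.
elim: m => [|m IH]; first by rewrite big_ord0 mul0r expR_ge0.
(* Multiplied by [1 - expR (- c)] the sum telescopes; keeping the end term makes the induction go
   through. *)
suff H : \sum_(k < m.+1 | (a <= k)%N) expR (- (c * k%:R)) * (1 - expR (- c)) <=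
    if (a <= m)%N then expR (- (c * a%:R)) - expR (- (c * m.+1%:R)) else 0.
  rewrite mulr_suml; apply: le_trans H _; case: ifP => _; last exact: expR_ge0.
  by rewrite lerBlDr lerDl expR_ge0.
elim: m {IH} => [|m IH]; rewrite big_mkcond big_ord_recr /= -big_mkcond /=.
  rewrite big_mkcond big_ord0 add0r; case: (posnP a) => [->|a0].
    by rewrite mulr0 oppr0 expR0 mul1r mulr1.
  by rewrite leqn0 eqn0Ngt a0.
apply: le_trans (lerD IH (lexx _)) _.
have step : expR (- (c * m.+1%:R)) * expR (- c) = expR (- (c * m.+2%:R)).
  by rewrite -expRD -[m.+2%:R]natr1; congr expR; ring.
rewrite mulrBr mulr1 step; case: (leqP a m) => [am|ma].
  by rewrite (leqW am); lra.
case: (eqVneq a m.+1) => [->|am]; first by rewrite leqnn add0r.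
by rewrite leq_eqVlt (negPf am) /= ltnS leqNgt ma addr0.
Qed.

(** Half of the exponent absorbs the power of [k], through [(c2 k)^(j+1) / (j+1)! <= exp(c2 k)]; the
    other half is summed. [K] is uniform in [a] and [m], so it may be fixed before [n]. *)
Lemma poly_geometric_sum (c : R) (j : nat) : 0 < c ->
  exists2 K : R, 0 < K & forall (a m : nat),
    \sum_(k < m | (a <= k)%N && (0 < k)%N) k%:R ^+ j * expR (- (c * k%:R)) <= K.
Proof.
move=> c0; pose c2 := c / 2; have c20 : 0 < c2 by rewrite divr_gt0.
pose M : R := j.+1`!%:R / c2 ^+ j.+1.
have M0 : 0 < M by rewrite divr_gt0 ?ltr0n ?fact_gt0 ?exprn_gt0.
have e1 : expR (- c2) < 1 by rewrite expR_lt1 oppr_lt0.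
exists (M / (1 - expR (- c2))) => [|a m]; first by rewrite divr_gt0 // subr_gt0.
apply: (@le_trans _ _ (\sum_(k < m | (0 <= k)%N) M * expR (- (c2 * k%:R)))); last first.
  rewrite -mulr_sumr ler_wpM2l ?(ltW M0) //.
  by have := geometric_tail 0 m c20; rewrite mulr0 oppr0 expR0 mul1r.
rewrite big_mkcond /=; apply: ler_sum => k _; case: ifP => [/andP[_ k0]|_]; last first.
  by rewrite mulr_ge0 ?expR_ge0 ?(ltW M0).
have -> : - (c * k%:R) = - (c2 * k%:R) - c2 * k%:R by rewrite /c2; field.
rewrite expRD mulrCA [leRHS]mulrC ler_wpM2l ?expR_ge0 // expRN ler_pdivrMr ?expR_gt0 //.
have k1 : 1 <= k%:R :> R by rewrite ler1n.
apply: (@le_trans _ _ (k%:R ^+ j.+1)).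
  by rewrite exprS ler_peMl // exprn_ge0.
have := @expR_ge1Dxn R (c2 * k%:R) j (mulr_ge0 (ltW c20) (ler0n _ _)).
set X := expR _ => h; have {h} : (c2 * k%:R) ^+ j.+1 / j.+1`!%:R <= X by lra.
rewrite ler_pdivrMr ?ltr0n ?fact_gt0 // exprMn => h.
by rewrite /M mulrAC ler_pdivlMr ?exprn_gt0 // mulrC [leRHS]mulrC.
Qed.

Lemma sqr_half_le_expR (y : R) : 0 <= y -> y ^+ 2 / 2 <= expR y.
Proof.
move=> y0; have := @expR_ge1Dxn R y 1 y0; rewrite (_ : 2`! = 2)%N //.
by apply: le_trans; rewrite lerDr.
Qed.

Lemma eta_gt0 (alpha : R) : 0 < alpha -> alpha != 1 -> 0 < alpha - 1 - ln alpha.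
Proof.
move=> a0 a1; have l0 : ln alpha != 0 by rewrite ln_eq0.
by have := expR_gt1Dx l0; rewrite lnK ?posrE // => h; lra.
Qed.

End Sums.

(** * Eventual inequalities along the index set *)

Section Limits.
Local Open Scope classical_set_scope.
Local Open Scope ring_scope.
Variables (R : realType) (S : set nat).

Lemma near_le_littleo (f g : nat -> R) (e : R) : 0 < e ->
  (fun n => f n : R^o) =o_ (along S) (fun n => g n : R^o) ->
  \forall n \near along S, `|f n| <= e * `|g n|.
Proof. by move=> e0 /eqoP/(_ _ e0). Qed.

Lemma near_Omega (f g : nat -> R) :
  (fun n => f n : R^o) =Omega_ (along S) (fun n => g n : R^o) ->
  exists2 c : R, 0 < c & \forall n \near along S, c * `|g n| <= `|f n|.
Proof.
rewrite eqOmegaE qualifE => /asboolP[c c0 h].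
by exists c.
Qed.

Lemma near_pinfty (f : nat -> R) (M : R) : f n @[n --> along S] --> +oo ->
  \forall n \near along S, M <= f n.
Proof. by move=> /cvgryPge/(_ M). Qed.

Lemma near_nat (M : R) : \forall n \near along S, M <= n%:R.
Proof.
rewrite /along near_withinE; near=> n => _.
near: n; exact: nbhs_infty_ger.
Unshelve. all: by end_near. Qed.

Lemma near_ln (M : R) : \forall n \near along S, M <= ln n%:R.
Proof.
near=> n; rewrite -[M]expRK ler_ln ?posrE ?expR_gt0 //.
  near: n; exact: near_nat.
near: n; apply: filterS (near_nat 1) => n; exact: lt_le_trans.
Unshelve. all: by end_near. Qed.

Lemma near_lnln (M : R) : \forall n \near along S, M <= ln (ln n%:R).
Proof.
near=> n; rewrite -[M]expRK ler_ln ?posrE ?expR_gt0 //.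
  near: n; exact: near_ln.
near: n; apply: filterS (near_ln 1) => n; exact: lt_le_trans.
Unshelve. all: by end_near. Qed.

Lemma near_mem : \forall n \near along S, S n.
Proof. by rewrite /along near_withinE; near=> n. Unshelve. all: by end_near. Qed.

Lemma near_much_larger (f g : nat -> R) (M : R) : 0 < M ->
  much_larger R S f g -> (\forall n \near along S, 0 < g n) ->
  \forall n \near along S, M * g n <= f n.
Proof.
move=> M0 fg g0; near=> n.
have gn : 0 < g n by near: n.
rewrite -ler_pdivlMr //; near: n; exact: near_pinfty fg.
Unshelve. all: by end_near. Qed.

Lemma whp_intro (G : forall n, {set {set 'I_n}}) (p : nat -> R)
    (A : forall n, pred {set {set 'I_n}}) :
  (\forall n \near along S, 0 <= p n <= 1) ->
  (forall e : R, 0 < e -> \forall n \near along S,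
     subgraph_prob (G n) (p n) (fun H => ~~ A n H) <= e) ->
  whp S G p A.
Proof.
move=> p01 small; apply/cvgrPdist_le => e e0; near=> n.
have /andP[p0 p1] : 0 <= p n <= 1 by near: n.
rewrite (subgraph_probC (G n) (p n) (A n)) opprB addrC subrK ger0_norm ?subgraph_prob_ge0 //.
near: n; exact: small.
Unshelve. all: by end_near. Qed.

End Limits.

(** * The five statements for large [n] *)

Section Asymptotic.
Local Open Scope classical_set_scope.
Local Open Scope ring_scope.
Variables (R : realType) (alpha : R) (S : set nat).
Variables (G : forall n : nat, {set {set 'I_n}}) (d : nat -> nat) (omega : nat -> R).
Hypotheses (alpha0 : 0 < alpha) (alpha1 : alpha != 1).
Hypothesis Spos : forall n, S n -> (0 < n)%N.
Hypothesis GS : forall n, S n -> simple_graph (G n) /\ regular (d n) (G n).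
Hypothesis dinf : (d n)%:R @[n --> along S] --> (+oo : set_system R).
Hypothesis lamd : (fun n => second_eigenvalue R (G n) : R^o)
    =o_ (along S) (fun n => (d n)%:R : R^o).
Hypothesis omegainf : omega n @[n --> along S] --> +oo.
Local Notation p n := (alpha / (d n)%:R).
Local Notation eta := (alpha - 1 - ln alpha).
Let eta0 : 0 < eta. Proof. exact: eta_gt0. Qed.
Variable eps : R.
(* With this [eps], the exponent [eta - 2 alpha eps] of [mid_components] is [eta / 2]. *)
Hypotheses (eps0 : 0 < eps) (alpha_eps : alpha * eps = eta / 4).
Let delta n : R := second_eigenvalue R (G n) / (d n)%:R.

(** The hypotheses of the bounds for a fixed graph, with [p] and [lambda / d] both below [e]. *)
Let regime n (e : R) : Prop :=
  [/\ S n, (0 < n)%N, simple_graph (G n) & regular (d n) (G n)] /\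
  [/\ (0 < d n)%N, alpha <= (d n)%:R, p n <= e & 0 <= delta n <= e] /\
  forall C : {set 'I_n}, (2 * #|edges_in (G n) C|)%:R <=
    (d n)%:R * #|C|%:R * (#|C|%:R / #|'I_n|%:R + delta n) :> R.

Lemma near_regime e : 0 < e -> \forall n \near along S, regime n e.
Proof.
move=> e0; near=> n.
have Sn : S n by near: n; exact: near_mem.
have [sG rG] := GS Sn.
have d1 : 1 <= (d n)%:R :> R by near: n; exact: near_pinfty dinf.
have dR : 0 < (d n)%:R :> R by rewrite (lt_le_trans _ d1).
(* The constant 1/2 is only there to give [lambda < d], which the mixing lemma asks for. *)
have l2 : `|second_eigenvalue R (G n)| <= 2^-1 * `|(d n)%:R|.
  by near: n; apply: near_le_littleo lamd; rewrite invr_gt0.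
have le : `|second_eigenvalue R (G n)| <= e * `|(d n)%:R|.
  by near: n; apply: near_le_littleo lamd.
have lam0 := second_eigenvalue_ge0 R (G n).
rewrite !ger0_norm // in l2 le.
split; first by split=> //; apply: Spos.
split.
  split; first by rewrite -(ltr0n R).
  - by near: n; exact: near_pinfty dinf.
  - rewrite ler_pdivrMr // -ler_pdivrMl //; near: n; exact: near_pinfty dinf.
  - by rewrite /delta divr_ge0 //= ler_pdivrMr.
move=> C; apply: le_trans (expander_mixing C sG rG _) _; first by lra.
rewrite card_ord /delta le_eqVlt; apply/orP; left; apply/eqP.
move: (second_eigenvalue _ _) => l; move: (n%:R^-1) => z.
by field; rewrite gt_eqF.
Unshelve. all: by end_near. Qed.

Lemma near_p01 : \forall n \near along S, 0 <= p n <= 1.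
Proof.
apply: filterS (near_regime ltr01) => n [_ [[d0 ad _ _] _]].
by rewrite divr_ge0 ?(ltW alpha0) //= ler_pdivrMr ?ltr0n // mul1r.
Qed.

Lemma near_large e : 0 < e -> \forall n \near along S,
  subgraph_prob (G n) (p n) (fun H => [exists C : {set 'I_n}, [&& C \in components H,
      eps * n%:R <= #|C|%:R & (#|edges_in H C| <= #|C|)%N]]) <= e.
Proof.
move=> e0; pose c := eps * eta / 4; pose K := expR 1 / (alpha * eps).
have c0 : 0 < c by rewrite divr_gt0 // mulr_gt0.
have K0 : 0 < K by rewrite divr_gt0 ?expR_gt0 // mulr_gt0.
(* Any multiple making [e' (2 + alpha / 2)] at most [c] would do. *)
pose e' := c / (3 + alpha).
have e'0 : 0 < e' by rewrite divr_gt0 // addr_gt0.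
near=> n.
have [[Sn n0 sG rG] [[d0 ad pe /andP[de0 de]] mix]] : regime n e' by near: n; exact: near_regime.
have small : delta n * (1 + alpha / 2) + p n <= c.
  apply: (@le_trans _ _ (e' * (1 + alpha / 2) + e')).
    by rewrite lerD // ler_wpM2r // addr_ge0 // divr_ge0 // ltW.
  have -> : c = e' * (3 + alpha) by rewrite /e'; field; rewrite gt_eqF // addr_gt0.
  have -> : e' * (1 + alpha / 2) + e' = e' * (2 + alpha / 2) by ring.
  by rewrite ler_pM2l //; move: alpha0; lra.
have aeta : alpha * eps <= eta by rewrite alpha_eps; move: eta0; lra.
have := large_components sG rG alpha0 d0 ad de0 mix eps0 aeta small.
rewrite card_ord => /le_trans; apply.
rewrite -/c -/K expRN ler_pdivrMr ?expR_gt0 //.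
have nR : 1 <= n%:R :> R by rewrite ler1n.
have nc0 : 0 <= n%:R * c by rewrite mulr_ge0 ?(ltW c0).
(* The prefactor is cubic in [n], so the fourth-order term of the exponential beats it. *)
have := @expR_ge1Dxn R (n%:R * c) 3 nc0; set X := expR _ => hX.
have X4 : (n%:R * c) ^+ 4 / 24%:R <= X.
  by apply: le_trans hX; rewrite lerDr.
have -> : n.+1%:R * (n ^ 2).+1%:R * K = (n%:R + 1) * (n%:R ^+ 2 + 1) * K :> R.
  by rewrite -!natr1 natrX.
apply: (@le_trans _ _ (4 * n%:R ^+ 3 * K)).
  rewrite ler_wpM2r ?(ltW K0) //; nra.
apply: (@le_trans _ _ (e * ((n%:R * c) ^+ 4 / 24%:R))); last by rewrite ler_pM2l.
have nbig : 96 * K / (e * c ^+ 4) <= n%:R by near: n; exact: near_nat.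
rewrite ler_pdivrMr ?mulr_gt0 ?exprn_gt0 // in nbig.
have n3 : 0 <= n%:R ^+ 3 :> R by rewrite exprn_ge0.
have -> : e * ((n%:R * c) ^+ 4 / 24%:R) = n%:R ^+ 3 * (n%:R * (e * c ^+ 4)) / 24%:R by field.
rewrite ler_pdivlMr //.
have -> : 4 * n%:R ^+ 3 * K * 24%:R = n%:R ^+ 3 * (96 * K) by ring.
by rewrite ler_wpM2l.
Unshelve. all: by end_near. Qed.

Let mid (n j a : nat) (H : {set {set 'I_n}}) : R :=
  \sum_(C in components H | [&& (a <= #|C|)%N, #|C|%:R <= eps * n%:R &
      (#|C| + j <= #|edges_in H C|.+1)%N]) #|C|%:R.
Arguments mid : clear implicits.

Lemma near_mid (j : nat) (a : nat -> nat) : \forall n \near along S,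
  subgraph_mean (G n) (p n) (mid n j (a n)) <= n%:R / alpha * p n ^+ j *
    \sum_(k < n.+1 | (a n <= k)%N && (0 < k)%N) k%:R ^+ (2 * j) * expR (- (eta / 2 * k%:R)).
Proof.
near=> n.
have [[Sn n0 sG rG] [[d0 ad pe /andP[de0 de]] mix]] : regime n eps by near: n; exact: near_regime.
have := mid_components sG rG alpha0 d0 ad mix j (a n) de; rewrite card_ord.
by have -> : eta - 2 * alpha * eps = eta / 2 by rewrite -mulrA alpha_eps; field.
Unshelve. all: by end_near. Qed.

Lemma near_excess_small e : 0 < e ->
  much_larger R S (fun n => (d n)%:R) (fun n => Num.sqrt n%:R) ->
  \forall n \near along S, subgraph_prob (G n) (p n) (fun H =>
    [exists C : {set 'I_n}, excess_component H C && (#|C|%:R <= eps * n%:R)]) <= e.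
Proof.
move=> e0 dn; have eta20 : 0 < eta / 2 by rewrite divr_gt0.
have [K K0 Kbound] := poly_geometric_sum 4 eta20.
(* The bound will be [alpha K n / d^2]; with this [M], it is at most [e] as soon as
   [d >= M sqrt n]. *)
pose M : R := Num.sqrt (alpha * K / e) + 1.
have M0 : 0 < M by rewrite ltr_wpDl ?sqrtr_ge0.
have M2 : alpha * K / e <= M ^+ 2.
  have h : 0 <= alpha * K / e by rewrite divr_ge0 ?mulr_ge0 ?ltW.
  rewrite -[leLHS]sqr_sqrtr // /M; have := sqrtr_ge0 (alpha * K / e); nra.
have sqrtpos : \forall n \near along S, 0 < Num.sqrt n%:R :> R.
  apply: filterS (near_nat S 1) => n n1; rewrite sqrtr_gt0; exact: lt_le_trans n1.
near=> n.
have [[Sn n0 sG rG] [[d0 ad pe /andP[de0 de]] mix]] : regime n 1 by near: n; exact: near_regime.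
have /andP[p0 p1] : 0 <= p n <= 1 by near: n; exact: near_p01.
have nR : 0 < n%:R :> R by rewrite ltr0n.
have dR : 0 < (d n)%:R :> R by rewrite ltr0n.
apply: (@le_trans _ _ (subgraph_mean (G n) (p n) (mid n 2 0))).
  apply: prob_le_subgraph_mean => // H HE; first by apply: sumr_ge0.
  move=> /existsP[C /andP[/andP[cC ex] Ce]].
  rewrite /mid (bigD1 C) /=; last by rewrite cC Ce /= addn2 ltnS.
  apply: (@le_trans _ _ (#|C|%:R)); first by rewrite ler1n (component_card_gt0 cC).
  by rewrite lerDl sumr_ge0.
have mid2 : subgraph_mean (G n) (p n) (mid n 2 0) <= n%:R / alpha * p n ^+ 2 *
    \sum_(k < n.+1 | (0 <= k)%N && (0 < k)%N) k%:R ^+ (2 * 2) * expR (- (eta / 2 * k%:R)).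
  by near: n; exact: (near_mid 2 (fun=> 0%N)).
apply: le_trans mid2 _; apply: (@le_trans _ _ (n%:R / alpha * p n ^+ 2 * K)).
  by rewrite ler_wpM2l ?Kbound // !mulr_ge0 ?invr_ge0 ?exprn_ge0 ?(ltW alpha0).
have dM : M * Num.sqrt n%:R <= (d n)%:R.
  by near: n; apply: near_much_larger M0 dn sqrtpos.
have d2 : M ^+ 2 * n%:R <= (d n)%:R ^+ 2.
  rewrite -[X in _ * X](sqr_sqrtr (ltW nR)) -exprMn.
  by apply: lerXn2r; rewrite ?nnegrE ?mulr_ge0 ?sqrtr_ge0 ?(ltW M0).
have -> : n%:R / alpha * p n ^+ 2 * K = (alpha * K / e * n%:R) * e / (d n)%:R ^+ 2.
  by field; rewrite ?gt_eqF.
rewrite ler_pdivrMr ?exprn_gt0 // mulrC ler_pM2l // (le_trans _ d2) //.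
by rewrite ler_wpM2r.
Unshelve. all: by end_near. Qed.

(** Above [eps * n], counting paths bounds the probability of any component at all by [O(1 / n)]. *)
Lemma excess_subcritical :
  much_larger R S (fun n => (d n)%:R) (fun n => Num.sqrt n%:R) -> alpha < 1 ->
  whp S G (fun n => p n) (fun n H => ~~ [exists C, excess_component H C]).
Proof.
move=> dn a1; apply: whp_intro; first exact: near_p01.
move=> e e0; have e20 : 0 < e / 2 by rewrite divr_gt0.
near=> n.
have [[Sn n0 sG rG] [[d0 ad pe /andP[de0 de]] mix]] : regime n 1 by near: n; exact: near_regime.
have /andP[p0 p1] : 0 <= p n <= 1 by near: n; exact: near_p01.
have nR : 0 < n%:R :> R by rewrite ltr0n.
have en : 0 < eps * n%:R by rewrite mulr_gt0.
apply: (@le_trans _ _ (subgraph_prob (G n) (p n) (fun H =>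
      [exists C : {set 'I_n}, excess_component H C && (#|C|%:R <= eps * n%:R)]) +
    subgraph_prob (G n) (p n) (fun H =>
      [exists C : {set 'I_n}, (C \in components H) && (eps * n%:R <= #|C|%:R)]))).
  apply: prob_union => // H HE; rewrite negbK => /existsP[C eC].
  have [le|/ltW le] := lerP (#|C|%:R) (eps * n%:R); [left|right]; apply/existsP; exists C.
    by rewrite eC.
  by move: eC; rewrite le andbT => /andP[].
rewrite [e]splitr lerD //.
  by near: n; exact: near_excess_small.
have := subcritical_components rG alpha0 d0 ad a1 en; rewrite card_ord => /le_trans; apply.
have a10 : 0 < 1 - alpha by rewrite subr_gt0.
have nbig : (1 - alpha)^-1 / eps ^+ 2 / (e / 2) <= n%:R by near: n; exact: near_nat.
rewrite ler_pdivrMr // in nbig.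
have -> : n%:R / (1 - alpha) / (eps * n%:R) ^+ 2 = ((1 - alpha)^-1 / eps ^+ 2) / n%:R.
  by field; rewrite !gt_eqF.
by rewrite ler_pdivrMr // [leRHS]mulrC.
Unshelve. all: by end_near. Qed.

(** A function [s = o(n)] is eventually below [eps * n], where [near_excess_small] applies. *)
Lemma excess_supercritical (s : nat -> R) :
  much_larger R S (fun n => (d n)%:R) (fun n => Num.sqrt n%:R) ->
  (fun n => s n : R^o) =o_ (along S) (fun n => n%:R : R^o) ->
  whp S G (fun n => p n) (fun n H => ~~ [exists C : {set 'I_n},
    excess_component H C && (#|C|%:R <= s n)]).
Proof.
move=> dn sn; apply: whp_intro; first exact: near_p01.
move=> e e0; near=> n.
have /andP[p0 p1] : 0 <= p n <= 1 by near: n; exact: near_p01.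
have se : `|s n| <= eps * `|n%:R|.
  by near: n; apply: near_le_littleo sn.
apply: (@le_trans _ _ (subgraph_prob (G n) (p n) (fun H =>
    [exists C : {set 'I_n}, excess_component H C && (#|C|%:R <= eps * n%:R)]))).
  apply: prob_le => // H HE; rewrite negbK => /existsP[C /andP[eC Cs]].
  apply/existsP; exists C; rewrite eC /= (le_trans Cs) // (le_trans (ler_norm _)) //.
  by rewrite (le_trans se) // ger0_norm.
by near: n; exact: near_excess_small.
Unshelve. all: by end_near. Qed.

(** Outside the event of [near_large], the weights [#|C|] in [mid] make it an upper bound for the
    number of vertices on unicyclic components. Its mean is [O(n / d) = O(1)], so Markov's
    inequality against [omega] suffices. *)
Lemma unicyclic_vertices_bound :
  (fun n => (d n)%:R : R^o) =Omega_ (along S) (fun n => n%:R : R^o) ->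
  whp S G (fun n => p n) (fun n H => #|unicyclic_vertices H|%:R <= omega n).
Proof.
move=> /near_Omega[c c0 dn]; apply: whp_intro; first exact: near_p01.
have eta20 : 0 < eta / 2 by rewrite divr_gt0.
have [K K0 Kbound] := poly_geometric_sum 2 eta20.
move=> e e0; have e20 : 0 < e / 2 by rewrite divr_gt0.
near=> n.
have [[Sn n0 sG rG] [[d0 ad pe /andP[de0 de]] mix]] : regime n 1 by near: n; exact: near_regime.
have /andP[p0 p1] : 0 <= p n <= 1 by near: n; exact: near_p01.
have nR : 0 < n%:R :> R by rewrite ltr0n.
have dR : 0 < (d n)%:R :> R by rewrite ltr0n.
have om1 : 1 <= omega n by near: n; exact: near_pinfty omegainf.
have om0 : 0 < omega n by rewrite (lt_le_trans _ om1).
apply: (@le_trans _ _ (subgraph_prob (G n) (p n) (fun H =>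
      [exists C : {set 'I_n}, [&& C \in components H,
        eps * n%:R <= #|C|%:R & (#|edges_in H C| <= #|C|)%N]]) +
    subgraph_prob (G n) (p n) (fun H => omega n < mid n 1 0 H))).
  apply: prob_union => // H HE; rewrite -ltNge => om.
  have sH := simple_sub HE sG.
  case: (boolP [exists C, _]) => [|nL]; [by left|right].
  apply: lt_le_trans om _.
  apply: (@le_trans _ _ (\sum_(C : {set 'I_n} | unicyclic_component H C) #|C|%:R)).
    rewrite -natr_sum ler_nat /unicyclic_vertices.
    elim/big_rec2: _ => [|C m U _ IH]; first by rewrite cards0.
    by apply: leq_trans (leq_card_setU _ _).1 _; rewrite leq_add2l.
  rewrite /mid big_mkcond [leRHS]big_mkcond /=; apply: ler_sum => C _.
  case: ifP => [uC|_]; last by case: ifP.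
  have eC := unicyclic_edges sH uC; have /andP[cC _] := uC.
  rewrite cC /= eC addn1 leqnn andbT.
  case: (lerP #|C|%:R (eps * n%:R)) => // lt; case/negP: nL; apply/existsP; exists C.
  by rewrite cC eC leqnn (ltW lt).
rewrite [e]splitr lerD //.
  by near: n; exact: near_large.
apply: (@le_trans _ _ (subgraph_mean (G n) (p n) (fun H => (omega n)^-1 * mid n 1 0 H))).
  apply: prob_le_subgraph_mean => // H HE; first by rewrite mulr_ge0 ?invr_ge0 ?(ltW om0)
      // sumr_ge0.
  by move=> /ltW le; rewrite ler_pdivlMl // mulr1.
rewrite subgraph_meanZ ler_pdivrMl //.
have mid1 : subgraph_mean (G n) (p n) (mid n 1 0) <= n%:R / alpha * p n ^+ 1 *
    \sum_(k < n.+1 | (0 <= k)%N && (0 < k)%N) k%:R ^+ (2 * 1) * expR (- (eta / 2 * k%:R)).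
  by near: n; exact: (near_mid 1 (fun=> 0%N)).
apply: le_trans mid1 _; apply: (@le_trans _ _ (n%:R / alpha * p n ^+ 1 * K)).
  by rewrite ler_wpM2l ?Kbound // !mulr_ge0 ?invr_ge0 ?exprn_ge0 ?(ltW alpha0).
have cn : c * `|n%:R| <= `|(d n)%:R| by near: n; exact: dn.
rewrite !ger0_norm // in cn.
have ombig : K / c / (e / 2) <= omega n by near: n; exact: near_pinfty omegainf.
rewrite ler_pdivrMr // in ombig; apply: le_trans ombig.
have -> : n%:R / alpha * p n ^+ 1 * K = K * (n%:R / (d n)%:R) by field; rewrite !gt_eqF.
by rewrite ler_pM2l // ler_pdivrMr // -ler_pdivrMl ?invr_gt0 // invrK.
Unshelve. all: by end_near. Qed.

(** Makes the correction [5/2 ln ln n] at most half of [ln n], so that the threshold stays of order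
    [ln n]. It is [y^2 / 2 <= exp y] at [y = ln ln n >= 10]. *)
Lemma near_five_lnln : \forall n \near along S, 5 * ln (ln n%:R) <= ln n%:R :> R.
Proof.
near=> n; have L1 : 1 <= ln n%:R :> R by near: n; exact: near_ln.
have LL : 10 <= ln (ln n%:R) :> R by near: n; exact: near_lnln.
have L0 : 0 < ln n%:R :> R by rewrite (lt_le_trans _ L1).
have := sqr_half_le_expR (le_trans (ler0n _ 10) LL); rewrite lnK ?posrE //.
apply: le_trans; rewrite expr2 -mulrA [leRHS]mulrC -mulrA.
by rewrite [leLHS]mulrC ler_wpM2l ?(le_trans _ LL) // ler_pdivlMl //; lra.
Unshelve. all: by end_near. Qed.

Local Notation size n := (zeta alpha * (ln n%:R - 5 / 2 * ln (ln n%:R))).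

Lemma near_size : \forall n \near along S, (2 * eta)^-1 * ln n%:R <= size n.
Proof.
apply: filterS near_five_lnln => n h; rewrite /zeta invfM [2^-1 * _]mulrC -[leLHS]mulrA.
by rewrite ler_wpM2l ?invr_ge0 ?(ltW eta0) //; lra.
Qed.

Lemma isolated_trees_upper :
  much_larger R S (fun n => (d n)%:R) (fun n => ln n%:R ^+ 2) ->
  whp S G (fun n => p n) (fun n H => ~~ [exists C : {set 'I_n},
    isolated_tree H C && (size n + omega n <= #|C|%:R)]).
Proof.
move=> dn; apply: whp_intro; first exact: near_p01.
move=> e e0; pose e4 := e / 4; have e40 : 0 < e4 by rewrite divr_gt0.
have eta20 : 0 < eta / 2 by rewrite divr_gt0.
have q1 : 0 < 1 - expR (- eta) by rewrite subr_gt0 expR_lt1 oppr_lt0.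
have q2 : 0 < 1 - expR (- (eta / 2)) by rewrite subr_gt0 expR_lt1 oppr_lt0.
(* [A] makes [exp(- eta / 2 * A ln n)] equal to [n^(-2)]. *)
pose A := 4 / eta; have A0 : 0 < A by rewrite divr_gt0.
(* [b n] is at most [2 A ln n], so [M (ln n)^2 <= d] gives the hypothesis of
   [small_isolated_trees]. *)
pose M := alpha * (2 * A) ^+ 2; have M0 : 0 < M by rewrite mulr_gt0 // exprn_gt0 // mulr_gt0.
pose K1 := expR 1 / alpha * expR (eta - 5 / 2 * ln (2 * eta)^-1) / (1 - expR (- eta)).
have K10 : 0 < K1 by rewrite divr_gt0 // mulr_gt0 ?expR_gt0 // divr_gt0 ?expR_gt0.
pose K2 := alpha^-1 / (1 - expR (- (eta / 2))).
have K20 : 0 < K2 by rewrite divr_gt0 // invr_gt0.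
have ln2pos : \forall n \near along S, 0 < ln n%:R ^+ 2 :> R.
  by apply: filterS (near_ln S 1) => n n1; rewrite exprn_gt0 // (lt_le_trans _ n1).
pose b n := (Num.truncn (A * ln n%:R : R)).+1.
near=> n.
have [[Sn n0 sG rG] [[d0 ad pe /andP[de0 de]] mix]] : regime n 1 by near: n; exact: near_regime.
have /andP[p0 p1] : 0 <= p n <= 1 by near: n; exact: near_p01.
have nR : 0 < n%:R :> R by rewrite ltr0n.
have L1 : 1 <= ln n%:R :> R by near: n; exact: near_ln.
have AL1 : A^-1 <= ln n%:R :> R by near: n; exact: near_ln.
have LL0 : 0 <= ln (ln n%:R) :> R by near: n; exact: near_lnln.
have om1 : 1 <= omega n by near: n; exact: near_pinfty omegainf.
have sz : (2 * eta)^-1 * ln n%:R <= size n by near: n; exact: near_size.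
have dM : M * ln n%:R ^+ 2 <= (d n)%:R by near: n; apply: near_much_larger M0 dn ln2pos.
have sz2 : 2 * eta <= ln n%:R by near: n; exact: near_ln.
set L := ln n%:R in L1 AL1 LL0 sz dM sz2 *; set x := size n + omega n.
have L0 : 0 < L by rewrite (lt_le_trans _ L1).
have hL : 0 < (2 * eta)^-1 * L by rewrite mulr_gt0 // invr_gt0 mulr_gt0.
have x1 : (2 * eta)^-1 * L + 1 <= x by rewrite lerD.
have x0 : 0 <= x by rewrite (le_trans _ x1) // addr_ge0 // ltW.
(* Rounding down keeps every size from [x] on; as [a > x - 1], it costs a factor [expR eta], part of
   [K1]. *)
pose a := Num.truncn x.
have [ax xa] : a%:R <= x /\ x < a.+1%:R by apply/andP; rewrite truncn_itv.
have [bx xb] : (b n)%:R <= 2 * A * L /\ A * L < (b n)%:R.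
  have AL0 : 0 <= A * L by rewrite mulr_ge0 // ltW.
  have /andP[t1 t2] := truncn_itv AL0; split; last exact: t2.
  rewrite /b -natr1 -/L; have : 1 <= A * L by rewrite -ler_pdivrMl // mulr1.
  by move: t1; rewrite -mulrA; move: (A * L) => y; lra.
have a1 : (2 * eta)^-1 * L <= a%:R by move: xa; rewrite -natr1; lra.
have a0 : (0 < a)%N by rewrite -(ltr0n R) (lt_le_trans hL).
have bd : alpha * (b n ^ 2)%:R <= (d n)%:R.
  apply: le_trans dM; rewrite /M -mulrA ler_pM2l // -exprMn natrX.
  by apply: lerXn2r; rewrite ?nnegrE // mulr_ge0 ?(ltW L0) // mulr_ge0 // ltW.
have first : subgraph_prob (G n) (p n) (fun H => [exists C : {set 'I_n},
    isolated_tree H C && (a <= #|C| <= b n)%N]) <= e4.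
  apply: le_trans (small_isolated_trees sG rG alpha0 d0 ad a bd) _; rewrite card_ord.
  have aR : 0 < a%:R :> R by rewrite ltr0n.
  apply: (@le_trans _ _ (n%:R / alpha * expR 1 * (expR (- (5 / 2 * ln a%:R)) *
      (expR (- (eta * a%:R)) / (1 - expR (- eta)))))).
    rewrite ler_wpM2l ?mulr_ge0 ?expR_ge0 ?invr_ge0 ?(ltW alpha0) //.
    apply: (@le_trans _ _ (\sum_(k < n.+1 | (a <= k)%N) expR (- (5 / 2 * ln a%:R)) *
        expR (- (eta * k%:R)))).
      rewrite big_mkcond [leRHS]big_mkcond /=; apply: ler_sum => k _.
      case: (leqP a k) => [ak|ka]; last by rewrite /= andbF.
      case: ifP => [/andP[k0 _]|_]; last by rewrite mulr_ge0 ?expR_ge0.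
      rewrite -expRD ler_expR.
      have : ln a%:R <= ln k%:R :> R by rewrite ler_ln ?posrE ?ltr0n // ler_nat.
      by lra.
    by rewrite -mulr_sumr ler_wpM2l ?expR_ge0 // geometric_tail.
  apply: (@le_trans _ _ (K1 * expR (- (eta * omega n)))).
    have -> : n%:R / alpha * expR 1 * (expR (- (5 / 2 * ln a%:R)) * (expR (- (eta * a%:R))
        / (1 - expR (- eta))))
      = expR 1 / alpha * (n%:R * (expR (- (5 / 2 * ln a%:R)) * expR (- (eta * a%:R))))
          / (1 - expR (- eta)) by ring.
    have -> : K1 * expR (- (eta * omega n)) =
      expR 1 / alpha * (expR (eta - 5 / 2 * ln (2 * eta)^-1) * expR (- (eta * omega n)))
          / (1 - expR (- eta)).
      by rewrite /K1; ring.
    rewrite ler_wpM2r ?invr_ge0 ?(ltW q1) // ler_wpM2l ?divr_ge0 ?expR_ge0 ?(ltW alpha0) //.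
    rewrite -[X in X * _](@lnK R n%:R) ?posrE // -!expRD ler_expR -/L.
    have la : ln (2 * eta)^-1 + ln L <= ln a%:R.
      by rewrite -lnM ?posrE ?invr_gt0 ?mulr_gt0 // ler_ln ?posrE.
    (* Since [a] is at least [ln n / (2 eta)], the power [a^(-5/2)] cancels the [5/2 ln ln n] of the
       threshold up to a constant, and only [exp(- eta omega)] remains. *)
    have ea : L - 5 / 2 * ln L + eta * omega n - eta <= eta * a%:R.
      have -> : L - 5 / 2 * ln L + eta * omega n - eta = eta * (x - 1).
        by rewrite /x /zeta -/L; field; rewrite gt_eqF.
      by rewrite ler_pM2l //; move: xa; rewrite -natr1; lra.
    by move: la ea; lra.
  have ombig : K1 / (eta * e4) <= omega n by near: n; exact: near_pinfty omegainf.
  rewrite expRN ler_pdivrMr ?expR_gt0 //.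
  rewrite ler_pdivrMr ?mulr_gt0 // in ombig.
  apply: le_trans ombig _; rewrite mulrA mulrC ler_pM2l //.
  by apply: le_trans (expR_ge1Dx _); rewrite mulrC lerDr.
have second : subgraph_prob (G n) (p n) (fun H => 1 <= mid n 0 (b n) H) <= e4.
  apply: (@le_trans _ _ (subgraph_mean (G n) (p n) (mid n 0 (b n)))).
    by apply: prob_le_subgraph_mean => // H _; apply: sumr_ge0.
  have mid0 : subgraph_mean (G n) (p n) (mid n 0 (b n)) <= n%:R / alpha * p n ^+ 0 *
    \sum_(k < n.+1 | (b n <= k)%N && (0 < k)%N) k%:R ^+ (2 * 0) * expR (- (eta / 2 * k%:R)).
    by near: n; exact: (near_mid 0 b).
  apply: le_trans mid0 _; rewrite expr0 mulr1.
  apply: (@le_trans _ _ (n%:R / alpha * (expR (- (eta / 2 * (b n)%:R))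
      / (1 - expR (- (eta / 2)))))).
    rewrite ler_wpM2l ?divr_ge0 ?(ltW alpha0) //.
    apply: le_trans (geometric_tail (b n) n.+1 eta20).
    rewrite big_mkcond [leRHS]big_mkcond /=; apply: ler_sum => k _.
    by rewrite expr0 mul1r; case: ifP => [/andP[->]|_] //; case: ifP; rewrite ?expR_ge0.
  apply: (@le_trans _ _ (K2 / n%:R)).
    rewrite /K2; have -> : alpha^-1 / (1 - expR (- (eta / 2))) / n%:R =
       alpha^-1 * n%:R^-1 / (1 - expR (- (eta / 2))) by rewrite mulrAC.
    have -> : n%:R / alpha * (expR (- (eta / 2 * (b n)%:R)) / (1 - expR (- (eta / 2)))) =
      alpha^-1 * (n%:R * expR (- (eta / 2 * (b n)%:R))) / (1 - expR (- (eta / 2))) by ring.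
    rewrite ler_wpM2r ?invr_ge0 ?(ltW q2) // ler_wpM2l ?invr_ge0 ?(ltW alpha0) //.
    rewrite -[leRHS]mul1r ler_pdivlMr // mulrC.
    rewrite -(@lnK R n%:R) ?posrE // -!expRD -/L -[leRHS](expR0) ler_expR.
    have -> : L + (L - eta / 2 * (b n)%:R) = eta / 2 * (A * L - (b n)%:R).
      by rewrite /A; field; rewrite gt_eqF.
    by rewrite pmulr_rle0 // subr_le0 ltW.
  have nbig : K2 / e4 <= n%:R by near: n; exact: near_nat.
  by rewrite ler_pdivrMr // [leRHS]mulrC -ler_pdivrMr.
have third : subgraph_prob (G n) (p n) (fun H => [exists C : {set 'I_n}, [&& C \in components H,
      eps * n%:R <= #|C|%:R & (#|edges_in H C| <= #|C|)%N]]) <= e4.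
  by near: n; exact: near_large.
apply: (@le_trans _ _ (subgraph_prob (G n) (p n) (fun H => [exists C : {set 'I_n},
    isolated_tree H C && (a <= #|C| <= b n)%N] || (1 <= mid n 0 (b n) H)) + e4)).
  apply: le_trans (lerD (lexx _) third).
  apply: prob_union => // H HE; rewrite negbK => /existsP[C /andP[iC Cx]].
  have sH := simple_sub HE sG.
  have /and4P[_ _ _ /eqP tC] := isolated_tree_edges sH iC; have /andP[cC _] := iC.
  have aC : (a <= #|C|)%N by rewrite -(ler_nat R) (le_trans ax).
  have [Cb|bC] := leqP #|C| (b n).
    by left; apply/orP; left; apply/existsP; exists C; rewrite iC aC Cb.
  have [Ce|/ltW Ce] := lerP (#|C|%:R) (eps * n%:R).
    left; apply/orP; right; rewrite /mid (bigD1 C) /=; last first.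
      by rewrite cC Ce addn0 tC leqnn (ltnW bC).
    apply: (@le_trans _ _ (#|C|%:R)); first by rewrite ler1n (component_card_gt0 cC).
    by rewrite lerDl sumr_ge0.
  by right; apply/existsP; exists C; rewrite cC Ce -tC leqnSn.
apply: (@le_trans _ _ ((e4 + e4) + e4)); last by rewrite /e4; lra.
rewrite lerD2r; apply: le_trans (lerD first second).
by apply: prob_union => // H HE /orP.
Unshelve. all: by end_near. Qed.

(** Chebyshev at the single size [k] just above the threshold: the mean grows like [exp(eta w)], and
    the covariance term is [O(k^2 / d)]. *)
Lemma isolated_trees_lower :
  much_larger R S (fun n => (d n)%:R) (fun n => ln n%:R ^+ 2) ->
  whp S G (fun n => p n) (fun n H => [exists C : {set 'I_n},
    isolated_tree H C && (size n - omega n <= #|C|%:R)]).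
Proof.
move=> dn; apply: whp_intro; first exact: near_p01.
(* The inverse of the mean costs [e4] and the covariance [2 * e4], by [inv_expr1B_le], which needs
   [e4 <= 1/2]. *)
move=> e e0; pose e4 := Num.min (e / 4) 2^-1.
have e40 : 0 < e4 by rewrite lt_min divr_gt0 //= invr_gt0.
have [e4e e42] : e4 <= e / 4 /\ e4 <= 2^-1 by apply/andP; rewrite -le_min.
pose Z := eta^-1; have Z0 : 0 < Z by rewrite invr_gt0.
(* As [k <= Z ln n], the three summands serve [2 k^2 <= d], [2 alpha^2 k <= d] and
   [alpha k^2 / d <= e4]. *)
pose M := (2 + 2 * alpha ^+ 2 + alpha / e4) * Z ^+ 2.
have M0 : 0 < M.
  rewrite mulr_gt0 ?exprn_gt0 // addr_gt0 //; last exact: divr_gt0.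
  by rewrite addr_gt0 // mulr_gt0 // exprn_gt0.
pose K3 := expR (- eta - 5 / 2 * ln Z - 2) / (2 * alpha).
have K30 : 0 < K3 by rewrite divr_gt0 ?expR_gt0 // mulr_gt0.
have ln2pos : \forall n \near along S, 0 < ln n%:R ^+ 2 :> R.
  by apply: filterS (near_ln S 1) => n n1; rewrite exprn_gt0 // (lt_le_trans _ n1).
near=> n.
have [[Sn n0 sG rG] [[d0 ad pe /andP[de0 de]] mix]] : regime n 2^-1.
  by near: n; apply: near_regime; rewrite invr_gt0.
have /andP[p0 p1] : 0 <= p n <= 1 by near: n; exact: near_p01.
have nR : 0 < n%:R :> R by rewrite ltr0n.
have dR : 0 < (d n)%:R :> R by rewrite ltr0n.
have L1 : 1 <= ln n%:R :> R by near: n; exact: near_ln.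
have LL0 : 4 * eta <= ln (ln n%:R) by near: n; exact: near_lnln.
have LL1 : 1 <= ln (ln n%:R) :> R by near: n; exact: near_lnln.
have sz : (2 * eta)^-1 * ln n%:R <= size n by near: n; exact: near_size.
have dM : M * ln n%:R ^+ 2 <= (d n)%:R by near: n; apply: near_much_larger M0 dn ln2pos.
have om1 : 1 <= omega n by near: n; exact: near_pinfty omegainf.
(* Chosen so that [K3 * (eta * W)] is [1 / e4], a lower bound for the mean. *)
pose W := (eta * (e4 * K3))^-1.
have omW : W <= omega n by near: n; exact: near_pinfty omegainf.
have lnW : W <= ln (ln n%:R) by near: n; exact: near_lnln.
have d2a : 2 * alpha <= (d n)%:R by near: n; exact: near_pinfty dinf.
(* If [omega] grows fast then [size n - omega n] may be negative, so truncate it. *)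
pose w := Num.min (omega n) (ln (ln n%:R)).
have w1 : 1 <= w by rewrite le_min om1.
have wW : W <= w by rewrite le_min omW.
have [wo wl] : w <= omega n /\ w <= ln (ln n%:R) by apply/andP; rewrite -le_min.
set L := ln n%:R in L1 LL0 LL1 sz dM lnW w w1 wW wo wl *.
have L0 : 0 < L by rewrite (lt_le_trans _ L1).
have LLL : 2 * eta * ln L <= L.
  have := sqr_half_le_expR (le_trans ler01 LL1); rewrite lnK ?posrE //.
  apply: le_trans; rewrite expr2 -[leRHS]mulrA [leLHS]mulrC ler_wpM2l ?(le_trans ler01 LL1) //.
  by rewrite ler_pdivlMr //; move: LL0; lra.
pose x := size n - w.
have x0 : 0 <= x.
  rewrite subr_ge0 (le_trans wl) // (le_trans _ sz) //.
  by rewrite -ler_pdivrMl ?invr_gt0 ?mulr_gt0 // invrK.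
(* Rounding up puts [k] above [x]; the excess of at most 1 costs the factor [expR (- eta)] in
   [K3]. *)
pose k := (Num.truncn x).+1.
have [kx xk] : k%:R <= x + 1 /\ x < k%:R.
  have /andP[t1 t2] := truncn_itv x0; split; last exact: t2.
  by rewrite /k -natr1 lerD2r.
have kR : 0 < k%:R :> R by rewrite ltr0n.
have kZ : k%:R <= Z * L.
  apply: le_trans kx _; rewrite /x /zeta -/L -/Z mulrBr.
  have : 0 <= Z * (5 / 2 * ln L) by rewrite !mulr_ge0 ?(ltW Z0) // (le_trans ler01 LL1).
  move: w1; lra.
have k2 : k%:R ^+ 2 <= Z ^+ 2 * L ^+ 2.
  by rewrite -exprMn; apply: lerXn2r; rewrite ?nnegrE // mulr_ge0 // ltW.
have kd : (2 + 2 * alpha ^+ 2 + alpha / e4) * k%:R ^+ 2 <= (d n)%:R.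
  apply: le_trans dM; rewrite /M -mulrA ler_wpM2l //.
  by rewrite addr_ge0 ?divr_ge0 ?(ltW alpha0) ?(ltW e40) // addr_ge0 // mulr_ge0 // exprn_ge0 //
      ltW.
have k20 : 0 <= k%:R ^+ 2 :> R by rewrite exprn_ge0.
have t1 : 0 <= 2 * alpha ^+ 2 * k%:R ^+ 2 by rewrite mulr_ge0 // mulr_ge0 // exprn_ge0 // ltW.
have t2 : 0 <= alpha / e4 * k%:R ^+ 2 by rewrite mulr_ge0 // divr_ge0 // ltW.
have kd1 : (2 * k ^ 2 <= d n)%N.
  by rewrite -(ler_nat R) natrM natrX; move: kd t1 t2; rewrite !mulrDl; lra.
have kd2 : 2 * alpha ^+ 2 * k%:R <= (d n)%:R.
  apply: (@le_trans _ _ (2 * alpha ^+ 2 * k%:R ^+ 2)).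
    by rewrite ler_wpM2l ?mulr_ge0 ?exprn_ge0 ?(ltW alpha0) // expr2 ler_peMl // ler1n.
  by move: kd t2; rewrite !mulrDl; lra.
have kd3 : p n * k%:R ^+ 2 <= e4.
  have h : alpha / e4 * k%:R ^+ 2 <= (d n)%:R by move: kd t1; rewrite !mulrDl; lra.
  by rewrite mulrAC ler_pdivrMr // -ler_pdivrMl // mulrA [_ * alpha]mulrC.
have mu_ge := mean_isolated_trees_expR sG rG alpha0 d0 ad (ltn0Sn _ : (0 < k)%N) kd1 kd2 d2a.
rewrite card_ord in mu_ge.
have muW : e4^-1 <= mean_isolated_trees (G n) (d n) alpha k.
  apply: le_trans mu_ge.
  have lnk : ln k%:R <= ln Z + ln L by rewrite -lnM ?posrE // ler_ln ?posrE // mulr_gt0.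
  have ek : eta * k%:R <= L - 5 / 2 * ln L - eta * w + eta.
    have -> : L - 5 / 2 * ln L - eta * w + eta = eta * (x + 1).
      by rewrite /x /zeta -/L; field; rewrite gt_eqF.
    by rewrite ler_pM2l.
  apply: (@le_trans _ _ (K3 * expR (eta * w))).
    apply: (@le_trans _ _ (K3 * (eta * w))).
      have -> : e4^-1 = K3 * (eta * W) by rewrite /W; field; rewrite !gt_eqF.
      by rewrite ler_pM2l // ler_pM2l.
    by rewrite ler_pM2l //; apply: le_trans (expR_ge1Dx _); rewrite lerDr.
  rewrite /K3 mulrAC [leRHS]mulrAC ler_wpM2r ?invr_ge0 ?mulr_ge0 ?(ltW alpha0) //.
  rewrite -(@lnK R n%:R) ?posrE // -!expRD ler_expR -/L.
  by move: lnk ek; lra.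
have mu0 : 0 < mean_isolated_trees (G n) (d n) alpha k.
  by rewrite (lt_le_trans _ muW) // invr_gt0.
have p1' : p n < 1 by rewrite (le_lt_trans pe) // invf_lt1 // ltr1n.
apply: (@le_trans _ _ (subgraph_prob (G n) (p n) (fun H =>
    ~~ [exists C : {set 'I_n}, isolated_tree H C && (#|C| == k)]))).
  apply: prob_le => // H HE; apply: contra => /existsP[C /andP[iC /eqP Ck]].
  apply/existsP; exists C; rewrite iC Ck /= (le_trans _ (ltW xk)) //.
  by rewrite /x lerD2l lerN2.
apply: le_trans (second_moment sG alpha0 d0 ad p1' mu0) _.
have muV : (mean_isolated_trees (G n) (d n) alpha k)^-1 <= e4.
  by rewrite -[e4]invrK lef_pV2 ?posrE ?invr_gt0.
have pk : (k ^ 2)%:R * p n <= e4 by rewrite natrX mulrC.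
have := inv_expr1B_le (introT andP (conj p0 p1)) pk e42.
by move: muV e4e; move: (_^-1) (_ ^- _) => u v; lra.
Unshelve. all: by end_near. Qed.

End Asymptotic.

Local Open Scope classical_set_scope.
Local Open Scope ring_scope.

Theorem theorem2 (R : realType) (alpha : R) (S : set nat)
    (G : forall n : nat, {set {set 'I_n}}) (d : nat -> nat)
    (omega : nat -> R) :
  0 < alpha -> alpha != 1 ->
  infinite_set S -> (forall n, S n -> (0 < n)%N) ->
  (forall n, S n -> simple_graph (G n) /\ regular (d n) (G n)) ->
  (d n)%:R @[n --> along S] --> (+oo : set_system R) ->
  (fun n => second_eigenvalue R (G n) : R^o)
    =o_ (along S) (fun n => (d n)%:R : R^o) ->
  omega n @[n --> along S] --> +oo ->
  let p := fun n : nat => alpha / (d n)%:R in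
  let size := fun n : nat =>
    zeta alpha * (ln n%:R - 5 / 2 * ln (ln n%:R)) in
  [/\ (much_larger R S (fun n => (d n)%:R) (fun n => ln n%:R ^+ 2) ->
        whp S G p (fun n H =>
          ~~ [exists C : {set 'I_n},
               isolated_tree H C && (size n + omega n <= #|C|%:R)])),
      (much_larger R S (fun n => (d n)%:R) (fun n => ln n%:R ^+ 2) ->
        whp S G p (fun n H =>
          [exists C : {set 'I_n},
            isolated_tree H C && (size n - omega n <= #|C|%:R)])),
      ((fun n => (d n)%:R : R^o) =Omega_ (along S) (fun n => n%:R : R^o) ->
        whp S G p (fun n H => #|unicyclic_vertices H|%:R <= omega n)),
      (much_larger R S (fun n => (d n)%:R) (fun n => Num.sqrt n%:R) ->
        alpha < 1 ->
        whp S G p (fun n H => ~~ [exists C, excess_component H C]))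
    & (much_larger R S (fun n => (d n)%:R) (fun n => Num.sqrt n%:R) ->
        1 < alpha ->
        forall s : nat -> R,
          (fun n => s n : R^o) =o_ (along S) (fun n => n%:R : R^o) ->
          whp S G p (fun n H =>
            ~~ [exists C : {set 'I_n},
                 excess_component H C && (#|C|%:R <= s n)]))].
Proof.
move=> alpha0 alpha1 _ Spos GS dinf lamd omegainf p size.
have eta0 := eta_gt0 alpha0 alpha1.
pose eps := (alpha - 1 - ln alpha) / (4 * alpha).
have eps0 : 0 < eps by rewrite divr_gt0 // mulr_gt0.
have alpha_eps : alpha * eps = (alpha - 1 - ln alpha) / 4.
  by rewrite /eps; field; rewrite gt_eqF.
split.
- exact: (isolated_trees_upper alpha0 alpha1 Spos GS dinf lamd omegainf eps0 alpha_eps).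
- exact: (isolated_trees_lower alpha0 alpha1 Spos GS dinf lamd omegainf).
- exact: (unicyclic_vertices_bound alpha0 alpha1 Spos GS dinf lamd omegainf eps0 alpha_eps).
- by move=> dn; apply: (excess_subcritical alpha0 alpha1 Spos GS dinf lamd eps0 alpha_eps dn).
- by move=> dn a1 s; apply: (excess_supercritical alpha0 alpha1 Spos GS dinf lamd eps0 alpha_eps
    dn).
Qed.
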